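(* Let $q$ be a positive integer and let $\hat p_1,\hat p_2,\hat s_1,\hat s_2$ be integers with $\gcd(\hat p_1,\hat p_2,q)=1$, $\gcd(\hat s_1,\hat s_2,q)=1$, $\hat p_1\not\equiv\pm\hat p_2 \pmod q$ and $\hat s_1\not\equiv\pm\hat s_2\pmod q$. Let $$\gamma_1=\begin{pmatrix}R(\hat p_1/q)&0\\0&R(\hat p_2/q)\end{pmatrix},\qquad \gamma_2=\begin{pmatrix}R(\hat s_1/q)&0\\0&R(\hat s_2/q)\end{pmatrix},$$ $G_1=\langle\gamma_1\rangle$, $G_2=\langle\gamma_2\rangle$, and consider the orbifold lens spaces $O_1=\mathbb{S}^3/G_1$ and $O_2=\mathbb{S}^3/G_2$. Write - $q_{11}=\gcd(\hat p_1,q)$, $q_{21}=\gcd(\hat p_2,q)$, $\hat p_1=p_1q_{11}$, $\hat p_2=p_2q_{21}$, $q=\hat\alpha_1q_{11}=\hat\beta_1q_{21}$, $g_1=\gcd(\hat\alpha_1,\hat\beta_1)$, $\hat\alpha_1=\alpha_1g_1$, $\hat\beta_1=\beta_1g_1$; - $q_{12}=\gcd(\hat s_1,q)$, $q_{22}=\gcd(\hat s_2,q)$, $\hat s_1=s_1q_{12}$, $\hat s_2=s_2q_{22}$, $q=\hat\alpha_2q_{12}=\hat\beta_2q_{22}$, $g_2=\gcd(\hat\alpha_2,\hat\beta_2)$, $\hat\alpha_2=\alpha_2g_2$, $\hat\beta_2=\beta_2g_2$. If $\alpha_1=\alpha_2$ and $\beta_1=\beta_2$, then $O_1$ and $O_2$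 have exactly the same asymptotic expansion of the heat trace as $t\to0^+$.
   Context: For $\theta\in\mathbb{R}$, $R(\theta)=\begin{pmatrix}\cos 2\pi\theta & \sin 2\pi\theta\\ -\sin 2\pi\theta & \cos 2\pi\theta\end{pmatrix}$. $\mathbb{S}^3$ is the unit sphere in $\mathbb{R}^4$ with the round metric, and $\mathbb{S}^3/G$ carries the induced Riemannian orbifold structure ($G$ may have elements with fixed points). Functions on $\mathbb{S}^3/G$ are $G$-invariant functions on $\mathbb{S}^3$, and the Laplacian on $\mathbb{S}^3/G$ is the Laplacian of $\mathbb{S}^3$ restricted to $G$-invariant smooth functions. If $\lambda_1\le\lambda_2\le\cdots$ is the spectrum (with multiplicity) of the Laplacian on a compact Riemannian orbifold $O$ of dimension $d$, its heat trace is $Z_O(t)=\sum_{j\ge1}e^{-\lambda_jt}$, which as $t\to0^+$ has an asymptotic expansion $Z_O(t)\sim(4\pi t)^{-d/2}\sum_{j=0}^\infty c_j(O)t^{j/2}$ with constants $c_j(O)$. Having the same asymptotic expansion means $c_j(O_1)=c_j(O_2)$ for all $j\ge0$. *)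

(* Defs.v *)
From HB Require Import structures.
From mathcomp Require Import all_boot all_order all_algebra.
From mathcomp Require Import all_classical all_reals all_analysis.

Set Implicit Arguments.
Unset Strict Implicit.
Unset Printing Implicit Defensive.

Import Order.TTheory GRing.Theory Num.Theory numFieldNormedType.Exports.

Local Open Scope classical_set_scope.
Local Open Scope card_scope.
Local Open Scope ring_scope.

Section RoundThreeSphere.
Context {R : realType}.
Implicit Types (f : 'cV[R]_4 -> R) (X : 'cV[R]_4 -> 'cV[R]_4) (x : 'cV[R]_4).

(* The library norm on matrices is the sup norm. *)
Definition euclid_norm x : R := Num.sqrt (\sum_(i < 4) x i ord0 ^+ 2).

Definition S3 : set 'cV[R]_4 := [set x | euclid_norm x = 1].

Definition partial (i : 'I_4) f : 'cV[R]_4 -> R :=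
  fun x => 'D_(delta_mx i ord0 : 'cV[R]_4) f x.

(* [iter_partial [:: i1; ...; ik] f] is the k-th order partial derivative
   d_i1 (... (d_ik f)). *)
Definition iter_partial (s : seq 'I_4) f : 'cV[R]_4 -> R := foldr partial f s.

Definition smooth_on (U : set 'cV[R]_4) f : Prop :=
  forall (s : seq 'I_4) x, U x ->
    {for x, continuous (iter_partial s f)} /\
    forall i : 'I_4, derivable (iter_partial s f) x (delta_mx i ord0 : 'cV[R]_4).

(* A function on S3 is represented by a function on R^4 of which only the
   values on S3 matter; [radial] extends these values to R^4 minus the origin,
   constantly along rays. *)
Definition radial (T : Type) (F : 'cV[R]_4 -> T) : 'cV[R]_4 -> T :=
  fun x => F ((euclid_norm x)^-1 *: x).

Definition smooth_on_S3 f : Prop := smooth_on [set x | x != 0] (radial f).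

(* The radial derivative of [radial f] vanishes, so at a point of S3 its
   Euclidean gradient is tangent to S3: it is the Riemannian gradient of f. *)
Definition sphere_grad f : 'cV[R]_4 -> 'cV[R]_4 :=
  fun x => \col_i partial i (radial f) x.

(* For a tangent field X, the divergence on S3 is the trace over the tangent
   space of the tangential part of DX; since the normal derivative of
   [radial X] vanishes, this is its full Euclidean divergence at points of S3. *)
Definition sphere_div X : 'cV[R]_4 -> R :=
  fun x => \sum_(i < 4) partial i (radial (fun y => X y i ord0)) x.

(* Sign convention: the Laplacian is - div grad, with nonnegative spectrum. *)
Definition sphere_laplacian f : 'cV[R]_4 -> R :=
  fun x => - sphere_div (sphere_grad f) x.

End RoundThreeSphere.

Section SphericalOrbifold.
Context {R : realType}.

(* The orbifold S3/G is represented by the group G of orthogonal matrices. *)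
Implicit Types G : set 'M[R]_4.

Definition invariant_on_S3 G (f : 'cV[R]_4 -> R) : Prop :=
  forall g x, G g -> S3 x -> f (g *m x) = f x.

Definition eigenspace_S3 G (mu : R) : set ('cV[R]_4 -> R) :=
  [set f | [/\ smooth_on_S3 f, invariant_on_S3 G f &
               forall x, S3 x -> sphere_laplacian f x = mu * f x]].

(* Linear (in)dependence is that of the restrictions to S3. *)
Definition has_dim_on_S3 (V : set ('cV[R]_4 -> R)) (n : nat) : Prop :=
  exists b : 'I_n -> 'cV[R]_4 -> R,
    [/\ forall i, V (b i),
        forall a : 'I_n -> R,
          (forall x, S3 x -> \sum_i a i * b i x = 0) -> forall i, a i = 0 &
        forall f, V f -> exists a : 'I_n -> R,
          forall x, S3 x -> f x = \sum_i a i * b i x].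

(* [lam 0 <= lam 1 <= ...] lists the eigenvalues, each repeated according to
   its multiplicity (which is 0 when mu is not an eigenvalue). *)
Definition is_spectrum G (lam : nat -> R) : Prop :=
  {homo lam : j k / (j <= k)%N >-> j <= k} /\
  forall mu : R, exists n : nat,
    has_dim_on_S3 (eigenspace_S3 G mu) n /\ [set j | lam j = mu] #= `I_n.

Definition is_heat_trace G (Z : R -> R) : Prop :=
  exists lam : nat -> R, is_spectrum G lam /\
    forall t : R, 0 < t -> series (fun j => expR (- lam j * t)) @ \oo --> Z t.

(* Z(t) ~ (4 pi t)^(-d/2) * sum_j c_j t^(j/2) as t -> 0+ *)
Definition heat_asymptotics (d : nat) (Z : R -> R) (c : nat -> R) : Prop :=
  forall N : nat,
    (fun t : R => Z t - (4 * pi * t) `^ (- (d%:R / 2)) *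
                        \sum_(j < N.+1) c j * t `^ (j%:R / 2))
      =o_ (0^'+) (fun t : R => t `^ ((N%:R - d%:R) / 2)).

Definition has_heat_expansion G (c : nat -> R) : Prop :=
  exists Z : R -> R, is_heat_trace G Z /\ heat_asymptotics 3 Z c.

(* Asymptotic coefficients are unique, so sharing one sequence of coefficients
   means that both expansions exist and agree term by term. *)
Definition same_heat_expansion G1 G2 : Prop :=
  exists c : nat -> R, has_heat_expansion G1 c /\ has_heat_expansion G2 c.

End SphericalOrbifold.

Section LensSpaces.
Context (R : realType).

Definition rot2 (theta : R) : 'M[R]_2 :=
  \matrix_(i < 2, j < 2)
    if i == j then cos (2 * pi * theta)
    else if (i < j)%N then sin (2 * pi * theta) else - sin (2 * pi * theta).

Definition lens_gen (q p1 p2 : int) : 'M[R]_4 :=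
  block_mx (rot2 (p1%:~R / q%:~R)) 0 0 (rot2 (p2%:~R / q%:~R)) : 'M[R]_(2 + 2).

Definition lens_group (q p1 p2 : int) : set 'M[R]_4 :=
  [set lens_gen q p1 p2 ^ n | n in [set: int]].

End LensSpaces.

Arguments lens_gen R q p1 p2 : clear implicits.
Arguments lens_group R q p1 p2 : clear implicits.

(* Main.v *)
(* Write n = k + 1 and let mult n be the number of (i, j) in [0, k]^2 such that q
   divides (i + j - k) p1 + (i - j) p2. The eigenvalues of the Laplacian of the
   3-sphere are the k (k + 2) = n^2 - 1, and the eigenspace has a basis indexed by
   the (i, j), made of functions of weight (m1, m2) = (i + j - k, i - j) under the
   rotations of the two complex coordinates times a Jacobi polynomial in |z|^2.
   The generator of the group rotates the span of the functions of weights
   (m1, m2) and (- m1, - m2) by the angle 2 pi (m1 p1 + m2 p2) / q, so the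
   invariant functions form a space of dimension mult n, and the heat trace is
   e^t sum_n mult n e^(- t n^2).

   Detecting divisibility by q with roots of unity, q mult n is the sum over r < q
   of characters X_r n = U_n u U_n v, where U_n is the Chebyshev character and
   u + v = 2 pi r p1 / q, u - v = 2 pi r p2 / q. Each X_r is annihilated by
   (dd + A) (dd + B), where dd is the second difference, A = 2 - 2 cos (u + v) and
   B = 2 - 2 cos (u - v). If A and B are nonzero, summation by parts shows that
   sum_n X_r n e^(- t n^2) decays faster than any power of t; if exactly one of
   them vanishes, X_r is 2 / (A + B) plus a sequence with this property; and
   X_0 n = n^2. As the theta sums with coefficients 1 and n^2 are a power of t up
   to rapidly decaying terms, the whole expansion depends only on q and on the sum
   of the 2 / (A + B) over the r of the second kind, which is a function of
   gcd(p1, q) and gcd(p2, q). These two integers are beta and alpha. *)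
Require Import Defs.
From HB Require Import structures.
From mathcomp Require Import all_boot all_order all_algebra.
From mathcomp Require Import all_classical all_reals all_analysis.
From mathcomp Require Import zify ring lra.

Set Implicit Arguments.
Unset Strict Implicit.
Unset Printing Implicit Defensive.

Import Order.TTheory GRing.Theory Num.Theory numFieldNormedType.Exports.
Local Open Scope classical_set_scope.
Local Open Scope ring_scope.

(** What shapes the proof is that eigenspaces contain arbitrary smooth functions: the explicit ones
    must be shown to exhaust the spectrum. Instead of the symmetry of the Laplacian, which rests on
    Stokes' theorem, the maximum principle is used. It bounds the resolvent in sup norm, so a finite
    combination close to an eigenfunction stays close to it after both are acted on by the
    resolvent, and this kills the coefficients in the wrong degrees. The integral then only has to
    be linear, bounded by the sup norm, positive, and such that the explicit functions are
    orthogonal; a limit of Riemann sums in Hopf coordinates is enough. Completeness comes from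
    uniform density, by Bernstein's probabilistic argument. The theta sums are evaluated without
    Poisson summation. A Riemann sum gives the constant up to O(tau), where tau is the square root
    of t. Passing from tau to 2 tau leaves an alternating sum, again of the oscillating kind, and so
    the error decays rapidly. Index 0 gets half weight, as in half a sum over all integers, which
    removes the boundary term at 0 from summation by parts. *)

(** * Chain rule for directional derivatives *)

Section DirectionalDerivatives.
Context {R : realType} {V : normedModType R}.
Implicit Types (f : V -> R) (x v : V).

(** Both difference quotients are the same function of the increment, so one-variable results, the
    chain rule above all, carry over to directional derivatives. *)
Lemma is_derive_line f x v df :
  is_derive x v f df <-> is_derive (0 : R) 1 (fun h : R => f (h *: v + x)) df.
Proof.
have E : 'D_v f x = 'D_1 (fun h : R => f (h *: v + x)) (0 : R).
  rewrite /derive; congr (lim _); apply: (f_equal (fun g => g @ 0^')).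
  by apply/funext => h /=; rewrite addr0 scale0r add0r [_%:A]mulr1.
split=> -[d e]; split.
- exact: (derivable1P f x v).1 d.
- by rewrite -E.
- exact: (derivable1P f x v).2 d.
- by rewrite E.
Qed.

Lemma is_derive_comp1 f (g : R -> R) x v df dg :
  is_derive (f x) 1 g dg -> is_derive x v f df ->
  is_derive x v (fun y => g (f y)) (dg * df).
Proof.
move=> Hg /is_derive_line Hf; apply/is_derive_line.
by apply: (@is_derive1_comp _ g _ 0 dg df) => //; rewrite scale0r add0r.
Qed.

Lemma is_derive_inv_comp f x v df :
  f x != 0 -> is_derive x v f df ->
  is_derive x v (fun y => (f y)^-1) (- (f x) ^- 2 * df).
Proof.
move=> fx0; apply: is_derive_comp1.
have H := @is_deriveV R id (f x) 1 1 fx0 (@is_derive_id R R (f x) 1).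
by apply: is_derive_eq H _; rewrite [_ *: _]mulr1.
Qed.

End DirectionalDerivatives.

(** * Explicit smooth functions on R^4 minus the origin, differentiated symbolically *)

Section Expressions.
Context {R : realType}.
Local Notation E4 := 'cV[R]_4.
Implicit Types (x : E4) (i j : 'I_4).

Definition basis4 i : E4 := delta_mx i ord0.

Lemma is_derive_coord x j i :
  is_derive x (basis4 i) (fun y : E4 => y j ord0) (i == j)%:R.
Proof.
have d : derivable (@id E4) x (basis4 i) by exact: derivable_id.
split; first by have /derivable_mxP := d; apply.
have := derive_mx d; rewrite derive_id => /matrixP/(_ j ord0).
by rewrite !mxE eqxx andbT eq_sym => ->.
Qed.

Lemma euclid_normsq x : euclid_norm x ^+ 2 = \sum_(i < 4) x i ord0 ^+ 2.
Proof. by rewrite /euclid_norm sqr_sqrtr// sumr_ge0// => i _; exact: sqr_ge0. Qed.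

Lemma euclid_norm_ge0 x : 0 <= euclid_norm x.
Proof. exact: sqrtr_ge0. Qed.

Lemma normsq_gt0 x : x != 0 -> 0 < \sum_(i < 4) x i ord0 ^+ 2.
Proof.
move=> x0; rewrite lt_def sumr_ge0 ?andbT; last by move=> i _; exact: sqr_ge0.
apply: contra x0; rewrite psumr_eq0 => [/allP h|i _]; last exact: sqr_ge0.
apply/eqP/matrixP => i j; rewrite ord1 !mxE.
by have /(_ (mem_index_enum i)) := h i; rewrite /= sqrf_eq0 => /eqP.
Qed.

Lemma euclid_norm_gt0 x : x != 0 -> 0 < euclid_norm x.
Proof. by move=> x0; rewrite sqrtr_gt0 normsq_gt0. Qed.

Lemma euclid_norm0 : euclid_norm (0 : E4) = 0.
Proof. by rewrite /euclid_norm big1 ?sqrtr0// => i _; rewrite mxE expr0n. Qed.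

Lemma S3_neq0 x : S3 x -> x != 0.
Proof.
by apply: contraPneq => ->; rewrite /S3 /= euclid_norm0 => /esym/eqP; rewrite oner_eq0.
Qed.

Lemma euclid_normZ (c : R) x : 0 <= c -> euclid_norm (c *: x) = c * euclid_norm x.
Proof.
move=> c0; rewrite /euclid_norm; under eq_bigr do rewrite mxE exprMn.
by rewrite -big_distrr/= sqrtrM ?sqr_ge0// sqrtr_sqr ger0_norm.
Qed.

Lemma S3_normalize x : x != 0 -> S3 ((euclid_norm x)^-1 *: x).
Proof.
move=> x0; rewrite /S3 /= euclid_normZ ?invr_ge0 ?euclid_norm_ge0// mulVf//.
by rewrite gt_eqF// euclid_norm_gt0.
Qed.

Lemma radialE (T : Type) (f : E4 -> T) x : S3 x -> radial f x = f x.
Proof. by rewrite /S3 /radial /= => ->; rewrite invr1 scale1r. Qed.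

(** A syntax closed under the partial derivatives [D]: smoothness and derivatives of all the
    explicit functions below follow by structural recursion. [Pol] keeps a polynomial as one block,
    so that its differential equation remains usable. *)
Inductive expr :=
| Cst of R
| Var of 'I_4
| Add of expr & expr
| Mul of expr & expr
| InvNorm
| Pol of {poly R} & expr.

Fixpoint eval (e : expr) x : R :=
  match e with
  | Cst c => c
  | Var i => x i ord0
  | Add a b => eval a x + eval b x
  | Mul a b => eval a x * eval b x
  | InvNorm => (euclid_norm x)^-1
  | Pol p a => p.[eval a x]
  end.

Fixpoint D i (e : expr) : expr :=
  match e with
  | Cst c => Cst 0
  | Var j => Cst (i == j)%:R
  | Add a b => Add (D i a) (D i b)
  | Mul a b => Add (Mul (D i a) b) (Mul a (D i b))
  | InvNorm => Mul (Cst (-1)) (Mul (Var i) (Mul InvNorm (Mul InvNorm InvNorm)))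
  | Pol p a => Mul (Pol p^`() a) (D i a)
  end.

Lemma is_derive_invnorm x i : x != 0 ->
  is_derive x (basis4 i) (fun y : E4 => (euclid_norm y)^-1)
    (- (x i ord0 * (euclid_norm x)^-1 ^+ 3)).
Proof.
move=> x0; have n0 := normsq_gt0 x0; have e0 := euclid_norm_gt0 x0.
have d1 : is_derive x (basis4 i) (fun y : E4 => \sum_(j < 4) y j ord0 ^+ 2)
    (2 * x i ord0).
  have := @is_derive_sum _ _ _ 4 (fun j => (fun y : E4 => y j ord0) ^+ 2) x
    (basis4 i) _ (fun j => is_deriveX 2 (is_derive_coord x j i)).
  rewrite (_ : \sum_(j < 4) _ = (fun y : E4 => \sum_(j < 4) y j ord0 ^+ 2)); last first.
    by apply/funext => y; rewrite fct_sumE.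
  move=> /is_derive_eq; apply; rewrite (bigD1 i)//= eqxx big1 ?addr0 ?scaler1//.
  by move=> j /negPf; rewrite eq_sym => ->; rewrite scaler0.
have d2 := is_derive_comp1 (is_derive1_sqrt n0) d1.
have := is_derive_inv_comp (lt0r_neq0 e0 : euclid_norm x != 0) d2.
move=> /is_derive_eq; apply; rewrite -[Num.sqrt _]/(euclid_norm x) /=.
by field; rewrite gt_eqF.
Qed.

Lemma is_derive_eval (e : expr) x i : x != 0 ->
  is_derive x (basis4 i) (eval e) (eval (D i e) x).
Proof.
move=> x0; elim: e => [c|j|a IHa b IHb|a IHa b IHb||p a IHa] /=.
- exact: is_derive_cst.
- exact: is_derive_coord.
- exact: is_deriveD.
- by apply: is_derive_eq (is_deriveM IHa IHb) _; rewrite addrC [_ *: _]mulrC.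
- apply: is_derive_eq (is_derive_invnorm i x0) _; rewrite /=; ring.
- exact: is_derive_comp1 (is_derive_poly p _) IHa.
Qed.

Lemma partial_eval e x i : x != 0 -> partial i (eval e) x = eval (D i e) x.
Proof. by move=> /(is_derive_eval e i) /@derive_val. Qed.

Definition punctured : set E4 := [set x | x != 0].

Lemma open_punctured : open punctured.
Proof.
rewrite (_ : punctured = ~` [set 0]); last by apply/seteqP; split => x /=; [move/eqP|move/eqP].
apply: closed_openC; exact: (@accessible_closed_set1 _ (hausdorff_accessible (@norm_hausdorff _ _)) 0).
Qed.

Lemma near_punctured x : x != 0 -> \forall y \near x, y != 0.
Proof. by move=> x0; apply: open_nbhs_nbhs; split => //; exact: open_punctured. Qed.

Lemma continuous_coord j : continuous (fun y : E4 => y j ord0).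
Proof. exact: coord_continuous. Qed.

Lemma continuous_normsq : continuous (fun y : E4 => \sum_(j < 4) y j ord0 ^+ 2).
Proof.
move=> x; rewrite (_ : (fun y => _) = \sum_(j < 4) (fun y : E4 => y j ord0 ^+ 2)).
  apply: (@big_ind _ (fun f => {for x, continuous f})).
  - exact: (@cst_continuous _ _ (0:R)).
  - by move=> f g cf cg; apply: continuousD.
  - move=> j _; apply: (@continuous_comp _ _ _ (fun y : E4 => y j ord0) (fun z : R => z ^+ 2)).
      exact: continuous_coord.
    exact: exprn_continuous.
by apply/funext => y; rewrite fct_sumE.
Qed.

Lemma continuous_euclid_norm : continuous (@euclid_norm R).
Proof.
move=> x; apply: (@continuous_comp _ _ _ _ Num.sqrt x (continuous_normsq (x := x))).
exact: sqrt_continuous.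
Qed.

Lemma continuous_eval e x : x != 0 -> {for x, continuous (eval e)}.
Proof.
move=> x0; elim: e => [c|j|a IHa b IHb|a IHa b IHb||p a IHa] /=.
- exact: cst_continuous.
- exact: continuous_coord.
- exact: (@continuousD _ _ _ (eval a) (eval b)).
- exact: (@continuousM _ _ (eval a) (eval b)).
- apply: (@continuousV _ _ (@euclid_norm R)); first by rewrite gt_eqF// euclid_norm_gt0.
  exact: continuous_euclid_norm.
- exact: (continuous_comp IHa (@continuous_horner _ p _)).
Qed.

Lemma partial_near (f g : E4 -> R) x i : (\forall y \near x, f y = g y) ->
  partial i f x = partial i g x.
Proof. by move=> fg; rewrite /partial; exact: near_eq_derive. Qed.

Lemma iter_partial_eq (U : set E4) (f g : E4 -> R) : open U ->
  (forall x, U x -> f x = g x) ->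
  forall s x, U x -> iter_partial s f x = iter_partial s g x.
Proof.
move=> oU fg; elim=> [|i s IH] x Ux /=; first exact: fg.
apply: partial_near; have : nbhs x U by apply: open_nbhs_nbhs.
by apply: filterS => y; exact: IH.
Qed.

Lemma smooth_on_eq (U : set E4) (f g : E4 -> R) : open U ->
  (forall x, U x -> f x = g x) -> smooth_on U f -> smooth_on U g.
Proof.
move=> oU fg sf s x Ux; have [cf df] := sf s x Ux.
have H : \forall y \near x, iter_partial s f y = iter_partial s g y.
  have : nbhs x U by apply: open_nbhs_nbhs.
  by apply: filterS => y Uy; exact: (iter_partial_eq oU fg).
split=> [|i]; last exact: near_eq_derivable H (df i).
rewrite /prop_for /continuous_at -(iter_partial_eq oU fg)//.
exact: cvg_trans (near_eq_cvg H) cf.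
Qed.

Lemma iter_partial_lin (U : set E4) (f g : E4 -> R) (a b : R) : open U ->
  smooth_on U f -> smooth_on U g ->
  forall s x, U x -> iter_partial s (fun y => a * f y + b * g y) x =
    a * iter_partial s f x + b * iter_partial s g x.
Proof.
move=> oU sf sg; elim=> [|i s IH] x Ux //=.
have H : \forall y \near x, iter_partial s (fun y => a * f y + b * g y) y =
   a * iter_partial s f y + b * iter_partial s g y.
  have : nbhs x U by apply: open_nbhs_nbhs.
  by apply: filterS => y Uy; exact: IH.
rewrite (partial_near i H); have [_ /(_ i) df] := sf s x Ux.
have [_ /(_ i) dg] := sg s x Ux; rewrite /partial.
rewrite [LHS](@deriveD _ _ _ (a *: iter_partial s f) (b *: iter_partial s g)); [|exact: derivableZ..].
by rewrite !deriveZ.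
Qed.

Lemma smooth_on_lin (U : set E4) (f g : E4 -> R) (a b : R) : open U ->
  smooth_on U f -> smooth_on U g -> smooth_on U (fun y => a * f y + b * g y).
Proof.
move=> oU sf sg s x Ux; have [cf df] := sf s x Ux; have [cg dg] := sg s x Ux.
have H : \forall y \near x, a * iter_partial s f y + b * iter_partial s g y =
   iter_partial s (fun y => a * f y + b * g y) y.
  have : nbhs x U by apply: open_nbhs_nbhs.
  by apply: filterS => y Uy; rewrite (iter_partial_lin a b oU sf sg).
split=> [|i].
  rewrite /prop_for /continuous_at (iter_partial_lin a b oU sf sg)//.
  apply: cvg_trans (near_eq_cvg H) _.
  by apply: cvgD; apply: cvgMr.
apply: near_eq_derivable H _.
apply: (@derivableD _ _ _ (a *: iter_partial s f) (b *: iter_partial s g)); exact: derivableZ.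
Qed.

Lemma iter_partial_eval e s x : x != 0 ->
  iter_partial s (eval e) x = eval (foldr D e s) x.
Proof.
elim: s x => [|i s IH] x x0 //=; rewrite -partial_eval//.
by apply: partial_near; apply: filterS (near_punctured x0).
Qed.

Lemma smooth_on_eval e : smooth_on punctured (eval e).
Proof.
move=> s x x0.
have H : \forall y \near x, eval (foldr D e s) y = iter_partial s (eval e) y.
  by apply: filterS (near_punctured x0) => y y0; rewrite iter_partial_eval.
split=> [|i].
  rewrite /prop_for /continuous_at iter_partial_eval//.
  have c := @continuous_eval (foldr D e s) x x0; rewrite /prop_for /continuous_at in c.
  exact: cvg_trans (near_eq_cvg H) c.
by apply: near_eq_derivable H _; have [] := is_derive_eval (foldr D e s) i x0.
Qed.

End Expressions.

(** * Compactness of the sphere and the maximum principle for its Laplacian *)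

Section MaximumPrinciple.
Context {R : realType}.
Local Notation E4 := 'cV[R]_4.
Implicit Types (x : E4) (f g : E4 -> R).

Lemma coord_le_euclid_norm x j : `|x j ord0| <= euclid_norm x.
Proof.
rewrite -sqrtr_sqr ler_sqrt; last by apply: sumr_ge0 => i _; exact: sqr_ge0.
by rewrite (bigD1 j)//= lerDl sumr_ge0// => i _; exact: sqr_ge0.
Qed.

(** Closed and bounded sets of row vectors are compact; continuity of the transposition carries this
    to columns. *)
Lemma compact_S3 : compact (@S3 R).
Proof.
rewrite (_ : @S3 R = (fun v : 'rV[R]_4 => v^T) @` [set v | S3 v^T]); last first.
  apply/seteqP; split => [x Sx|_ [v Sv <-]//].
  by exists x^T => //=; rewrite trmxK.
have ctr : continuous (fun v : 'rV[R]_4 => v^T).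
  move=> v W /nbhs_ballP[e /= e0 H]; apply/nbhs_ballP; exists e => //= w [_ h].
  by apply: H; split=> // i j; rewrite !mxE; exact: h.
apply: continuous_compact; first exact: continuous_subspaceT.
apply: bounded_closed_compact.
  exists 1; split => // M M1 v /= Sv.
  rewrite [leLHS]/Num.Def.normr /= mx_normrE; apply/bigmax_leP; split => [|[i j] _ /=].
    by rewrite (le_trans _ (ltW M1)).
  rewrite ord1; have := coord_le_euclid_norm v^T j; rewrite mxE => /le_trans; apply.
  by rewrite (Sv : euclid_norm _ = 1) ltW.
rewrite (_ : [set v | _] = (fun v : 'rV[R]_4 => euclid_norm v^T) @^-1` [set 1]); last by [].
apply: preimage_closed; last exact: (@accessible_closed_set1 _ (hausdorff_accessible (@norm_hausdorff _ _))).
by move=> v _; apply: (@continuous_comp _ _ _ _ (@euclid_norm R)); [exact: ctr|exact: continuous_euclid_norm].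
Qed.

Definition pole : E4 := basis4 ord0.

Lemma S3_pole : S3 pole.
Proof.
rewrite /S3 /= /euclid_norm (bigD1 ord0)//= big1 ?addr0.
  by rewrite mxE eqxx expr1n sqrtr1.
by move=> i /negPf i0; rewrite mxE i0 expr0n.
Qed.

Definition continuous_on_S3 f := forall x, S3 x -> {for x, continuous (radial f)}.

Lemma smooth_continuous_on_S3 f : smooth_on_S3 f -> continuous_on_S3 f.
Proof. by move=> sf x /S3_neq0 x0; have [] := sf [::] x x0. Qed.

Lemma S3_max f : continuous_on_S3 f ->
  exists2 x, S3 x & forall y, S3 y -> f y <= f x.
Proof.
move=> cf; have wf : {within (@S3 R), continuous (radial f)}.
  by apply: continuous_in_subspaceT => x /[!inE]; exact: cf.
have [x] := compact_EVT_max (ex_intro _ pole S3_pole) compact_S3 wf.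
move=> /[!inE] Sx h; exists x => // y Sy.
by have := h y; rewrite inE !radialE//; apply.
Qed.

Lemma is_derive_euclid_norm x i : x != 0 ->
  is_derive x (basis4 i) (@euclid_norm R) (x i ord0 / euclid_norm x).
Proof.
move=> x0; have e0 := euclid_norm_gt0 x0.
have := @is_derive_inv_comp _ _ (fun y : E4 => (euclid_norm y)^-1) x _ _ _ (is_derive_invnorm i x0).
rewrite invr_neq0 ?gt_eqF// => /(_ isT).
rewrite (_ : (fun y => _) = @euclid_norm R); last by apply/funext => y; rewrite invrK.
move=> /is_derive_eq; apply; field.
by rewrite gt_eqF.
Qed.

Lemma radialZ f (c : R) x : 0 < c -> radial f (c *: x) = radial f x.
Proof.
move=> c0; have [->|x0] := eqVneq x 0; first by rewrite scaler0.
rewrite /radial euclid_normZ ?ltW// scalerA; congr (f (_ *: _)).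
by rewrite invfM mulrAC mulVf ?mul1r// gt_eqF.
Qed.

(** [radial f] is homogeneous of degree 0, hence its partial derivatives are homogeneous of degree
    -1. *)
Lemma is_derive_radialZ f (c : R) x i (d : R) : 0 < c ->
  is_derive x (basis4 i) (radial f) d ->
  is_derive (c *: x) (basis4 i) (radial f) (c^-1 * d).
Proof.
move=> c0 /is_derive_line H; apply/is_derive_line.
have -> : (fun h : R => radial f (h *: basis4 i + c *: x)) =
   (fun h : R => radial f (h *: basis4 i + x)) \o (fun h : R => c^-1 * h).
  apply/funext => h /=; rewrite -[RHS](radialZ _ _ c0); congr radial.
  by rewrite scalerDr scalerA mulrA divff ?mul1r// gt_eqF.
rewrite mulrC; apply: is_derive1_comp; first by rewrite mulr0.
have := @is_deriveZ R R R id c^-1 0 1 1 (is_derive_id _ _).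
by move=> /is_derive_eq; apply; rewrite [_ *: _]mulr1.
Qed.

(** At a unit vector this is the sum over [i] of the derivatives of [euclid_norm * partial i f] in
    direction [i]. The norm factor is what makes the gradient of a function of degree 0 constant
    along rays. *)
Definition lap_expansion f x : R :=
  \sum_(i < 4) (partial i (partial i f) x + x i ord0 * partial i f x).

Lemma sphere_laplacianE f x : smooth_on_S3 f -> S3 x ->
  sphere_laplacian f x = - lap_expansion (radial f) x.
Proof.
move=> sf Sx; have x0 := S3_neq0 Sx; rewrite /sphere_laplacian /sphere_div; congr (- _).
apply: eq_bigr => i _.
have H : \forall y \near x, radial (fun y => sphere_grad f y i ord0) y =
    (@euclid_norm R * partial i (radial f)) y.
  apply: filterS (near_punctured x0) => y y0; rewrite /radial mxE /GRing.mul /=.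
  have [_ /(_ i) /derivableP dy] := sf [::] y y0.
  have ny := euclid_norm_gt0 y0; have nVy : 0 < (euclid_norm y)^-1 by rewrite invr_gt0.
  by have /@derive_val := is_derive_radialZ nVy dy; rewrite invrK.
rewrite (partial_near i H) {H}.
have [_ /(_ i) /derivableP dx] := sf [:: i] x x0.
have /@derive_val := is_deriveM (is_derive_euclid_norm i x0) dx.
by rewrite /partial => ->; rewrite (Sx : euclid_norm x = 1) divr1 scale1r [_ *: _]mulrC.
Qed.

Lemma sphere_laplacian_lin f g (a b : R) x :
  smooth_on_S3 f -> smooth_on_S3 g -> S3 x ->
  sphere_laplacian (fun y => a * f y + b * g y) x =
  a * sphere_laplacian f x + b * sphere_laplacian g x.
Proof.
move=> sf sg Sx; have x0 := S3_neq0 Sx; have oU := @open_punctured R.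
have sfg : smooth_on_S3 (fun y => a * f y + b * g y).
  exact: (@smooth_on_lin R _ (radial f) (radial g) a b oU sf sg).
rewrite !sphere_laplacianE// !mulrN -opprD; congr (- _).
rewrite /lap_expansion !big_distrr/= -big_split/=; apply: eq_bigr => i _.
have E2 : partial i (partial i (radial (fun y => a * f y + b * g y))) x =
    a * partial i (partial i (radial f)) x + b * partial i (partial i (radial g)) x.
  exact: (iter_partial_lin a b oU sf sg [:: i; i] x0).
have E1 : partial i (radial (fun y => a * f y + b * g y)) x =
    a * partial i (radial f) x + b * partial i (radial g) x.
  exact: (iter_partial_lin a b oU sf sg [:: i] x0).
rewrite E1 E2; move: (partial _ _ _) (partial _ _ _) (partial _ _ _) (partial _ _ _) => p1 p2 p3 p4.
move: (x i ord0) => xi; ring.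
Qed.

(** A positive second derivative would make [psi] positive just to the right of 0, and the mean
    value theorem would then lift [phi] above its maximum. *)
Lemma second_derivative_at_max (phi psi : R -> R) (d m : R) : 0 < d ->
  (forall h : R, - d < h -> h < d -> is_derive h 1 phi (psi h)) ->
  is_derive (0 : R) 1 psi m -> (forall h, - d < h -> h < d -> phi h <= phi 0) ->
  psi 0 = 0 /\ m <= 0.
Proof.
move=> d0 dphi dpsi phimax; have Nd0 : - d < 0 by rewrite oppr_lt0.
have psi0 : psi 0 = 0.
  have dd : - d <= d by rewrite (le_trans (ltW Nd0))// ltW.
  have dr t : t \in `]- d, d[ -> derivable phi t 1.
    by rewrite in_itv/= => /andP[t1 t2]; have [] := dphi t t1 t2.
  have c0 : 0 \in `]- d, d[ by rewrite in_itv/= Nd0.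
  have mx t : t \in `]- d, d[ -> phi t <= phi 0.
    by rewrite in_itv/= => /andP[t1 t2]; exact: phimax.
  have [_ E] := derive1_at_max dd dr c0 mx.
  by have [_ E'] := dphi 0 Nd0 d0; rewrite -E' E.
split=> //; rewrite leNgt; apply/negP => m0.
have [dp dpE] := dpsi.
have cv : (fun h : R => h^-1 *: ((psi \o shift 0) (h *: 1) - psi 0)) @ 0^' --> m.
  by rewrite -dpE; exact: dp.
have := cvgr_gt _ cv _ m0.
move=> /(_ _) Hn; have [e /= e0 He] := (nbhs_ballP (0 : R) _).1 Hn.
clear cv Hn dp dpE.
pose h := Num.min d e / 2.
have me0 : 0 < Num.min d e by rewrite lt_min d0.
have h0 : 0 < h by rewrite divr_gt0.
have [hd he] : h < d /\ h < e.
  have : h < Num.min d e by rewrite ltr_pdivrMr// ltr_pMr// ltr1n.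
  by rewrite lt_min => /andP.
have dp t : t \in `]0, h[ -> is_derive t 1 phi (psi t).
  rewrite in_itv/= => /andP[t0 th].
  by apply: dphi; [exact: lt_trans t0|exact: lt_trans hd].
have cp : {within `[0, h], continuous phi}.
  apply: derivable_within_continuous => t; rewrite in_itv/= => /andP[t0 th].
  by have [] := dphi t (lt_le_trans Nd0 t0) (le_lt_trans th hd).
have [c] := MVT h0 dp cp.
rewrite in_itv/= => /andP[c0 ch]; rewrite subr0 => E.
have psic : 0 < psi c.
  have := He c; rewrite /ball /= sub0r normrN gtr0_norm// => /(_ (lt_trans ch he)).
  rewrite gt_eqF// => /(_ isT); rewrite addr0 psi0 subr0 [_%:A]mulr1.
  by rewrite [_ *: _]mulrC pmulr_lgt0// invr_gt0.
have : 0 < phi h - phi 0 by rewrite E mulr_gt0.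
by rewrite subr_gt0 ltNge phimax// (lt_trans Nd0).
Qed.

(** Off the origin [radial f] only takes values that [f] takes on the sphere, so [x] is a maximum
    along every straight coordinate line. One-variable calculus then controls both terms of
    [lap_expansion], coordinate by coordinate. *)
Lemma sphere_laplacian_at_max f x : smooth_on_S3 f -> S3 x ->
  (forall y, S3 y -> f y <= f x) -> 0 <= sphere_laplacian f x.
Proof.
move=> sf Sx fx; rewrite sphere_laplacianE// oppr_ge0; apply: sumr_le0 => i _.
have x0 := S3_neq0 Sx; set F := radial f.
have Fmax y : y != 0 -> F y <= F x.
  by move=> y0; rewrite /F (radialE f Sx); apply: fx; exact: S3_normalize.
have cl : (fun h : R => h *: basis4 i + x) @ nbhs (0 : R) --> x.
  rewrite -[X in _ --> X]add0r -(scale0r (basis4 i)).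
  by apply: cvgD; [exact: scalel_continuous|exact: cvg_cst].
have : \forall h \near nbhs (0 : R), h *: basis4 i + x != 0.
  exact: (cl _ (near_punctured x0)).
move=> /nbhs_ballP[d /= d0 Hd].
have Hd' (h : R) : -d < h -> h < d -> h *: basis4 i + x != 0.
  by move=> h1 h2; apply: Hd; rewrite /ball /= sub0r normrN ltr_norml h1.
pose phi := fun h : R => F (h *: basis4 i + x).
pose psi := fun h : R => partial i F (h *: basis4 i + x).
have dphi (h : R) : -d < h -> h < d -> is_derive h 1 phi (psi h).
  move=> h1 h2; have [_ /(_ i) /derivableP dx] := sf [::] _ (Hd' h h1 h2).
  have H := (is_derive_line _ _ _ _).1 dx.
  have E : phi = (fun h0 : R => F (h0 *: basis4 i + (h *: basis4 i + x))) \o shift (- h).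
    by apply/funext => k /=; rewrite addrA -scalerDl subrK.
  rewrite E -[psi h]mulr1; apply: is_derive1_comp; last exact: is_derive_shift.
  by rewrite /= subrr; exact: H.
have [_ /(_ i) /derivableP dx] := sf [:: i] x x0.
have dpsi : is_derive (0 : R) 1 psi (partial i (partial i F) x).
  exact: ((is_derive_line _ _ _ _).1 dx).
have phimax (h : R) : -d < h -> h < d -> phi h <= phi 0.
  by move=> h1 h2; rewrite /phi scale0r add0r; exact/Fmax/Hd'.
have [psi0 m0] := second_derivative_at_max d0 dphi dpsi phimax.
by move: psi0; rewrite /psi scale0r add0r => ->; rewrite mulr0 addr0.
Qed.

(** At a maximum of [f] the Laplacian is nonnegative, so [l * f] is at most [e] there; the lower
    bound is the same statement for [- f]. In other words, the inverse of the Laplacian plus [l] has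
    sup norm at most [1 / l]. *)
Lemma maximum_principle f (l e : R) : smooth_on_S3 f -> 0 < l ->
  (forall x, S3 x -> `|sphere_laplacian f x + l * f x| <= e) ->
  forall x, S3 x -> l * `|f x| <= e.
Proof.
suff H g : smooth_on_S3 g -> 0 < l ->
    (forall x, S3 x -> `|sphere_laplacian g x + l * g x| <= e) ->
    forall x, S3 x -> l * g x <= e.
  move=> sf l0 he x Sx; rewrite -ler_pdivlMl// ler_norml lerNl; apply/andP; split; last first.
    by rewrite ler_pdivlMl//; apply: H.
  pose g := fun y => (-1) * f y + 0 * f y.
  have -> : - f x = g x by rewrite /g; ring.
  rewrite ler_pdivlMl//; apply: H => // [|y Sy].
    exact: (@smooth_on_lin R _ (radial f) (radial f) (-1) 0 (@open_punctured R) sf sf).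
  have := he y Sy; rewrite -normrN; congr (`|_| <= e).
  by rewrite /g sphere_laplacian_lin//; ring.
move=> sg l0 he x Sx.
have [y Sy my] := S3_max (smooth_continuous_on_S3 sg).
rewrite (@le_trans _ _ (l * g y))// ?ler_pM2l ?my//.
have := he y Sy; rewrite ler_norml => /andP[_]; apply: le_trans.
by rewrite lerDr; apply: sphere_laplacian_at_max.
Qed.

End MaximumPrinciple.

(** * Real and imaginary parts of the powers of a complex coordinate *)

Section ComplexPowers.
Context {R : realType}.
Local Notation E4 := 'cV[R]_4.
Local Notation expr := (@expr R).
Implicit Types (x : E4) (i j k : 'I_4) (n : nat).

Definition Sub (a b : expr) := Add a (Mul (Cst (-1)) b).

Fixpoint re_im_pow i j n : expr * expr :=
  if n is m.+1 then
    let: (a, b) := re_im_pow i j m in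
    (Sub (Mul (Var i) a) (Mul (Var j) b), Add (Mul (Var i) b) (Mul (Var j) a))
  else (Cst 1, Cst 0).
Definition re_pow i j n := (re_im_pow i j n).1.
Definition im_pow i j n := (re_im_pow i j n).2.

Lemma re_powS i j n : re_pow i j n.+1 =
  Sub (Mul (Var i) (re_pow i j n)) (Mul (Var j) (im_pow i j n)).
Proof. by rewrite /re_pow /im_pow /=; case: (re_im_pow i j n). Qed.

Lemma im_powS i j n : im_pow i j n.+1 =
  Add (Mul (Var i) (im_pow i j n)) (Mul (Var j) (re_pow i j n)).
Proof. by rewrite /re_pow /im_pow /=; case: (re_im_pow i j n). Qed.

Lemma eval_re_powS i j n x : eval (re_pow i j n.+1) x =
  x i ord0 * eval (re_pow i j n) x - x j ord0 * eval (im_pow i j n) x.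
Proof. by rewrite re_powS /=; ring. Qed.

Lemma eval_im_powS i j n x : eval (im_pow i j n.+1) x =
  x i ord0 * eval (im_pow i j n) x + x j ord0 * eval (re_pow i j n) x.
Proof. by rewrite im_powS /=. Qed.

(** This is d(z^n) = n z^(n-1) dz for z = x_i + sqrt(-1) x_j, where direction [j] contributes the
    factor sqrt(-1). The truncated predecessor at [n = 0] is masked by the factor [n%:R]. *)
Lemma eval_D_pow i j k n x : i != j ->
  eval (D k (re_pow i j n)) x = n%:R * ((k == i)%:R * eval (re_pow i j n.-1) x
     - (k == j)%:R * eval (im_pow i j n.-1) x) /\
  eval (D k (im_pow i j n)) x = n%:R * ((k == i)%:R * eval (im_pow i j n.-1) x
     + (k == j)%:R * eval (re_pow i j n.-1) x).
Proof.
move=> ij; elim: n => [|n [IHr IHi]]; first by rewrite /= !mul0r.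
rewrite re_powS im_powS /= IHr IHi; case: n {IHr IHi} => [|n].
  by rewrite /=; split; ring.
rewrite /= !eval_re_powS !eval_im_powS -[n.+2%:R]natr1.
set c := eval (re_pow i j n) x; set s := eval (im_pow i j n) x.
by split; ring.
Qed.

Lemma eval_pow_polar i j n x (r t : R) :
  x i ord0 = r * cos t -> x j ord0 = r * sin t ->
  eval (re_pow i j n) x = r ^+ n * cos (n%:R * t) /\
  eval (im_pow i j n) x = r ^+ n * sin (n%:R * t).
Proof.
move=> xi xj; elim: n => [|n [IHr IHi]].
  by rewrite /= mul0r cos0 sin0 expr0; split; ring.
rewrite eval_re_powS eval_im_powS IHr IHi xi xj -natr1 mulrDl mul1r cosD sinD exprS.
by split; ring.
Qed.

End ComplexPowers.

(** * Eigenfunctions of the sphere of a given weight under the maximal torus *)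

Section TorusHarmonics.
Context {R : realType}.
Local Notation E4 := 'cV[R]_4.
Local Notation expr := (@expr R).
Implicit Types (x : E4) (k : 'I_4) (m : int) (p : {poly R}).

Definition i0 : 'I_4 := ord0.
Definition i1 : 'I_4 := inord 1.
Definition i2 : 'I_4 := inord 2.
Definition i3 : 'I_4 := inord 3.

Lemma big_ord4 (V : nmodType) (F : 'I_4 -> V) :
  \sum_(i < 4) F i = F i0 + F i1 + F i2 + F i3.
Proof.
rewrite !big_ord_recl big_ord0 addr0 !addrA; congr (F _ + F _ + F _ + F _);
  by apply/val_inj; rewrite /= ?inordK.
Qed.

Lemma ord4P k : [\/ k = i0, k = i1, k = i2 | k = i3].
Proof.
by case: k => -[|[|[|[|]]]] // h; [constructor 1|constructor 2|constructor 3|constructor 4];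
  apply/val_inj; rewrite /= ?inordK.
Qed.

Lemma ord4_eq : ((i0 == i1) = false) * ((i0 == i2) = false) * ((i0 == i3) = false)
  * ((i1 == i2) = false) * ((i1 == i3) = false) * ((i2 == i3) = false)
  * ((i1 == i0) = false) * ((i2 == i0) = false) * ((i3 == i0) = false)
  * ((i2 == i1) = false) * ((i3 == i1) = false) * ((i3 == i2) = false)
  * ((i0 == i0) = true) * ((i1 == i1) = true) * ((i2 == i2) = true) * ((i3 == i3) = true).
Proof. by rewrite !eqxx; do !split; apply/eqP => /(congr1 val); rewrite /= ?inordK. Qed.

Definition sgn (m : int) : R := if m < 0 then -1 else 1.

Lemma sgn_absz m : sgn m * `|m|%N%:R = m%:~R.
Proof.
rewrite /sgn; case: m => n /=; first by rewrite mul1r.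
by rewrite mulN1r NegzE mulrNz.
Qed.

Definition harm (a b : R) (n l : nat) : expr :=
  Add (Mul (re_pow i0 i1 n) (Add (re_pow i2 i3 l) (Mul (Cst b) (im_pow i2 i3 l))))
      (Mul (Mul (Cst a) (im_pow i0 i1 n)) (Sub (re_pow i2 i3 l) (Mul (Cst b) (im_pow i2 i3 l)))).

(* Re + Im of z^m1 w^m2 for z = x0 + i x1 and w = x2 + i x3, where negative
   powers stand for powers of the conjugate. Adding the two parts gives one real
   function for each weight (m1, m2). *)
Definition torus_harm m1 m2 : expr := harm (sgn m1) (sgn m2) `|m1| `|m2|.

(** Hartley's kernel: [cas t] and [cas (- t)] together span [cos t] and [sin t]. *)
Definition cas (t : R) := cos t + sin t.

Lemma torus_harm_polar m1 m2 x (r1 r2 t1 t2 : R) :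
  x i0 ord0 = r1 * cos t1 -> x i1 ord0 = r1 * sin t1 ->
  x i2 ord0 = r2 * cos t2 -> x i3 ord0 = r2 * sin t2 ->
  eval (torus_harm m1 m2) x =
  r1 ^+ `|m1| * r2 ^+ `|m2| * cas (m1%:~R * t1 + m2%:~R * t2).
Proof.
move=> h0 h1 h2 h3; rewrite /torus_harm /harm /=.
have [-> ->] := eval_pow_polar `|m1| h0 h1; have [-> ->] := eval_pow_polar `|m2| h2 h3.
rewrite -!sgn_absz /cas cosD sinD -!mulrA.
have hs m (u : R) : sin (sgn m * u) = sgn m * sin u.
  by rewrite /sgn; case: ifP; rewrite ?mulN1r ?mul1r ?sinN.
have hc m (u : R) : cos (sgn m * u) = cos u.
  by rewrite /sgn; case: ifP; rewrite ?mulN1r ?mul1r ?cosN.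
by rewrite !hs !hc; ring.
Qed.

Lemma eval_D_ext (a b : expr) k x : (forall y, y != 0 -> eval a y = eval b y) ->
  x != 0 -> eval (D k a) x = eval (D k b) x.
Proof.
move=> ab x0; rewrite -!partial_eval//; apply: partial_near.
by apply: filterS (near_punctured x0) => y; exact: ab.
Qed.

Let n01 : i0 != i1. Proof. by rewrite ord4_eq. Qed.
Let n23 : i2 != i3. Proof. by rewrite ord4_eq. Qed.

(** Euler's relation in each coordinate plane separately: the function has degree [n] in the first
    and [l] in the second. *)
Lemma harm_euler (a b : R) (n l : nat) x :
  x i0 ord0 * eval (D i0 (harm a b n l)) x + x i1 ord0 * eval (D i1 (harm a b n l)) x =
    n%:R * eval (harm a b n l) x /\
  x i2 ord0 * eval (D i2 (harm a b n l)) x + x i3 ord0 * eval (D i3 (harm a b n l)) x =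
    l%:R * eval (harm a b n l) x.
Proof.
rewrite /harm /=.
have [-> ->] := eval_D_pow i0 n x n01.
have [-> ->] := eval_D_pow i0 l x n23; have [-> ->] := eval_D_pow i1 l x n23.
have [-> ->] := eval_D_pow i1 n x n01.
have [-> ->] := eval_D_pow i2 n x n01; have [-> ->] := eval_D_pow i3 n x n01.
have [-> ->] := eval_D_pow i2 l x n23; have [-> ->] := eval_D_pow i3 l x n23.
rewrite !ord4_eq /=; split.
  case: n => [|n]; first by rewrite /=; ring.
  by rewrite !eval_re_powS !eval_im_powS /=; ring.
case: l => [|l]; first by rewrite /=; ring.
by rewrite !eval_re_powS !eval_im_powS /=; ring.
Qed.

(** With the other plane frozen, the function is a combination of the real and imaginary parts of a
    complex power, hence harmonic in each plane. *)
Lemma harm_laplacian (a b : R) (n l : nat) x : x != 0 ->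
  eval (D i0 (D i0 (harm a b n l))) x + eval (D i1 (D i1 (harm a b n l))) x = 0 /\
  eval (D i2 (D i2 (harm a b n l))) x + eval (D i3 (D i3 (harm a b n l))) x = 0.
Proof.
move=> x0.
set P := Add (re_pow i2 i3 l) (Mul (Cst b) (im_pow i2 i3 l)).
set Q := Sub (re_pow i2 i3 l) (Mul (Cst b) (im_pow i2 i3 l)).
pose C : expr := re_pow i0 i1 n; pose S : expr := im_pow i0 i1 n.
have E0 y : y != 0 -> eval (D i0 (harm a b n l)) y = eval (Mul (Cst n%:R)
   (Add (Mul (re_pow i0 i1 n.-1) P) (Mul (Mul (Cst a) (im_pow i0 i1 n.-1)) Q))) y.
  move=> _; rewrite /harm /=; have [-> ->] := eval_D_pow i0 n y n01.
  by have [-> ->] := eval_D_pow i0 l y n23; rewrite !ord4_eq /=; ring.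
have E1 y : y != 0 -> eval (D i1 (harm a b n l)) y = eval (Mul (Cst n%:R)
   (Sub (Mul (Mul (Cst a) (re_pow i0 i1 n.-1)) Q) (Mul (im_pow i0 i1 n.-1) P))) y.
  move=> _; rewrite /harm /=; have [-> ->] := eval_D_pow i1 n y n01.
  by have [-> ->] := eval_D_pow i1 l y n23; rewrite !ord4_eq /=; ring.
have E2 y : y != 0 -> eval (D i2 (harm a b n l)) y = eval (Mul (Cst l%:R)
   (Add (Mul C (Add (re_pow i2 i3 l.-1) (Mul (Cst b) (im_pow i2 i3 l.-1))))
     (Mul (Mul (Cst a) S) (Sub (re_pow i2 i3 l.-1) (Mul (Cst b) (im_pow i2 i3 l.-1)))))) y.
  move=> _; rewrite /harm /=; have [-> ->] := eval_D_pow i2 n y n01.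
  by have [-> ->] := eval_D_pow i2 l y n23; rewrite !ord4_eq /=; ring.
have E3 y : y != 0 -> eval (D i3 (harm a b n l)) y = eval (Mul (Cst l%:R)
   (Sub (Mul C (Sub (Mul (Cst b) (re_pow i2 i3 l.-1)) (im_pow i2 i3 l.-1)))
     (Mul (Mul (Cst a) S) (Add (im_pow i2 i3 l.-1) (Mul (Cst b) (re_pow i2 i3 l.-1)))))) y.
  move=> _; rewrite /harm /=; have [-> ->] := eval_D_pow i3 n y n01.
  by have [-> ->] := eval_D_pow i3 l y n23; rewrite !ord4_eq /=; ring.
rewrite (eval_D_ext _ E0 x0) (eval_D_ext _ E1 x0) (eval_D_ext _ E2 x0) (eval_D_ext _ E3 x0).
rewrite /=.
have [-> ->] := eval_D_pow i0 n.-1 x n01; have [-> ->] := eval_D_pow i1 n.-1 x n01.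
have [-> ->] := eval_D_pow i2 l.-1 x n23; have [-> ->] := eval_D_pow i3 l.-1 x n23.
have [-> ->] := eval_D_pow i0 l x n23; have [-> ->] := eval_D_pow i1 l x n23.
have [-> ->] := eval_D_pow i2 n x n01; have [-> ->] := eval_D_pow i3 n x n01.
by rewrite !ord4_eq /=; split; ring.
Qed.

Definition sq1 : expr :=
  Mul (Add (Mul (Var i0) (Var i0)) (Mul (Var i1) (Var i1))) (Mul InvNorm InvNorm).

(** The power of [InvNorm] and the normalization inside [sq1] bring the degree to 0. The function is
    thus its own [radial] extension, and its Laplacian on the sphere is computed by differentiating
    this expression. *)
Definition homog0 m1 m2 p : expr :=
  Mul (torus_harm m1 m2) (Mul (Pol 'X^(`|m1| + `|m2|) InvNorm) (Pol p sq1)).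

Lemma eval_homog0Z m1 m2 p x (c : R) : 0 < c ->
  eval (homog0 m1 m2 p) (c *: x) = eval (homog0 m1 m2 p) x.
Proof.
move=> c0.
have hp i j n : eval (re_pow i j n) (c *: x) = c ^+ n * eval (re_pow i j n) x /\
   eval (im_pow i j n) (c *: x) = c ^+ n * eval (im_pow i j n) x.
  elim: n => [|n [IHr IHi]]; first by rewrite /= expr0 mulr0; split; ring.
  by rewrite !eval_re_powS !eval_im_powS IHr IHi !mxE exprS; split; ring.
have [->|x0] := eqVneq x 0; first by rewrite scaler0.
have e0 := euclid_norm_gt0 x0.
have hT : eval (torus_harm m1 m2) (c *: x) =
    c ^+ (`|m1| + `|m2|) * eval (torus_harm m1 m2) x.
  rewrite /torus_harm /harm /=.
  have [-> ->] := hp i0 i1 `|m1|%N; have [-> ->] := hp i2 i3 `|m2|%N.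
  by rewrite exprD; ring.
have hs : eval sq1 (c *: x) = eval sq1 x.
  rewrite /= euclid_normZ ?ltW// !mxE; field.
  by rewrite !gt_eqF.
have hi : eval InvNorm (c *: x) = c^-1 * eval InvNorm x.
  by rewrite /= euclid_normZ ?ltW// invfM.
rewrite /homog0 /= in hT hs hi *; rewrite hT hs hi !hornerXn exprMn.
have E : c ^+ (`|m1| + `|m2|) * c^-1 ^+ (`|m1| + `|m2|) = 1.
  by rewrite -exprMn divff ?gt_eqF// expr1n.
rewrite -[RHS]mul1r -E; move: (p.[_]) (c ^+ _) (c^-1 ^+ _) ((euclid_norm x)^-1 ^+ _) => P c1 c2 c3; ring.
Qed.

Lemma radial_homog0 m1 m2 p : radial (eval (homog0 m1 m2 p)) =1 eval (homog0 m1 m2 p).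
Proof.
move=> x; have [->|x0] := eqVneq x 0; first by rewrite /radial scaler0.
by rewrite /radial eval_homog0Z// invr_gt0 euclid_norm_gt0.
Qed.

Definition eigf m1 m2 p : E4 -> R := eval (homog0 m1 m2 p).

Lemma smooth_eigf m1 m2 p : smooth_on_S3 (eigf m1 m2 p).
Proof.
rewrite /eigf.
apply: smooth_on_eq (@open_punctured R) _ (smooth_on_eval _) => x _.
by rewrite radial_homog0.
Qed.

(* Jacobi's equation on [0, 1]; it characterizes the factor p for which
   homog0 m1 m2 p is an eigenfunction. *)
Definition jacobi_eq (a h j : nat) (p : {poly R}) : Prop :=
  'X * (1 - 'X) * p^`()^`() + (a.+1%:R%:P - h.+2%:R *: 'X) * p^`()
    + (j * (j + h.+1))%:R *: p = 0.

Lemma eigf_eigen m1 m2 p (j : nat) x : S3 x ->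
  jacobi_eq `|m1| (`|m1| + `|m2|) j p ->
  let k := (`|m1| + `|m2| + 2 * j)%N in
  sphere_laplacian (eigf m1 m2 p) x = (k * (k + 2))%:R * eigf m1 m2 p x.
Proof.
move=> Sx ode k; rewrite /eigf; have x0 := S3_neq0 Sx.
rewrite (sphere_laplacianE (smooth_eigf m1 m2 p) Sx).
rewrite (_ : radial _ = eval (homog0 m1 m2 p)); last by apply/funext => y; exact: radial_homog0.
have -> : lap_expansion (eval (homog0 m1 m2 p)) x = \sum_(i < 4)
    (eval (D i (D i (homog0 m1 m2 p))) x + x i ord0 * eval (D i (homog0 m1 m2 p)) x).
  apply: eq_bigr => i _; rewrite partial_eval//; congr (_ + _).
  rewrite -partial_eval//; apply: partial_near.
  by apply: filterS (near_punctured x0) => y y0; rewrite partial_eval.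
have [H0 H1] := harm_laplacian (sgn m1) (sgn m2) `|m1| `|m2| x0.
have [E0 E1] := harm_euler (sgn m1) (sgn m2) `|m1| `|m2| x.
rewrite -/(torus_harm m1 m2) in H0 H1 E0 E1.
have nx : (euclid_norm x)^-1 = 1 by rewrite (Sx : euclid_norm x = 1) invr1.
have sx : x i2 ord0 ^+ 2 + x i3 ord0 ^+ 2 = 1 - (x i0 ord0 ^+ 2 + x i1 ord0 ^+ 2).
  have := euclid_normsq x; rewrite (Sx : euclid_norm x = 1) expr1n big_ord4; lra.
set s := x i0 ord0 ^+ 2 + x i1 ord0 ^+ 2 in sx.
have ode' := congr1 (fun q : {poly R} => q.[s]) ode; rewrite /= !hornerE in ode'.
rewrite big_ord4 /homog0.
move: (torus_harm m1 m2) H0 H1 E0 E1 => T H0 H1 E0 E1.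
set h := (`|m1| + `|m2|)%N in ode ode' *.
have xn1 : ('X^h : {poly R}).[1] = 1 by rewrite hornerXn expr1n.
have xn2 : ('X^h : {poly R})^`().[1] = h%:R by rewrite derivXn hornerMn hornerXn expr1n.
have xn3 : ('X^h : {poly R})^`()^`().[1] = h%:R * (h%:R - 1).
  rewrite derivXn derivMn derivXn !hornerMn hornerXn expr1n -mulrnA.
  by case: (h) => [|h']; rewrite ?mul0r// natrM -natr1 /=; ring.
rewrite /= nx !mulr1 -!expr2 -/s xn1 xn2 xn3 !ord4_eq.
move: (eval (D i0 (D i0 T)) x) (eval (D i1 (D i1 T)) x) (eval (D i2 (D i2 T)) x)
  (eval (D i3 (D i3 T)) x) (eval (D i0 T) x) (eval (D i1 T) x) (eval (D i2 T) x)
  (eval (D i3 T) x) (eval T x) H0 H1 E0 E1 => d00 d11 d22 d33 d0 d1 d2 d3 t H0 H1 E0 E1.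
move: (p.[s]) (p^`().[s]) (p^`()^`().[s]) ode' => P0 P1 P2 ode'.
(* Let G be the factor of [T] in [homog0]. At a unit vector the gradient of G is [x_i * (A + B)] in
   the first plane and [x_i * A] in the second, and the pure second derivatives in the second plane
   are [A + al * x_i ^+ 2]. *)
pose A : R := - (h%:R * P0) - 2 * s * P1; pose B : R := 2 * P1.
pose al : R := h%:R * (h%:R + 2) * P0 + 2 * s * h%:R * P1 + 2 * s * (h%:R + 4) * P1 + 4 * s ^+ 2 * P2.
apply/eqP; rewrite -subr_eq0; apply/eqP.
(* The defect is an explicit combination of the relations [H0], [H1], [E0], [E1], [sx] and [ode']:
   every summand contains a bracket that one of them annihilates. *)
transitivity (- P0 * ((d00 + d11) + (d22 + d33))
  - 2 * (A + B) * (x i0 ord0 * d0 + x i1 ord0 * d1 - `|m1|%:R * t)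
  - 2 * A * (x i2 ord0 * d2 + x i3 ord0 * d3 - `|m2|%:R * t)
  - P0 * ((x i0 ord0 * d0 + x i1 ord0 * d1 - `|m1|%:R * t)
          + (x i2 ord0 * d2 + x i3 ord0 * d3 - `|m2|%:R * t))
  - t * (al + A) * (x i2 ord0 ^+ 2 + x i3 ord0 ^+ 2 - (1 - s))
  - 4 * t * (s * (1 - s) * P2 + (`|m1|.+1%:R - h.+2%:R * s) * P1 + (j * (j + h.+1))%:R * P0)); last first.
  rewrite H0 H1 E0 E1 sx ode' !subrr; ring.
have tE : true%:R = 1 :> R by [].
have fE : false%:R = 0 :> R by [].
rewrite tE fE /al /A /B /k /h /s; ring.
Qed.

Lemma eigfE m1 m2 p x : S3 x ->
  eigf m1 m2 p x = eval (torus_harm m1 m2) x * p.[x i0 ord0 ^+ 2 + x i1 ord0 ^+ 2].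
Proof.
move=> Sx; have -> : eigf m1 m2 p x = eval (torus_harm m1 m2) x *
  (('X^(`|m1| + `|m2|) : {poly R}).[(euclid_norm x)^-1] *
   p.[(x i0 ord0 * x i0 ord0 + x i1 ord0 * x i1 ord0) * ((euclid_norm x)^-1 * (euclid_norm x)^-1)]) by [].
by rewrite (Sx : euclid_norm x = 1) invr1 hornerXn expr1n !mulr1 mul1r -!expr2.
Qed.

End TorusHarmonics.

Arguments eigf : simpl never.

(** * Jacobi polynomials on [0, 1]: differential equation, span, orthogonality *)

Section JacobiPolynomials.
Context {R : realType}.
Implicit Types (a h j i : nat) (p q : {poly R}).

(** Coefficients of the hypergeometric polynomial 2F1(-j, j + h + 1; a + 1; s): the numerator
    factors as (l - j) (l + j + h + 1), which also makes them vanish beyond [j]. *)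
Fixpoint jacobi_coef a h j i : R :=
  if i is l.+1 then jacobi_coef a h j l *
     ((l * (l + h.+1))%:R - (j * (j + h.+1))%:R) / (l.+1 * (l.+1 + a))%:R
  else 1.

Definition jacobi a h j : {poly R} := \poly_(i < j.+1) jacobi_coef a h j i.

Lemma jacobi_coef_rec a h j i :
  (i.+1 * (i.+1 + a))%:R * jacobi_coef a h j i.+1 =
  ((i * (i + h.+1))%:R - (j * (j + h.+1))%:R) * jacobi_coef a h j i.
Proof. by rewrite /= mulrC divfK ?pnatr_eq0// mulrC. Qed.

Lemma jacobi_coef_gt a h j i : (j < i)%N -> jacobi_coef a h j i = 0.
Proof.
elim: i => [//|i IH]; rewrite ltnS leq_eqVlt => /orP[/eqP ->|/IH E].
  by rewrite /= subrr mulr0 mul0r.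
by rewrite /= E !mul0r.
Qed.

Lemma jacobi_coef_neq0 a h j i : (i <= j)%N -> jacobi_coef a h j i != 0.
Proof.
elim: i => [|i IH] ij /=; first exact: oner_neq0.
rewrite !mulf_neq0 ?IH ?invr_eq0 ?pnatr_eq0 ?(ltnW ij)//.
by rewrite subr_eq0 eqr_nat; apply/eqP; nia.
Qed.

Lemma coef_jacobi a h j i : (jacobi a h j)`_i = jacobi_coef a h j i.
Proof. by rewrite coef_poly; case: ltnP => // /jacobi_coef_gt ->. Qed.

Lemma size_jacobi a h j : size (jacobi a h j) = j.+1.
Proof. by rewrite size_poly_eq// jacobi_coef_neq0. Qed.

Lemma jacobi_ode a h j : jacobi_eq a h j (jacobi a h j).
Proof.
rewrite /jacobi_eq; set p := jacobi a h j.
have E : 'X * (1 - 'X) * p^`()^`() + (a.+1%:R%:P - h.+2%:R *: 'X) * p^`() =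
   'X * p^`()^`() - 'X * ('X * p^`()^`()) + a.+1%:R *: p^`() - h.+2%:R *: ('X * p^`()).
  rewrite -!mul_polyC; ring.
rewrite E {E}; pose c := jacobi_coef a h j.
have d0 n : p`_n = c n by rewrite /p coef_jacobi.
have d1 n : p^`()`_n = c n.+1 * n.+1%:R by rewrite coef_deriv d0 mulr_natr.
have d2 n : p^`()^`()`_n = c n.+2 * n.+2%:R * n.+1%:R by rewrite coef_deriv d1 -[LHS]mulr_natr.
have rec n : (n.+1 * (n.+1 + a))%:R * c n.+1 -
   ((n * (n + h.+1))%:R - (j * (j + h.+1))%:R) * c n = 0.
  by rewrite /c jacobi_coef_rec subrr.
clearbody p c.
apply/polyP => i; rewrite !(coefD, coefB, coefN, coefZ, coefXM) coef0 -[RHS](rec i) {rec}.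
by case: i => [|[|i]]; rewrite /= ?d2 ?d1 ?d0 !natrM; ring.
Qed.

(** The [j]-th polynomial has degree exactly [j], so subtracting a multiple of it removes the
    leading term. *)
Lemma poly_jacobi_span a h p : exists c : nat -> R,
  p = \sum_(j < size p) c j *: jacobi a h j.
Proof.
elim/(@well_founded_induction _ _ (Wf_nat.well_founded_ltof _ (fun q : {poly R} => size q))) : p => p IH.
have [->|p0] := eqVneq p 0; first by exists (fun=> 0); rewrite size_poly0 big_ord0.
have sp : (0 < size p)%N by rewrite size_poly_gt0.
pose d := (size p).-1; pose l := lead_coef p / jacobi_coef a h d d.
pose q := p - l *: jacobi a h d.
have qd i : (d <= i)%N -> q`_i = 0.
  move=> di; rewrite coefB coefZ coef_jacobi; case: (ltngtP d i) di => // [di|<-] _.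
    rewrite jacobi_coef_gt// mulr0 subr0 nth_default//.
    by rewrite -(prednK sp) -/d.
  by rewrite /l mulfVK ?jacobi_coef_neq0// lead_coefE subrr.
have sq : (size q <= d)%N by apply/leq_sizeP.
have [|c qc] := IH q.
  by apply/ssrnat.ltP; rewrite (leq_ltn_trans sq)// ltn_predL.
exists (fun j => if (j < size q)%N then c j else if j == d then l else 0).
rewrite -(prednK sp) -/d big_ord_recr /= ltnNge sq eqxx /=.
have -> : p = q + l *: jacobi a h d by rewrite subrK.
congr (_ + _); rewrite [LHS]qc (big_ord_widen_cond d predT (fun j => c j *: jacobi a h j))//.
rewrite big_mkcond /=; apply: eq_bigr => j _; case: ifP => //.
by rewrite ltn_eqF ?scale0r.
Qed.

(** The integral over [0, 1], taken coefficientwise: linearity and the fundamental theorem of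
    calculus become finite identities. *)
Definition int01 p : R := \sum_(i < size p) p`_i / i.+1%:R.

Lemma int01E n p : (size p <= n)%N -> int01 p = \sum_(i < n) p`_i / i.+1%:R.
Proof.
move=> pn; rewrite /int01 (big_ord_widen n (fun i => p`_i / i.+1%:R))//.
rewrite big_mkcond /=; apply: eq_bigr => i _; case: ltnP => // h.
by rewrite nth_default// mul0r.
Qed.

Lemma int01_lin (c : R) p q : int01 (c *: p + q) = c * int01 p + int01 q.
Proof.
pose n := maxn (size p) (size q).
have h : (size (c *: p + q)%R <= n)%N.
  rewrite (leq_trans (size_polyD _ _))// geq_max leq_maxr andbT.
  by rewrite (leq_trans (size_scale_leq _ _))// leq_maxl.
rewrite (int01E h) (@int01E n p) ?leq_maxl// (@int01E n q) ?leq_maxr//.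
rewrite big_distrr -big_split /=; apply: eq_bigr => i _.
by rewrite coefD coefZ mulrDl mulrA.
Qed.

Lemma int01_deriv p : int01 p^`() = p.[1] - p.[0].
Proof.
have sp : (size p^`() <= (size p).-1)%N by rewrite size_poly.
rewrite (int01E sp) horner_coef0 horner_coef.
have [->|p0] := eqVneq p 0.
  by rewrite size_poly0 !big_ord0 coef0 subrr.
rewrite -(prednK (_ : 0 < size p)%N) ?size_poly_gt0//=; move: (size p).-1 => n.
rewrite big_ord_recl /= expr0 mulr1 addrAC subrr add0r.
apply: eq_bigr => i _; rewrite coef_deriv expr1n mulr1 /= -[X in X / _]mulr_natr mulfK//.
Qed.

Definition jacobi_weight (a b : nat) : {poly R} := 'X^a * (1 - 'X) ^+ b.

(** Sturm-Liouville argument: the weighted Wronskian [W * (p^]() * q - p * q^[())] vanishes at 0 and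
    1, and by Jacobi's equation its derivative is the difference of the two eigenvalues times
    [w * (p * q)]. *)
Lemma jacobi_orthogonal (a b i j : nat) : i != j ->
  int01 (jacobi_weight a b * (jacobi a (a + b) i * jacobi a (a + b) j)) = 0.
Proof.
move=> ij; set p := jacobi _ _ i; set q := jacobi _ _ j.
have := jacobi_ode a (a + b) i; have := jacobi_ode a (a + b) j.
rewrite /jacobi_eq -/p -/q => hq hp; clearbody p q.
pose w := jacobi_weight a b; pose W : {poly R} := 'X^(a.+1) * (1 - 'X) ^+ b.+1.
have dW : W^`() = w * (a.+1%:R%:P - (a + b).+2%:R *: 'X).
  rewrite /W /w /jacobi_weight derivM derivXn deriv_exp derivB derivX derivC sub0r /=.
  rewrite !exprS scaler_nat polyC_natr; move: ('X : {poly R}) ((1 - 'X) ^+ b) ('X^a : {poly R}).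
  move=> X yb xa; ring.
have key : (W * (p^`() * q - p * q^`()))^`() =
    ((j * (j + (a + b).+1))%:R - (i * (i + (a + b).+1))%:R) *: (w * (p * q)).
  rewrite derivM dW derivB !derivM.
  have -> : W = w * ('X * (1 - 'X)) by rewrite /W /w /jacobi_weight !exprS; ring.
  set A := (a.+1%:R)%:P - _ in hp hq *.
  transitivity (w * (q * ('X * (1 - 'X) * p^`()^`() + A * p^`()) - p * ('X * (1 - 'X) * q^`()^`() + A * q^`()))).
    clear hp hq dW W; clearbody w A.
    move: ('X * (1 - 'X)) (p^`()^`()) (q^`()^`()) (p^`()) (q^`()) => Z p2 q2 p1 q1; ring.
  move: hp hq => /eqP; rewrite addr_eq0 => /eqP -> /eqP; rewrite addr_eq0 => /eqP ->.
  rewrite -!mul_polyC polyCB; clear dW W A; clearbody w; move: (_%:P) (_%:P) => *; ring.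
have := int01_deriv (W * (p^`() * q - p * q^`())).
rewrite key; have := int01_lin ((j * (j + (a + b).+1))%:R - (i * (i + (a + b).+1))%:R) (w * (p * q)) 0.
rewrite addr0 => ->; rewrite /int01 size_poly0 big_ord0 addr0.
rewrite !hornerM !hornerXn !horner_exp !hornerE subrr /= !expr0n !expr1n /= mulr0 !mul0r subrr.
rewrite -/(int01 _) => /eqP; rewrite mulf_eq0 => /orP[|/eqP//].
rewrite subr_eq0 eqr_nat => /eqP e; case/eqP: ij; nia.
Qed.

End JacobiPolynomials.

(** * Half-weighted series and summation by parts *)

Section WeightedSeries.
Context {R : realType}.
Implicit Types (u v X f : nat -> R) (tau : R).

Lemma limit_norm_le u (l B : R) : u @ \oo --> l -> (forall n, `|u n| <= B) -> `|l| <= B.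
Proof.
move=> ul uB; have nl : (fun n => `|u n|) @ \oo --> `|l| by exact: cvg_norm.
rewrite -(cvg_lim (@Rhausdorff R) nl); apply: limr_le; first exact: (cvgP _ nl).
by apply: nearW.
Qed.

(** Telescoping of 1 / k^2 <= 2 / (k (k + 1)). *)
Lemma sum_inv_sq_le (n : nat) :
  \sum_(0 <= k < n) (k.+1%:R ^+ 2)^-1 <= 2 - 2 / n.+1%:R :> R.
Proof.
elim: n => [|n IH]; first by rewrite big_nil divr1 subrr.
rewrite big_nat_recr//= (le_trans (lerD IH (lexx _)))//.
have n0 : (0 : R) <= n%:R by [].
rewrite -[n.+2%:R]natr1 -[n.+1%:R]natr1; set m := (n%:R : R) in n0 *.
have -> : 2 - 2 / (m + 1) + ((m + 1) ^+ 2)^-1 =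
   2 - 2 / (m + 1 + 1) - m / ((m + 1) ^+ 2 * (m + 1 + 1)).
  by field; apply/andP; split; lra.
rewrite gerBl; apply: divr_ge0 => //; apply: mulr_ge0; [exact: sqr_ge0|lra].
Qed.

Lemma series_inv_sq u (B : R) : (forall n, `|u n| <= B / n.+1%:R ^+ 2) ->
  cvgn (series u) /\ `|limn (series u)| <= 2 * B.
Proof.
move=> uB; have B0 : 0 <= B.
  by have := uB 0%N; rewrite expr1n divr1; apply: le_trans.
have bd n : \sum_(0 <= k < n) `|u k| <= 2 * B.
  apply: (@le_trans _ _ (\sum_(0 <= k < n) B * (k.+1%:R ^+ 2)^-1)).
    by apply: ler_sum => k _; exact: uB.
  rewrite -big_distrr/= mulrC ler_wpM2r// (le_trans (sum_inv_sq_le n))//.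
  by rewrite gerBl divr_ge0.
have cn : cvgn [normed series u].
  apply: nondecreasing_is_cvgn.
    by apply: nondecreasing_series => k _ _; exact: normr_ge0.
  by exists (2 * B) => _ [n _ <-]; exact: bd.
have cu := normed_cvg cn; split=> //.
apply: (limit_norm_le cu) => n; apply: le_trans (bd n).
exact: ler_norm_sum.
Qed.

(* The sum over nat with the term of index 0 halved is half of the sum over int
   of the even extension. *)
Definition half0 u n := if n is 0%N then u 0%N / 2 else u n.

Definition hsum u := limn (series (half0 u)).

Lemma half0_le u n : `|half0 u n| <= `|u n|.
Proof. by case: n => //=; rewrite normrM normfV (ger0_norm (_ : 0 <= 2))// ler_pdivrMr// ler_peMr// ler1n. Qed.

Lemma hsum_inv_sq u (B : R) : (forall n, `|u n| <= B / n.+1%:R ^+ 2) ->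
  cvgn (series (half0 u)) /\ `|hsum u| <= 2 * B.
Proof. by move=> uB; apply: series_inv_sq => n; exact: le_trans (half0_le u n) _. Qed.

Definition summable u := exists B : R, forall n, `|u n| <= B / n.+1%:R ^+ 2.

Lemma summable_cvg u : summable u -> cvgn (series (half0 u)).
Proof. by case=> B /hsum_inv_sq[]. Qed.

Lemma summable_lin (a b : R) u v : summable u -> summable v ->
  summable (fun n => a * u n + b * v n).
Proof.
move=> [A uA] [B vB]; exists (`|a| * A + `|b| * B) => n.
rewrite (le_trans (ler_normD _ _))// !normrM mulrDl -!mulrA.
by apply: lerD; rewrite ler_wpM2l.
Qed.

Lemma half0_lin (a b : R) u v :
  half0 (fun n => a * u n + b * v n) = (a *: half0 u) + (b *: half0 v).
Proof.
apply/funext => -[|n]; rewrite /half0 /= ?mulrDl -?mulrA //.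
Qed.

Lemma hsum_lin (a b : R) u v : summable u -> summable v ->
  hsum (fun n => a * u n + b * v n) = a * hsum u + b * hsum v.
Proof.
move=> /summable_cvg su /summable_cvg sv; rewrite /hsum half0_lin.
have cu := @is_cvg_seriesZ _ (half0 u) a su; have cv := @is_cvg_seriesZ _ (half0 v) b sv.
by rewrite (lim_seriesD cu cv) (lim_seriesZ _ su) (lim_seriesZ _ sv).
Qed.

Lemma eq_hsum u v : u =1 v -> hsum u = hsum v.
Proof. by move=> /funext ->. Qed.

Lemma hsumZ (c : R) u : summable u ->
  summable (fun n => c * u n) /\ hsum (fun n => c * u n) = c * hsum u.
Proof.
move=> su; have E : (fun n => c * u n) = (fun n => c * u n + 0 * u n).
  by apply/funext => n; rewrite mul0r addr0.
by rewrite E hsum_lin// mul0r addr0; split => //; exact: summable_lin.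
Qed.

(** This is |n - 1|: in an even extension the left neighbour of 0 carries the value at 1. *)
Definition refl_pred n := if n is m.+1 then m else 1%N.

(* second difference of the even extension of u to int *)
Definition dd u : nat -> R := fun n => u n.+1 + u (refl_pred n) - 2 * u n.

(** Discrete Green formula. The halved term of index 0 makes the boundary contribution at 0 cancel,
    by evenness, and only the one at [n] remains. *)
Lemma sum_by_parts X f n :
  \sum_(0 <= k < n.+1) half0 (fun k => X k * dd f k - dd X k * f k) k =
  X n * f n.+1 - X n.+1 * f n.
Proof.
elim: n => [|n IH].
  by rewrite big_nat1 /= /dd /=; field.
by rewrite big_nat_recr//= IH /dd /=; ring.
Qed.

Definition quad_bounded (K : R) X := forall n, `|X n| <= K * n.+1%:R ^+ 2.
Definition exp_bounded (C tau : R) f := forall n, `|f n| <= C * expR (- (tau * n%:R)).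

Lemma quad_bounded1 : quad_bounded 1 (fun=> 1).
Proof. by move=> n; rewrite normr1 mul1r -natrX ler1n expn_gt0. Qed.

Lemma quad_bounded_ge0 (K : R) X : quad_bounded K X -> 0 <= K.
Proof. by move=> /(_ 0%N); rewrite expr1n mulr1; apply: le_trans. Qed.

Lemma exp_bounded_ge0 (C tau : R) f : exp_bounded C tau f -> 0 <= C.
Proof. by move=> /(_ 0%N); rewrite mulr0 oppr0 expR0 mulr1; apply: le_trans. Qed.

Lemma quad_bounded_dd (K : R) X : quad_bounded K X -> quad_bounded (10 * K) (dd X).
Proof.
move=> XK n; have K0 := quad_bounded_ge0 XK.
rewrite /dd (le_trans (ler_normB _ _))// normrM ger0_norm//.
apply: (@le_trans _ _ (K * n.+2%:R ^+ 2 + K * (refl_pred n).+1%:R ^+ 2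
   + 2 * (K * n.+1%:R ^+ 2))).
  apply: lerD; first by rewrite (le_trans (ler_normD _ _))// lerD.
  by rewrite ler_wpM2l.
(* Neighbouring indices at most double [n.+1], so 10 = 4 + 4 + 2. *)
have h1 : (n.+2%:R ^+ 2 : R) <= 4 * n.+1%:R ^+ 2.
  by rewrite -!natrX -natrM ler_nat; nia.
have h2 : ((refl_pred n).+1%:R ^+ 2 : R) <= 4 * n.+1%:R ^+ 2.
  by rewrite -!natrX -natrM ler_nat; case: n {h1} => [|n] /=; nia.
set a := n.+2%:R ^+ 2 in h1 *; set b := (refl_pred n).+1%:R ^+ 2 in h2 *; set c := n.+1%:R ^+ 2 in h1 h2 *.
have := ler_wpM2l K0 h1; have := ler_wpM2l K0 h2; lra.
Qed.

(** The [i]-th power of y / i <= exp(y / i). *)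
Lemma pow_le_expR (i : nat) (y : R) : 0 <= y -> y ^+ i <= i%:R ^+ i * expR y.
Proof.
case: i => [|i] y0; first by rewrite !expr0 mul1r -(@expR0 R) ler_expR.
rewrite -[y in expR y](@mulfVK _ i.+1%:R)// mulrC -[_ * i.+1%:R]mulrC expRM_natl.
rewrite mulrC -exprMn; apply: lerXn2r; rewrite ?nnegrE//.
rewrite -ler_pdivrMl// mulrC (le_trans _ (expR_ge1Dx _))// lerDr//.
Qed.

(** [pow_le_expR] with exponent 4, whence 256 = 4^4; [expR 1] pays for replacing [n] by [n.+1].
    Exponent 4 is what still leaves an inverse square after multiplication by a quadratically
    bounded sequence. *)
Lemma exp_decay_le tau n : 0 < tau <= 1 ->
  expR (- (tau * n%:R)) <= 256 * expR 1 * tau ^- 4 / n.+1%:R ^+ 4.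
Proof.
move=> /andP[t0 t1].
have := @pow_le_expR 4 (tau * n.+1%:R) (mulr_ge0 (ltW t0) (ler0n _ _)).
have -> : expR (tau * n.+1%:R) = expR tau * expR (tau * n%:R).
  by rewrite -expRD -natr1; congr expR; ring.
have e1 : expR tau <= expR 1 :> R by rewrite ler_expR.
have e0 := expR_gt0 (tau * n%:R).
move=> h; rewrite expRN -[leLHS]mul1r ler_pdivrMr// mulrAC ler_pdivlMr ?exprn_gt0//.
rewrite mulrAC ler_pdivlMr ?exprn_gt0// mul1r mulrC -exprMn (le_trans h)//.
have -> : (4%:R : R) ^+ 4 = 256 by ring.
by have := ler_wpM2r (ltW e0) e1; lra.
Qed.

Lemma bounded_summable (K C tau : R) X f : 0 < tau <= 1 ->
  quad_bounded K X -> exp_bounded C tau f ->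
  forall n, `|X n * f n| <= (K * C * (256 * expR 1) * tau ^- 4) / n.+1%:R ^+ 2.
Proof.
move=> t01 XK fC n; have K0 := quad_bounded_ge0 XK; have C0 := exp_bounded_ge0 fC.
rewrite normrM; apply: le_trans (ler_pM _ _ (XK n) (fC n)) _ => //.
have := ler_wpM2l C0 (exp_decay_le n t01) => /(ler_wpM2l (_ : 0 <= K * n.+1%:R ^+ 2)).
move=> /(_ _)/le_trans; apply; first by rewrite mulr_ge0// sqr_ge0.
have t0 : tau != 0 by case/andP: t01 => /lt0r_neq0.
have n0 : n.+1%:R != 0 :> R by rewrite pnatr_eq0.
move: (n.+1%:R) n0 => N n0.
rewrite le_eqVlt; apply/orP; left; apply/eqP; by field; rewrite t0 n0.
Qed.

Lemma bounded_is_summable (K C tau : R) X f : 0 < tau <= 1 ->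
  quad_bounded K X -> exp_bounded C tau f -> summable (fun n => X n * f n).
Proof. by move=> t XK fC; eexists; exact: bounded_summable t XK fC. Qed.

Lemma exp_boundedS (C tau : R) f : 0 < tau -> exp_bounded C tau f ->
  exp_bounded C tau (fun n => f n.+1).
Proof.
move=> t0 fC n; have C0 := exp_bounded_ge0 fC; apply: le_trans (fC _) _.
by rewrite ler_wpM2l// ler_expR lerN2 ler_pM2l// ler_nat.
Qed.

Lemma exp_bounded_dd (C tau : R) f : 0 < tau <= 1 -> exp_bounded C tau f ->
  exp_bounded (C * (3 + expR 1)) tau (dd f).
Proof.
move=> /andP[t0 t1] fC n; have C0 := exp_bounded_ge0 fC.
rewrite /dd (le_trans (ler_normB _ _))// normrM ger0_norm//.
rewrite (le_trans (lerD (ler_normD _ _) (lexx _)))//.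
have h1 := exp_boundedS t0 fC n; have h2 := fC n.
have h3 : `|f (refl_pred n)| <= C * (expR 1 * expR (- (tau * n%:R))).
  apply: le_trans (fC _) _; rewrite ler_wpM2l// -expRD ler_expR.
  by case: n {h1 h2} => [|n] /=; rewrite -?natr1; nra.
move: h1 h2 h3; set e := expR (- _); lra.
Qed.

(** The boundary terms left by [sum_by_parts] are themselves dominated by an inverse square, so they
    tend to 0. *)
Lemma hsum_dd (K C tau : R) X f : 0 < tau <= 1 ->
  quad_bounded K X -> exp_bounded C tau f ->
  hsum (fun n => X n * dd f n) = hsum (fun n => dd X n * f n).
Proof.
move=> t01 XK fC; apply/eqP; rewrite -subr_eq0; apply/eqP.
have s1 := bounded_is_summable t01 XK (exp_bounded_dd t01 fC).
have s2 := bounded_is_summable t01 (quad_bounded_dd XK) fC.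
transitivity (hsum (fun n => 1 * (X n * dd f n) + (-1) * (dd X n * f n))).
  by rewrite hsum_lin//; ring.
apply: cvg_lim; first exact: Rhausdorff.
rewrite -cvg_shiftS.
have -> : [sequence series (half0 (fun n => 1 * (X n * dd f n) + -1 * (dd X n * f n))) n.+1]_n
   = (fun n => X n * f n.+1 - X n.+1 * f n).
  apply/funext => n; rewrite -sum_by_parts /series /=; apply: eq_bigr => k _.
  by congr (half0 _ _); apply/funext => m; ring.
pose B := K * C * (256 * expR 1) * tau ^- 4 + 4 * K * C * (256 * expR 1) * tau ^- 4.
have t0 : 0 < tau by case/andP: t01.
have XK4 : quad_bounded (4 * K) (fun n => X n.+1).
  move=> n; apply: le_trans (XK _) _.
  have h : (n.+2%:R ^+ 2 : R) <= 4 * n.+1%:R ^+ 2 by rewrite -!natrX -natrM ler_nat; nia.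
  by apply: le_trans (ler_wpM2l (quad_bounded_ge0 XK) h) _; rewrite mulrCA mulrA.
have bd n : `|X n * f n.+1 - X n.+1 * f n| <= B / n.+1%:R ^+ 2.
  rewrite (le_trans (ler_normB _ _))// mulrDl lerD//.
    exact: (bounded_summable t01 XK (exp_boundedS t0 fC)).
  by have := bounded_summable t01 XK4 fC n; rewrite !mulrA.
have [cv _] := series_inv_sq bd.
exact: cvg_series_cvg_0 cv.
Qed.

End WeightedSeries.

(** * Iterated differences of the Gaussian and decay of oscillating sums *)

Section GaussianSums.
Context {R : realType}.
Implicit Types (tau y : R) (p : {poly R}).

Definition gauss_poly p y : R := p.[y] * expR (- y ^+ 2).

Definition gauss_deriv p : {poly R} := p^`() - 2 *: ('X * p).

Lemma is_derive_gauss_poly p y :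
  is_derive y 1 (gauss_poly p) (gauss_poly (gauss_deriv p) y).
Proof.
have d1 : is_derive y 1 (fun z : R => - z ^+ 2) (- (2 * y)).
  have := is_deriveN (@is_deriveX _ _ (@id R) 2 y 1 1 (is_derive_id _ _)).
  by move=> /is_derive_eq; apply; rewrite expr1 [_ *: _]mulr1.
have d2 := @is_derive1_comp _ expR (fun z : R => - z ^+ 2) y _ _ (is_derive_expR (- y ^+ 2)) d1.
have := is_deriveM (is_derive_poly p y) d2.
move=> /is_derive_eq; apply; rewrite /gauss_poly /gauss_deriv !hornerE /=.
rewrite ![_ *: _]mulrC /=; ring.
Qed.

(** Rests on 2 |y| - y^2 <= 1: one factor exp(|y|) absorbs the polynomial, the other provides the
    decay. *)
Lemma gauss_poly_bound p : exists C : R, forall y, `|gauss_poly p y| <= C * expR (- `|y|).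
Proof.
exists ((\sum_(i < size p) `|p`_i| * i%:R ^+ i) * expR 1) => y.
rewrite /gauss_poly normrM (ger0_norm (expR_ge0 _)).
have h1 : `|p.[y]| <= (\sum_(i < size p) `|p`_i| * i%:R ^+ i) * expR `|y|.
  rewrite horner_coef (le_trans (ler_norm_sum _ _ _))// big_distrl/=.
  apply: ler_sum => i _; rewrite normrM -mulrA ler_wpM2l// normrX.
  exact: pow_le_expR.
apply: le_trans (ler_wpM2r (expR_ge0 _) h1) _.
rewrite -!mulrA ler_wpM2l//.
  by apply: sumr_ge0 => i _; rewrite mulr_ge0// exprn_ge0.
rewrite -!expRD ler_expR -subr_ge0 -[y ^+ 2]real_normK ?num_real//.
have -> : 1 - `|y| - (`|y| - `|y| ^+ 2) = (`|y| - 1) ^+ 2 by ring.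
exact: sqr_ge0.
Qed.

Definition dd_step tau (f : R -> R) : R -> R := fun y => f (y + tau) + f (y - tau) - 2 * f y.

Lemma is_derive_translate (f f' : R -> R) (c y : R) : (forall z : R, is_derive z 1 f (f' z)) ->
  is_derive y 1 (fun z : R => f (z + c)) (f' (y + c)).
Proof.
move=> df; have := @is_derive1_comp _ f (shift c) y _ _ (df (y + c)) (is_derive_shift y 1 c).
by rewrite mulr1.
Qed.

Lemma is_derive_dd_step tau (f f' : R -> R) : (forall y : R, is_derive y 1 f (f' y)) ->
  forall y, is_derive y 1 (dd_step tau f) (dd_step tau f' y).
Proof.
move=> df y.
have d1 := is_derive_translate tau y df; have d2 := is_derive_translate (- tau) y df.
exact: (is_deriveB (is_deriveD d1 d2) (is_deriveZ 2 (df y))).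
Qed.

Lemma is_derive_iter_dd_step tau m (f f' : R -> R) : (forall y : R, is_derive y 1 f (f' y)) ->
  forall y, is_derive y 1 (iter m (dd_step tau) f) (iter m (dd_step tau) f' y).
Proof. by move=> df; elim: m => [|m IH] //= y; exact: is_derive_dd_step. Qed.

Lemma is_derive_continuous (f f' : R -> R) (a b : R) : (forall y : R, is_derive y 1 f (f' y)) ->
  {within `[a, b], continuous f}.
Proof. by move=> df; apply: derivable_within_continuous => y _; have [] := df y. Qed.

Lemma mean_value (f f' : R -> R) (a b : R) : a <= b -> (forall y : R, is_derive y 1 f (f' y)) ->
  exists2 c, a <= c <= b & f b - f a = f' c * (b - a).
Proof.
move=> ab df; have [c] := MVT_segment ab (fun y _ => df y) (is_derive_continuous df).
by rewrite in_itv/= => cab E; exists c.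
Qed.

(** Mean values turn the second difference into [f'' c * (c1 - c2) * tau] with [c1 - c2 <= 2 * tau].
    The point [c] is within distance 1 of [y], which costs the factor [expR 1]. *)
Lemma dd_step_bound tau (f f' f'' : R -> R) (B : R) : 0 < tau <= 1 ->
  (forall y : R, is_derive y 1 f (f' y)) -> (forall y : R, is_derive y 1 f' (f'' y)) ->
  (forall y, `|f'' y| <= B * expR (- `|y|)) ->
  forall y, `|dd_step tau f y| <= 2 * expR 1 * B * tau ^+ 2 * expR (- `|y|).
Proof.
move=> /andP[t0 t1] df df' fB y.
have B0 : 0 <= B by have := fB 0; rewrite normr0 oppr0 expR0 mulr1; apply: le_trans.
have y1 : y <= y + tau by rewrite lerDl ltW.
have y2 : y - tau <= y by rewrite gerBl ltW.
have [c1 /andP[c1a c1b] E1] := mean_value y1 df.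
have [c2 /andP[c2a c2b] E2] := mean_value y2 df.
have c21 : c2 <= c1 by exact: le_trans c1a.
have [c /andP[ca cb] E3] := mean_value c21 df'.
have -> : dd_step tau f y = f'' c * (c1 - c2) * tau.
  rewrite -E3 /dd_step.
  have -> : f (y + tau) = f y + f' c1 * tau by rewrite -[X in _ = _ + _ * X](addKr y) [- y + _]addrC -E1; ring.
  have -> : f (y - tau) = f y - f' c2 * tau by have := E2; rewrite (_ : y - (y - tau) = tau) => [<-|]; ring.
  ring.
rewrite !normrM (gtr0_norm t0) (@ger0_norm _ (c1 - c2)) ?subr_ge0//.
have cy : - `|c| <= 1 - `|y|.
  have : `|y| <= `|c| + `|y - c| by rewrite -[in leLHS](subrK c y) addrC ler_normD.
  have : `|y - c| <= 1 by rewrite ler_norml; apply/andP; split; lra.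
  lra.
have h := le_trans (fB c) (ler_wpM2l B0 (_ : expR (- `|c|) <= expR 1 * expR (- `|y|))).
have {}h : `|f'' c| <= B * (expR 1 * expR (- `|y|)) by apply: h; rewrite -expRD ler_expR.
have h2 : (c1 - c2) * tau <= 2 * tau ^+ 2 by rewrite expr2; nra.
rewrite -mulrA (le_trans (ler_pM _ _ h h2))//.
  by rewrite mulr_ge0 ?subr_ge0// ltW.
by rewrite le_eqVlt; apply/orP; left; apply/eqP; ring.
Qed.

(** Differences commute with derivatives: the induction hypothesis is applied to the second
    derivative of [gauss_poly p], and the outermost difference gains [tau ^+ 2]. *)
Lemma iter_dd_gauss_bound m p : exists C : R, forall tau, 0 < tau <= 1 -> forall y,
  `|iter m (dd_step tau) (gauss_poly p) y| <= C * tau ^+ (2 * m) * expR (- `|y|).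
Proof.
elim: m p => [|m IH] p.
  have [C h] := gauss_poly_bound p; exists C => tau _ y.
  by rewrite muln0 expr0 mulr1; exact: h.
have [C h] := IH (gauss_deriv (gauss_deriv p)); exists (2 * expR 1 * C) => tau t01 y.
have := dd_step_bound t01 (is_derive_iter_dd_step tau m (is_derive_gauss_poly p))
  (is_derive_iter_dd_step tau m (is_derive_gauss_poly (gauss_deriv p))) (h tau t01) y.
rewrite -/(iter m.+1 (dd_step tau) (gauss_poly p)) => /le_trans; apply.
rewrite le_eqVlt; apply/orP; left; apply/eqP.
by rewrite mulnS exprD; ring.
Qed.

Definition gauss tau (n : nat) : R := expR (- (tau * n%:R) ^+ 2).

Lemma iter_dd_even tau m (f : R -> R) : (forall y, f (- y) = f y) ->
  forall y, iter m (dd_step tau) f (- y) = iter m (dd_step tau) f y.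
Proof.
move=> fe; elim: m => [|m IH] y //=; rewrite /dd_step.
have -> : - y + tau = - (y - tau) by ring.
have -> : - y - tau = - (y + tau) by ring.
by rewrite !IH; ring.
Qed.

Lemma iter_dd_gauss tau m n :
  iter m dd (gauss tau) n = iter m (dd_step tau) (gauss_poly 1) (tau * n%:R).
Proof.
elim: m n => [|m IH] n; first by rewrite /= /gauss_poly hornerC mul1r.
rewrite [LHS]/= /dd !IH [RHS]/= /dd_step; congr (_ + _ - _).
  by rewrite -[n.+1%:R]natr1 mulrDr mulr1.
case: n => [|n] /=; last by rewrite -[n.+1%:R]natr1 mulrDr mulr1 addrK.
rewrite mulr0 add0r mulr1 iter_dd_even// => y.
by rewrite /gauss_poly !hornerC sqrrN.
Qed.

Lemma exp_bounded_iter_dd m : exists C : R, forall tau, 0 < tau <= 1 ->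
  exp_bounded (C * tau ^+ (2 * m)) tau (iter m dd (gauss tau)).
Proof.
have [C h] := iter_dd_gauss_bound m 1; exists C => tau t01 n.
rewrite iter_dd_gauss (le_trans (h _ t01 _))// ger0_norm// mulr_ge0//.
by case/andP: t01 => /ltW.
Qed.

(** Summation costs a factor [tau ^- 4] that does not depend on [m], so it can be made up for by
    taking more differences. *)
Lemma hsum_iter_dd_bound X (K : R) m : quad_bounded K X -> exists C : R,
  forall tau, 0 < tau <= 1 ->
  `|hsum (fun n => X n * iter m dd (gauss tau) n)| * tau ^+ 4 <= C * tau ^+ (2 * m).
Proof.
move=> XK; have [C h] := exp_bounded_iter_dd m.
exists (2 * (K * C * (256 * expR 1))) => tau t01.
have [_] := hsum_inv_sq (bounded_summable t01 XK (h tau t01)).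
have t0 : 0 < tau ^+ 4 by rewrite exprn_gt0//; case/andP: t01.
rewrite -ler_pdivlMr// => /le_trans; apply.
by rewrite le_eqVlt; apply/orP; left; apply/eqP; field; case/andP: t01 => /lt0r_neq0.
Qed.

(** Negligible to all orders at 0. The variable is the square root of the time. *)
Definition rapid_decay (f : R -> R) : Prop := forall M, exists D : R,
  forall tau, 0 < tau <= 1 -> `|f tau| <= D * tau ^+ M.

(* The characteristic roots of X are unit complex numbers different from 1, so
   X is a combination of its second and fourth differences; moving these onto
   the Gaussian gains powers of tau indefinitely. *)
Lemma oscillating_sum_decay X (K A B : R) : quad_bounded K X -> 0 < A -> 0 < B ->
  (forall n, dd (dd X) n + (A + B) * dd X n + A * B * X n = 0) ->
  rapid_decay (fun tau => hsum (fun n => X n * gauss tau n)).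
Proof.
move=> XK A0 B0 rec.
pose s tau m := hsum (fun n => X n * iter m dd (gauss tau) n).
have [P [Q srec]] : exists P Q, forall tau m, 0 < tau <= 1 ->
    s tau m = P * s tau m.+1 + Q * s tau m.+2.
  exists (- ((A + B) / (A * B))), (- (A * B)^-1) => tau m t01. have [C h] := exp_bounded_iter_dd m.
  have fC := h _ t01; have fC' := exp_bounded_dd t01 fC.
  have XK' := quad_bounded_dd XK.
  rewrite /s [iter m.+1 _ _]/= [iter m.+2 _ _]/=.
  rewrite (hsum_dd t01 XK fC) (hsum_dd t01 XK fC') (hsum_dd t01 XK' fC).
  rewrite -hsum_lin; [|exact: bounded_is_summable t01 XK' fC|
    exact: bounded_is_summable t01 (quad_bounded_dd XK') fC].
  apply: eq_hsum => n; have := rec n.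
  move=> /eqP; rewrite addr_eq0 => /eqP e.
  have -> : X n = - (A * B)^-1 * (dd (dd X) n + (A + B) * dd X n).
    by rewrite e; field; rewrite !gt_eqF.
  by field; rewrite !gt_eqF.
have bnd j : forall m, exists C : R, forall tau, 0 < tau <= 1 ->
    `|s tau m| * tau ^+ 4 <= C * tau ^+ (2 * (m + j)).
  elim: j => [|j IH] m; first by rewrite addn0; exact: hsum_iter_dd_bound XK.
  have [C1 h1] := IH m.+1; have [C2 h2] := IH m.+2.
  exists (`|P| * C1 + `|Q| * `|C2|) => tau t01.
  have [t0 t1] := andP t01; have t4 : 0 <= tau ^+ 4 by rewrite exprn_ge0 ?ltW.
  rewrite srec// (le_trans (ler_wpM2r t4 (ler_normD _ _)))// !normrM !mulrDl.
  rewrite -!mulrA; apply: lerD; rewrite ler_wpM2l//.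
    by rewrite (le_trans (h1 _ t01))// addSnnS.
  rewrite (le_trans (h2 _ t01))//.
  apply: (@le_trans _ _ (`|C2| * tau ^+ (2 * (m.+2 + j)))).
    by rewrite ler_wpM2r ?ler_norm// exprn_ge0 ?ltW.
  by rewrite ler_wpM2l// ler_wiXn2l ?(ltW t0)//; lia.
(* The exponent 2 (M + 2) = 2 M + 4 covers the factor [tau ^+ 4] on the left and leaves at least
   [M]. *)
move=> M; have [C h] := bnd (M + 2)%N 0%N; exists `|C| => tau t01.
have [t0 t1] := andP t01.
have := h _ t01; rewrite -ler_pdivlMr ?exprn_gt0// => /le_trans; apply.
rewrite ler_pdivrMr ?exprn_gt0// -mulrA -exprD.
apply: (@le_trans _ _ (`|C| * tau ^+ (2 * (0 + (M + 2))))).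
  by rewrite ler_wpM2r ?ler_norm// exprn_ge0 ?ltW.
by rewrite ler_wpM2l// ler_wiXn2l ?(ltW t0)//; lia.
Qed.

End GaussianSums.

(** * Asymptotics of the theta sums with coefficients 1 and n^2 *)

Section ThetaAsymptotics.
Context {R : realType}.
Implicit Types (tau y : R) (X u : nat -> R).

Lemma gauss_exp_bounded tau : 0 < tau <= 1 -> exp_bounded (expR 1) tau (gauss tau).
Proof.
move=> /andP[t0 t1] n; rewrite /gauss ger0_norm ?expR_ge0// -expRD ler_expR.
have := sqr_ge0 (tau * n%:R - 1); set z := tau * n%:R; have : 0 <= z by rewrite mulr_ge0// ltW.
nra.
Qed.

Definition alternate X : nat -> R := fun n => (-1) ^+ n * X n.

Lemma half0_even_sum u N :
  \sum_(0 <= k < N.*2) half0 (fun n => u n + (-1) ^+ n * u n) k =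
  \sum_(0 <= k < N) half0 (fun n => 2 * u n.*2) k.
Proof.
elim: N => [|N IH]; first by rewrite !big_geq.
rewrite doubleS !big_nat_recr//= IH -addrA; congr (_ + _).
rewrite -signr_odd /= odd_double expr1 mulN1r subrr addr0.
case: N {IH} => [|N]; first by rewrite /= expr0 mul1r; field.
by rewrite /= -signr_odd /= odd_double expr0 mul1r mulrDl mul1r.
Qed.

(** Adding the alternating series cancels the odd terms and doubles the even ones, the halved term
    of index 0 included. *)
Lemma hsum_double u : summable u ->
  hsum u + hsum (alternate u) = 2 * hsum (fun n => u n.*2).
Proof.
move=> su; have [B uB] := su.
have sa : summable (alternate u).
  by exists B => n; rewrite /alternate normrM normrX normrN1 expr1n mul1r.
have s2 : summable (fun n => u n.*2).
  exists B => n; apply: le_trans (uB _) _.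
  have B0 : 0 <= B by have := uB 0%N; rewrite expr1n divr1; apply: le_trans.
  rewrite ler_wpM2l// lef_pV2 ?posrE ?exprn_gt0// lerXn2r ?nnegrE// ler_nat.
  by rewrite ltnS -addnn leq_addr.
have E1 : hsum u + hsum (alternate u) = hsum (fun n => u n + (-1) ^+ n * u n).
  have := hsum_lin 1 1 su sa; rewrite !mul1r => <-.
  by apply: eq_hsum => n; rewrite !mul1r.
have [sB <-] := hsumZ 2 s2.
have sA : summable (fun n => u n + (-1) ^+ n * u n).
  have [B' h] := summable_lin 1 1 su sa; exists B' => n.
  by have := h n; rewrite !mul1r.
rewrite E1; apply: cvg_lim; first exact: Rhausdorff.
have c1 := summable_cvg sA.
suff -> : hsum (fun n => 2 * u n.*2) = limn (series (half0 (fun n => u n + (-1) ^+ n * u n))) by [].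
have sub2 : (fun N => N.*2) @ \oo --> \oo.
  move=> A [N _ NA]; exists N => // n /= Nn; apply: NA => /=.
  by rewrite (leq_trans Nn)// -addnn leq_addr.
have := cvg_comp _ _ sub2 c1.
move=> /(cvg_lim (@Rhausdorff R)) <-; rewrite /hsum; congr (limn _).
by apply/funext => N; rewrite /= /series /= half0_even_sum.
Qed.

(** [H] behaves as a primitive of [K] up to local errors of order [tau ^+ 2]. Their weights form a
    geometric series of sum at most [2 / tau], because [tau / 2 <= 1 - expR (- tau)]. *)
Lemma telescope_bound (H K : R -> R) tau (B : R) : 0 < tau <= 1 ->
  (forall y, 0 <= y -> forall h, 0 <= h -> h <= tau ->
     `|H (y + h) - H y - h * K y| <= h ^+ 2 * B * expR (- y)) ->
  forall N, `|\sum_(0 <= n < N) tau * K (tau * n%:R) - (H (tau * N%:R) - H 0)| <= 2 * B * tau.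
Proof.
move=> /andP[t0 t1] HK N.
have B0 : 0 <= B.
  have := HK 0 (lexx _) tau (ltW t0) (lexx _); rewrite oppr0 expR0 mulr1 => /(le_trans (normr_ge0 _)).
  by rewrite pmulr_rge0// exprn_gt0.
apply: (@le_trans _ _ (\sum_(0 <= n < N) tau ^+ 2 * B * expR (- (tau * n%:R)))).
  elim: N => [|N IH]; first by rewrite !big_geq// mulr0 subrr sub0r oppr0 normr0.
  rewrite !big_nat_recr//=.
  have -> : \sum_(0 <= n < N) tau * K (tau * n%:R) + tau * K (tau * N%:R) - (H (tau * N.+1%:R) - H 0)
     = (\sum_(0 <= n < N) tau * K (tau * n%:R) - (H (tau * N%:R) - H 0)) -
       (H (tau * N%:R + tau) - H (tau * N%:R) - tau * K (tau * N%:R)).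
    by rewrite -[N.+1%:R]natr1 mulrDr mulr1; ring.
  have tN : 0 <= tau * N%:R by rewrite mulr_ge0// ltW.
  by rewrite (le_trans (ler_normB _ _))// lerD// HK// ltW.
rewrite -big_distrr/=.
have et : expR tau * expR (- tau) = 1 by exact: expRxMexpNx_1.
have e1 := expR_ge1Dx tau; have e0 := expR_gt0 (- tau).
have geo : (1 - expR (- tau)) * \sum_(0 <= n < N) expR (- (tau * n%:R)) <= 1.
  have -> : \sum_(0 <= n < N) expR (- (tau * n%:R)) = \sum_(i < N) expR (- tau) ^+ i.
    by rewrite big_mkord; apply: eq_bigr => i _; rewrite -expRM_natl; congr expR; ring.
  have := subrX1 (expR (- tau)) N; have : 0 <= expR (- tau) ^+ N by rewrite exprn_ge0 ?(ltW t0).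
  set S := \sum_(_ < _) _; move=> e2 e3.
  by have -> : (1 - expR (- tau)) * S = - ((expR (- tau) - 1) * S); [ring|rewrite -e3; lra].
set S := \sum_(_ <= _ < _) _ in geo *.
have S0 : 0 <= S by apply: sumr_ge0 => i _; exact: expR_ge0.
have tS : tau * S <= 2.
  have : tau / 2 <= 1 - expR (- tau) by nra.
  by move=> /(ler_wpM2r S0); lra.
have -> : tau ^+ 2 * B * S = B * tau * (tau * S) by ring.
have := ler_wpM2l (mulr_ge0 B0 (ltW t0)) tS; lra.
Qed.

(** Continuity up to 0 with derivability on the open half-line is what a primitive defined as an
    integral from 0 provides; two applications of the mean value theorem give the quadratic
    error. *)
Lemma riemann_step (H : R -> R) (p : {poly R}) :
  (forall x : R, 0 <= x -> {within `[0, x], continuous H}) ->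
  (forall y : R, 0 < y -> is_derive y 1 H (gauss_poly p y)) ->
  exists B : R, forall y, 0 <= y -> forall h, 0 <= h ->
    `|H (y + h) - H y - h * gauss_poly p y| <= h ^+ 2 * B * expR (- y).
Proof.
move=> cH dH; have [B hB] := gauss_poly_bound (gauss_deriv p); exists B => y y0 h h0.
have yh : y <= y + h by rewrite lerDl.
have dH' x : x \in `]y, (y + h)[ -> is_derive x 1 H (gauss_poly p x).
  by rewrite in_itv/= => /andP[yx _]; apply: dH; exact: le_lt_trans yx.
have cH' : {within `[y, y + h], continuous H}.
  apply: continuous_subspaceW (cH (y + h) _); last by rewrite addr_ge0.
  by apply: subset_itvr => //=; rewrite bnd_simp.
have [c] := MVT_segment yh dH' cH'; rewrite in_itv/= => /andP[yc ch] ->.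
have [d /andP[yd dc] E] := mean_value yc (is_derive_gauss_poly p).
have -> : gauss_poly p c * (y + h - y) - h * gauss_poly p y =
  h * (gauss_poly p c - gauss_poly p y) by ring.
rewrite E normrM (ger0_norm h0) [X in h * X]normrM (@ger0_norm _ (c - y)) ?subr_ge0//.
have h1 : `|gauss_poly (gauss_deriv p) d| <= B * expR (- y).
  apply: le_trans (hB d) _; have B0 : 0 <= B.
    by have := hB 0; rewrite normr0 oppr0 expR0 mulr1; apply: le_trans.
  by rewrite ler_wpM2l// ler_expR lerN2 ger0_norm ?(le_trans y0 yd).
have h2 : c - y <= h by lra.
have := ler_pM (normr_ge0 _) (_ : 0 <= c - y) h1 h2; rewrite subr_ge0 => /(_ yc)/(ler_wpM2l h0).
by rewrite expr2; lra.
Qed.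

Lemma poly_summable p tau : 0 < tau <= 1 -> summable (fun n => gauss_poly p (tau * n%:R)).
Proof.
move=> t01; have [C h] := gauss_poly_bound p.
have eb : exp_bounded C tau (fun n => gauss_poly p (tau * n%:R)).
  move=> n; rewrite (le_trans (h _))// ger0_norm// mulr_ge0//.
  by case/andP: t01 => /ltW.
have [B hB] := bounded_is_summable t01 (@quad_bounded1 R) eb; exists B => n.
by have := hB n; rewrite mul1r.
Qed.

Lemma riemann_limit (H : R -> R) (p : {poly R}) (C : R) :
  (forall x : R, 0 <= x -> {within `[0, x], continuous H}) ->
  (forall y : R, 0 < y -> is_derive y 1 H (gauss_poly p y)) ->
  (forall tau, 0 < tau <= 1 -> (fun N : nat => H (tau * N%:R) - H 0) @ \oo --> C) ->
  exists C' : R, forall tau, 0 < tau <= 1 ->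
    `|tau * hsum (fun n => gauss_poly p (tau * n%:R)) - C| <= C' * tau.
Proof.
move=> cH dH limH; have [B hB] := riemann_step cH dH.
exists (2 * B + `|gauss_poly p 0|) => tau t01; have [t0 t1] := andP t01.
pose u n := gauss_poly p (tau * n%:R).
have cs := summable_cvg (poly_summable p t01).
have lim1 : (fun N => tau * series (half0 u) N - (H (tau * N%:R) - H 0)) @ \oo -->
    tau * hsum u - C.
  by apply: cvgB; [apply: cvgMr; exact: cs|exact: limH].
apply: (limit_norm_le lim1) => N.
have hB' y : 0 <= y -> forall h, 0 <= h -> h <= tau ->
    `|H (y + h) - H y - h * gauss_poly p y| <= h ^+ 2 * B * expR (- y).
  by move=> y0 h h0 _; exact: hB.
have := telescope_bound t01 hB' N.
(* What halving the term of index 0 removes from the left Riemann sum; it is O(tau). *)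
pose Z := if N is 0%N then 0 else tau * (gauss_poly p 0 / 2).
have -> : \sum_(0 <= n < N) tau * gauss_poly p (tau * n%:R) = tau * series (half0 u) N + Z.
  rewrite /Z /series /= -big_distrr/=; case: (N) => [|N']; first by rewrite !big_geq// addr0.
  rewrite !big_nat_recl//= -mulrDr; congr (_ * _).
  rewrite mulr0 /u mulr0.
  by field.
set X := tau * series _ _; set Y := H _ - H _.
have Zb : `|Z| <= tau * `|gauss_poly p 0|.
  rewrite /Z; case: (N) => [|_]; first by rewrite normr0 mulr_ge0// ltW.
  rewrite normrM (gtr0_norm t0) normrM ler_wpM2l ?(ltW t0)// ler_piMr//.
  by rewrite normfV ger0_norm// invf_le1 ?ler1n.
move=> h; have -> : X - Y = (X + Z - Y) - Z by ring.
rewrite (le_trans (ler_normB _ _))//; move: h Zb; lra.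
Qed.

Lemma le_add_pow2 (a b c : R) : (forall k : nat, a <= b + c / 2 ^+ k) -> a <= b.
Proof.
move=> h; apply/ler_addgt0Pr => e e0.
have [c0|c0] := leP c 0.
  by apply: le_trans (h 0%N) _; rewrite expr0 divr1; lra.
apply: le_trans (h (Num.truncn (c / e)).+1) _; rewrite lerD2l.
rewrite ler_pdivrMr ?exprn_gt0// -ler_pdivrMl// mulrC.
apply: ltW; apply: lt_le_trans (truncnS_gt _) _.
by rewrite -natrX ler_nat ltnW// ltn_expl.
Qed.

(* Telescoping along tau / 2 ^ k: rapidly decaying increments improve an O(tau)
   remainder to a rapidly decaying one. *)
Lemma asymptotics_of_doubling (phi : R -> R) (C C' : R) :
  (forall tau, 0 < tau <= 1 -> `|phi tau - C| <= C' * tau) ->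
  rapid_decay (fun tau => phi (tau * 2) - phi tau) -> rapid_decay (fun tau => phi tau - C).
Proof.
(* One power more than required: the spare factor [tau / 2 ^+ k] makes the increments summable in
   [k]. *)
move=> h1 h2 M; have [D hD] := h2 M.+1; exists D => tau t01; have [t0 t1] := andP t01.
have D0 : 0 <= D by have := hD 1; rewrite ltr01 lexx expr1n mulr1 => /(_ isT); apply: le_trans.
have tk (k : nat) : 0 < tau / 2 ^+ k <= tau.
  rewrite divr_gt0 ?exprn_gt0//= ler_pdivrMr ?exprn_gt0// ler_peMr ?(ltW t0)//.
  by rewrite exprn_ege1// ler1n.
have tk1 k : 0 < tau / 2 ^+ k <= 1.
  by have /andP[-> /le_trans->] := tk k.
apply: (@le_add_pow2 _ _ (C' * tau)) => k.
have step : `|phi tau - phi (tau / 2 ^+ k)| <= D * tau ^+ M * (1 - (2 ^+ k)^-1).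
  elim: k => [|k IH]; first by rewrite expr0 divr1 invr1 !subrr normr0 mulr0.
  have -> : phi tau - phi (tau / 2 ^+ k.+1) =
    (phi tau - phi (tau / 2 ^+ k)) + (phi (tau / 2 ^+ k.+1 * 2) - phi (tau / 2 ^+ k.+1)).
    have -> : tau / 2 ^+ k.+1 * 2 = tau / 2 ^+ k.
      by rewrite exprS; field; rewrite expf_neq0.
    ring.
  rewrite (le_trans (ler_normD _ _))//.
  have e := hD _ (tk1 k.+1).
  have : (tau / 2 ^+ k.+1) ^+ M.+1 <= tau ^+ M * (2 ^+ k.+1)^-1.
    rewrite exprS mulrC; apply: ler_pM.
    - by rewrite exprn_ge0// divr_ge0 ?exprn_ge0 ?(ltW t0).
    - by rewrite divr_ge0 ?exprn_ge0 ?(ltW t0).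
    - rewrite lerXn2r ?nnegrE ?(ltW t0)//; first by rewrite divr_ge0 ?exprn_ge0 ?(ltW t0).
      by have /andP[] := tk k.+1.
    - by rewrite ler_piMl ?invr_ge0 ?exprn_ge0.
  move=> /(ler_wpM2l D0) e2.
  apply: le_trans (lerD IH (le_trans e e2)) _.
  have -> : (2 ^+ k)^-1 = 2 * (2 ^+ k.+1)^-1 :> R.
    by rewrite exprS; field; rewrite expf_neq0.
  by rewrite le_eqVlt; apply/orP; left; apply/eqP; ring.
have -> : phi tau - C = (phi tau - phi (tau / 2 ^+ k)) + (phi (tau / 2 ^+ k) - C) by ring.
rewrite (le_trans (ler_normD _ _))// lerD//; last by rewrite -mulrA; exact: h1.
apply: le_trans step _; rewrite ler_piMr ?mulr_ge0 ?exprn_ge0 ?(ltW t0)//.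
Qed.

(** Alternating sequences correspond to the characteristic root -1, for which both constants are 2 -
    2 cos(pi) = 4. *)
Lemma alternate_decay (X : nat -> R) (K : R) : quad_bounded K X ->
  (forall n, dd (dd (alternate X)) n + 8 * dd (alternate X) n + 16 * alternate X n = 0) ->
  rapid_decay (fun tau => hsum (fun n => alternate X n * gauss tau n)).
Proof.
move=> XK h; have XK' : quad_bounded K (alternate X).
  by move=> n; rewrite /alternate normrM normrX normrN1 expr1n mul1r.
apply: (oscillating_sum_decay XK' (_ : 0 < 4) (_ : 0 < 4)) => // n.
by rewrite -[RHS](h n); ring.
Qed.

(* The sum at 2 tau compares with the sum at tau and the alternating sum, and the
   latter decays rapidly. *)
Lemma gauss_poly_asymptotics (H : R -> R) (p : {poly R}) (C K : R) (X : nat -> R) (d : nat) :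
  (forall x : R, 0 <= x -> {within `[0, x], continuous H}) ->
  (forall y : R, 0 < y -> is_derive y 1 H (gauss_poly p y)) ->
  (forall tau, 0 < tau <= 1 -> (fun N : nat => H (tau * N%:R) - H 0) @ \oo --> C) ->
  quad_bounded K X ->
  (forall n, dd (dd (alternate X)) n + 8 * dd (alternate X) n + 16 * alternate X n = 0) ->
  (forall tau n, gauss_poly p (tau * n%:R) = tau ^+ d * (X n * gauss tau n)) ->
  rapid_decay (fun tau => tau ^+ d.+1 * hsum (fun n => X n * gauss tau n) - C).
Proof.
move=> cH dH limH XK hX pX.
pose phi tau := tau * hsum (fun n => gauss_poly p (tau * n%:R)).
have phiE tau : 0 < tau <= 1 -> phi tau = tau ^+ d.+1 * hsum (fun n => X n * gauss tau n).
  move=> t01; have sX := bounded_is_summable t01 XK (gauss_exp_bounded t01).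
  rewrite exprS -mulrA -(hsumZ _ sX).2 /phi; congr (_ * _).
  by apply: eq_hsum => n; rewrite pX.
have [C' h1] := riemann_limit cH dH limH.
have h2 : rapid_decay (fun tau => phi (tau * 2) - phi tau).
  move=> M; have [D hD] := alternate_decay XK hX M; exists D => tau t01; have [t0 t1] := andP t01.
  have e := hsum_double (poly_summable p t01).
  have -> : phi (tau * 2) - phi tau = tau * hsum (alternate (fun n => gauss_poly p (tau * n%:R))).
    have -> : phi (tau * 2) = tau * (2 * hsum (fun n => gauss_poly p (tau * n.*2%:R))).
      rewrite /phi mulrA; congr (_ * _); apply: eq_hsum => n.
      by rewrite -mul2n natrM; congr gauss_poly; ring.
    by rewrite -e /phi; ring.
  have -> : hsum (alternate (fun n => gauss_poly p (tau * n%:R))) =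
      tau ^+ d * hsum (fun n => alternate X n * gauss tau n).
    have XK' : quad_bounded K (alternate X).
      by move=> n; rewrite /alternate normrM normrX normrN1 expr1n mul1r.
    have sX := bounded_is_summable t01 XK' (gauss_exp_bounded t01).
    by rewrite -(hsumZ _ sX).2; apply: eq_hsum => n; rewrite /alternate pX; ring.
  rewrite mulrA -exprS normrM ger0_norm ?exprn_ge0 ?(ltW t0)//.
  apply: le_trans (hD tau t01); rewrite ler_piMl//.
  by rewrite exprn_ile1 ?(ltW t0).
move=> M; have [D hD] := asymptotics_of_doubling h1 h2 M; exists D => tau t01.
by rewrite -phiE//; exact: hD.
Qed.

Import gauss_integral_proof.

Lemma gauss_poly1 : gauss_poly (1 : {poly R}) = gauss_fun.
Proof. by apply/funext => y; rewrite /gauss_poly hornerC mul1r. Qed.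

Lemma continuous_integral0_gauss (x : R) : 0 <= x ->
  {within `[0, x], continuous (@integral0_gauss R)}.
Proof.
move=> x0; apply: parameterized_integral_continuous => //=.
apply: continuous_compact_integrable; first exact: segment_compact.
by apply: continuous_subspaceT; exact: continuous_gauss_fun.
Qed.

Lemma is_derive_integral0_gauss (y : R) : 0 < y ->
  is_derive y 1 (@integral0_gauss R) (gauss_poly 1 y).
Proof.
move=> y0; have yy : y < y + 1 by rewrite ltrDl.
have ig : (@lebesgue_measure R).-integrable `[0, (y + 1)] (EFin \o (@gauss_fun R)).
  apply: continuous_compact_integrable; first exact: segment_compact.
  by apply: continuous_subspaceT; exact: continuous_gauss_fun.
have [d e] := continuous_FTC1_closed yy ig y0 (@continuous_gauss_fun R y).
by split; [exact: d|rewrite -derive1E gauss_poly1; exact: e].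
Qed.

Lemma cvg_integral0_gauss tau : 0 < tau <= 1 ->
  (fun N : nat => @integral0_gauss R (tau * N%:R) - integral0_gauss 0) @ \oo --> (Num.sqrt pi / 2 : R).
Proof.
move=> /andP[t0 _].
have I0 : @integral0_gauss R 0 = 0.
  by rewrite /integral0_gauss set_itv1 Rintegral_set1.
have c1 : (fun x => Num.sqrt (@integral0_gauss R x ^+ 2)) @ +oo%R --> Num.sqrt (pi / 4 : R).
  by apply: continuous_cvg; [exact: sqrt_continuous|exact: cvg_integral0_gauss_sqr].
have E : (fun x => Num.sqrt (@integral0_gauss R x ^+ 2)) = @integral0_gauss R.
  by apply/funext => x; rewrite sqrtr_sqr ger0_norm// integral0_gauss_ge0.
have E2 : Num.sqrt (pi / 4 : R) = Num.sqrt pi / 2.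
  rewrite sqrtrM ?pi_ge0//; congr (_ * _); rewrite sqrtrV//; congr (_^-1).
  by rewrite (_ : 4 = 2 ^+ 2) ?sqrtr_sqr ?ger0_norm//; ring.
rewrite E E2 in c1.
have c2 : (fun N : nat => tau * N%:R) @ \oo --> +oo%R.
  apply/cvgryPge => A; exists (Num.truncn (A / tau)).+1 => // n /= An.
  rewrite -ler_pdivrMl// mulrC; apply: ltW; apply: lt_le_trans (truncnS_gt _) _.
  by rewrite ler_nat.
have -> : (fun N : nat => @integral0_gauss R (tau * N%:R) - integral0_gauss 0) =
   @integral0_gauss R \o (fun N : nat => tau * N%:R).
  by apply/funext => N; rewrite /= I0 subr0.
exact: cvg_comp c2 c1.
Qed.

Lemma theta0_asymptotics : exists C : R, rapid_decay (fun tau => tau * hsum (gauss tau) - C).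
Proof.
exists (Num.sqrt pi / 2) => M.
have [||D hD] := @gauss_poly_asymptotics (@integral0_gauss R) 1 (Num.sqrt pi / 2) 1 (fun=> 1) 0
  continuous_integral0_gauss is_derive_integral0_gauss cvg_integral0_gauss (@quad_bounded1 R) _ _ M.
- by move=> [|[|n]]; rewrite /dd /alternate /= !exprS ?expr0; ring.
- by move=> tau n; rewrite /gauss_poly /gauss hornerC expr0 !mul1r.
exists D => tau t01; have := hD tau t01; rewrite expr1.
by rewrite (@eq_hsum _ (fun n => 1 * gauss tau n) (gauss tau))// => n; rewrite mul1r.
Qed.

Lemma theta2_asymptotics : exists C : R,
  rapid_decay (fun tau => tau ^+ 3 * hsum (fun n => n%:R ^+ 2 * gauss tau n) - C).
Proof.
(* A primitive of y^2 exp(-y^2), obtained by integrating by parts. *)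
pose H y : R := 2^-1 * integral0_gauss y - 2^-1 * gauss_poly 'X y.
have cH (x : R) : 0 <= x -> {within `[0, x], continuous H}.
  move=> x0 y; apply: cvgB; apply: cvgMr; first exact: continuous_integral0_gauss.
  exact: (is_derive_continuous (is_derive_gauss_poly 'X)).
have dH (y : R) : 0 < y -> is_derive y 1 H (gauss_poly 'X^2 y).
  move=> y0; have d1 := is_derive_integral0_gauss y0; have d2 := is_derive_gauss_poly ('X : {poly R}) y.
  have := is_deriveB (is_deriveZ 2^-1 d1) (is_deriveZ 2^-1 d2).
  move=> /is_derive_eq; apply; rewrite /gauss_poly /gauss_deriv derivX !hornerE /=.
  have sE (a b : R) : a *: b = a * b by [].
  by rewrite !sE; field.
have lH tau : 0 < tau <= 1 -> (fun N : nat => H (tau * N%:R) - H 0) @ \oo --> (2^-1 * (Num.sqrt pi / 2) : R).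
  move=> t.
  have c2 : (fun N : nat => gauss_poly 'X (tau * N%:R)) @ \oo --> (0 : R).
    by have [B hB] := poly_summable 'X t; exact: cvg_series_cvg_0 (series_inv_sq hB).1.
  have c3 : (fun N : nat => 2^-1 * (integral0_gauss (tau * N%:R) - integral0_gauss 0)) @ \oo -->
      (2^-1 * (Num.sqrt pi / 2) : R).
    by apply: cvgMr; exact: cvg_integral0_gauss.
  have c4 : (fun N : nat => 2^-1 * gauss_poly 'X (tau * N%:R)) @ \oo --> (2^-1 * 0 : R).
    by apply: cvgMr.
  have -> : (2^-1 * (Num.sqrt pi / 2) : R) = 2^-1 * (Num.sqrt pi / 2) - 2^-1 * 0 by rewrite mulr0 subr0.
  have -> : (fun N : nat => H (tau * N%:R) - H 0) = (fun N : nat =>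
      2^-1 * (integral0_gauss (tau * N%:R) - integral0_gauss 0) - 2^-1 * gauss_poly 'X (tau * N%:R)).
    by apply/funext => N; rewrite /H /gauss_poly !hornerX mul0r; ring.
  exact: (cvgB c3 c4).
exists (2^-1 * (Num.sqrt pi / 2)) => M.
have X2 : quad_bounded 1 (fun n => n%:R ^+ 2 : R).
  by move=> n; rewrite mul1r ger0_norm ?exprn_ge0// lerXn2r ?nnegrE// ler_nat.
have [||D hD] := @gauss_poly_asymptotics H 'X^2 _ 1 (fun n => n%:R ^+ 2) 2 cH dH lH X2 _ _ M.
- by move=> [|[|n]]; rewrite /dd /alternate /= !exprS ?expr0 -?natr1; ring.
- by move=> tau n; rewrite /gauss_poly /gauss hornerXn exprMn; ring.
by exists D => tau t01; have := hD tau t01.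
Qed.

End ThetaAsymptotics.

(** * Sums over roots of unity in terms of cosines and sines *)

Section RootsOfUnity.
Context {R : realType}.
Implicit Types (q m z : int) (x t : R).

Lemma cos_int_period t z : cos (t + z%:~R * (2 * pi)) = cos t.
Proof.
have h (n : nat) (u : R) : cos (u + n%:R * (2 * pi)) = cos u.
  elim: n u => [|n IH] u; first by rewrite mul0r addr0.
  have -> : u + n.+1%:R * (2 * pi) = (u + n%:R * (2 * pi)) + pi *+ 2.
    by rewrite -[n.+1%:R]natr1 -mulr_natr; ring.
  by rewrite cosD2pi IH.
case: z => n; first exact: h.
by rewrite NegzE mulrNz mulNr -[in RHS](subrK (n.+1%:R * (2 * pi)) t) h.
Qed.

Lemma sin_int_period t z : sin (t + z%:~R * (2 * pi)) = sin t.
Proof.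
have := cos_int_period (t - pi / 2) z.
have -> : t - pi / 2 + z%:~R * (2 * pi) = (t + z%:~R * (2 * pi)) - pi / 2 by ring.
by rewrite !cosB cos_pihalf sin_pihalf !mulr0 !add0r !mulr1.
Qed.

Definition angle q m : R := 2 * pi * (m%:~R / q%:~R).

Lemma angle_period q m z : 0 < q -> angle q (m + z * q) = angle q m + z%:~R * (2 * pi).
Proof.
by move=> q0; rewrite /angle intrD intrM; field; rewrite intr_eq0 gt_eqF.
Qed.

Lemma angleD q m z : angle q (m + z) = angle q m + angle q z.
Proof. by rewrite /angle intrD; ring. Qed.

Lemma angleMl (r : nat) q m : r%:R * angle q m = angle q (r%:Z * m).
Proof. by rewrite /angle intrM; ring. Qed.

Lemma cos_angle_dvd q m : 0 < q -> (q %| m)%Z -> cos (angle q m) = 1 /\ sin (angle q m) = 0.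
Proof.
move=> q0 /dvdzP[z ->]; rewrite -[z * q]add0r angle_period//.
by rewrite cos_int_period sin_int_period /angle mul0r mulr0 cos0 sin0.
Qed.

(** After reduction modulo [q], half the angle lies strictly between 0 and pi, where the sine is
    positive; the double angle formula concludes. *)
Lemma cos_angle_lt1 q m : 0 < q -> ~~ (q %| m)%Z -> cos (angle q m) < 1.
Proof.
move=> q0 qm; rewrite (divz_eq m q) addrC angle_period// cos_int_period.
set r := (m %% q)%Z.
have r0 : 0 < r.
  rewrite lt_def; apply/andP; split; last by rewrite modz_ge0// gt_eqF.
  by apply: contra qm => /eqP e; apply/dvdz_mod0P.
have rq : r < q by rewrite ltz_pmod.
have qR : 0 < (q%:~R : R) by rewrite ltr0z.
have -> : angle q r = (pi * (r%:~R / q%:~R)) *+ 2 by rewrite /angle -mulr_natr; ring.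
rewrite cos_mulr2n cos2sin2.
have : 0 < sin (pi * (r%:~R / q%:~R) : R).
  apply: sin_gt0_pi; rewrite mulr_gt0 ?pi_gt0 ?divr_gt0 ?ltr0z//=.
  by rewrite gtr_pMr ?pi_gt0// ltr_pdivrMr// mul1r ltr_int.
move=> s0; have : 0 < sin (pi * (r%:~R / q%:~R) : R) ^+ 2 by rewrite exprn_gt0.
by rewrite -mulr_natr; lra.
Qed.

(** Shifting the summation index rotates the vector [(C, S)] by [angle N m] and, by periodicity,
    leaves it unchanged; a nontrivial rotation fixes only 0. *)
Lemma sum_angle (N : nat) m : (0 < N)%N ->
  \sum_(0 <= k < N) cos (k%:R * angle N m) = (if (N %| m)%Z then N%:R else 0) /\
  \sum_(0 <= k < N) sin (k%:R * angle N m) = 0.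
Proof.
move=> N0; have q0 : (0 : int) < N by []; case: ifP => [d|/negbT qm].
  have h (k : nat) : cos (k%:R * angle N m) = 1 /\ sin (k%:R * angle N m) = 0.
    by rewrite angleMl; apply: cos_angle_dvd => //; rewrite dvdz_mull.
  split; last by apply: big1 => k _; rewrite (h k).2.
  by under eq_bigr do rewrite (h _).1; rewrite sumr_const_nat subn0.
set C := \sum_(_ <= _ < _) _; set S := \sum_(_ <= _ < _) _.
have shift (F : nat -> R) : F N = F 0%N -> \sum_(0 <= k < N) F k.+1 = \sum_(0 <= k < N) F k.
  move=> e; have h1 : \sum_(0 <= k < N.+1) F k = F 0%N + \sum_(0 <= k < N) F k.+1 by rewrite big_nat_recl.
  have h2 : \sum_(0 <= k < N.+1) F k = \sum_(0 <= k < N) F k + F N by rewrite big_nat_recr.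
  by apply: (addrI (F 0%N)); rewrite -h1 h2 e addrC.
have e : angle N m *+ N = m%:~R * (2 * pi) :> R.
  have Nn : N%:R != 0 :> R by rewrite pnatr_eq0 -lt0n.
  by rewrite -mulr_natl /angle -[(N : int)%:~R]/(N%:R : R); field.
have eN : N%:R * angle N m = 0 + m%:~R * (2 * pi) :> R by rewrite mulr_natl e add0r.
have sC : \sum_(0 <= k < N) cos (k.+1%:R * angle N m) = C.
  by apply: (shift (fun k => cos (k%:R * angle N m))); rewrite eN cos_int_period mul0r.
have sS : \sum_(0 <= k < N) sin (k.+1%:R * angle N m) = S.
  by apply: (shift (fun k => sin (k%:R * angle N m))); rewrite eN sin_int_period mul0r.
have eC : C = cos (angle N m) * C - sin (angle N m) * S.
  rewrite -[LHS]sC !big_distrr/= -sumrB; apply: eq_bigr => k _.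
  by rewrite -natr1 mulrDl mul1r cosD; ring.
have eS : S = sin (angle N m) * C + cos (angle N m) * S.
  rewrite -[LHS]sS !big_distrr/= -big_split/=; apply: eq_bigr => k _.
  by rewrite -natr1 mulrDl mul1r sinD; ring.
have c1 := cos_angle_lt1 q0 qm; have cs := cos2Dsin2 (angle N m).
move: (cos _) (sin _) c1 cs eC eS => c s c1 cs eC eS.
have hC : (1 - c) * C + s * S = 0 by lra.
have hS : - s * C + (1 - c) * S = 0 by lra.
(* The determinant of the identity minus the rotation; the two computations below are Cramer's
   formulas. *)
have n0 : 2 - 2 * c != 0 by rewrite gt_eqF//; lra.
split; apply: (mulfI n0); rewrite mulr0.
  transitivity ((1 - c) * ((1 - c) * C + s * S) - s * (- s * C + (1 - c) * S)
    + C * (1 - (c ^+ 2 + s ^+ 2))); first by ring.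
  by rewrite hC hS cs; ring.
transitivity ((1 - c) * (- s * C + (1 - c) * S) + s * ((1 - c) * C + s * S)
  + S * (1 - (c ^+ 2 + s ^+ 2))); first by ring.
by rewrite hC hS cs; ring.
Qed.

Definition torus_cos N m z : R :=
  \sum_(0 <= k < N) \sum_(0 <= l < N) cos (k%:R * angle N m + l%:R * angle N z).
Definition torus_sin N m z : R :=
  \sum_(0 <= k < N) \sum_(0 <= l < N) sin (k%:R * angle N m + l%:R * angle N z).

Lemma torus_cos_sin (N : nat) m z : (0 < N)%N ->
  torus_cos N m z = (if (N %| m)%Z && (N %| z)%Z then N%:R ^+ 2 else 0) /\
  torus_sin N m z = 0.
Proof.
move=> N0; have [c1 s1] := sum_angle m N0; have [c2 s2] := sum_angle z N0.
split; rewrite /torus_cos /torus_sin.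
  transitivity ((\sum_(0 <= k < N) cos (k%:R * angle N m)) * (\sum_(0 <= k < N) cos (k%:R * angle N z))
     - (\sum_(0 <= k < N) sin (k%:R * angle N m)) * (\sum_(0 <= k < N) sin (k%:R * angle N z)) : R).
    rewrite !big_distrl/= -sumrB; apply: eq_bigr => k _.
    by rewrite !big_distrr/= -sumrB; apply: eq_bigr => l _; rewrite cosD.
  rewrite c1 s1 c2 s2 mulr0 subr0.
  by case: ((N %| m)%Z); case: ((N %| z)%Z); rewrite ?mul0r ?mulr0.
transitivity ((\sum_(0 <= k < N) sin (k%:R * angle N m)) * (\sum_(0 <= k < N) cos (k%:R * angle N z))
     + (\sum_(0 <= k < N) cos (k%:R * angle N m)) * (\sum_(0 <= k < N) sin (k%:R * angle N z)) : R).
  rewrite !big_distrl/= -big_split/=; apply: eq_bigr => k _.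
  by rewrite !big_distrr/= -big_split/=; apply: eq_bigr => l _; rewrite sinD.
by rewrite s1 s2 mul0r mulr0 addr0.
Qed.

End RootsOfUnity.

(** * Averages over a grid in Hopf coordinates *)

Section SphereAverage.
Context {R : realType}.
Local Notation E4 := 'cV[R]_4.
Implicit Types (f g : E4 -> R) (m n : int) (p : {poly R}) (s a b : R) (N : nat).

(* |z|^2 = s, and the arguments of z and w are 2 pi a and 2 pi b. *)
Definition hopf s a b : E4 := \col_i
  if i == i0 then Num.sqrt s * cos (2 * pi * a)
  else if i == i1 then Num.sqrt s * sin (2 * pi * a)
  else if i == i2 then Num.sqrt (1 - s) * cos (2 * pi * b)
  else Num.sqrt (1 - s) * sin (2 * pi * b).

Lemma hopfE s a b : [/\ hopf s a b i0 ord0 = Num.sqrt s * cos (2 * pi * a),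
  hopf s a b i1 ord0 = Num.sqrt s * sin (2 * pi * a),
  hopf s a b i2 ord0 = Num.sqrt (1 - s) * cos (2 * pi * b) &
  hopf s a b i3 ord0 = Num.sqrt (1 - s) * sin (2 * pi * b)].
Proof. by split; rewrite mxE !ord4_eq. Qed.

Lemma hopf_S3 s a b : 0 <= s <= 1 -> S3 (hopf s a b).
Proof.
move=> /andP[s0 s1]; rewrite /S3 /= /euclid_norm big_ord4.
have [-> -> -> ->] := hopfE s a b; rewrite !exprMn !sqr_sqrtr ?subr_ge0//.
rewrite -mulrDr -addrA -mulrDr !cos2Dsin2 !mulr1 addrC subrK sqrtr1 //.
Qed.

Lemma eigf_hopf m n p s a b : 0 <= s <= 1 -> eigf m n p (hopf s a b) =
  Num.sqrt s ^+ `|m| * Num.sqrt (1 - s) ^+ `|n| * p.[s] *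
  cas (m%:~R * (2 * pi * a) + n%:~R * (2 * pi * b)).
Proof.
move=> s01; have Sh := hopf_S3 a b s01; have [h0 h1 h2 h3] := hopfE s a b.
have /andP[s0 s1] := s01.
rewrite (eigfE _ _ _ Sh) (torus_harm_polar m n h0 h1 h2 h3) h0 h1 !exprMn sqr_sqrtr//.
rewrite -mulrDr cos2Dsin2 mulr1; ring.
Qed.

Definition grid N (i k l : nat) : E4 := hopf (i%:R / N%:R) (k%:R / N%:R) (l%:R / N%:R).

(* Riemann sum, in Hopf coordinates, of the normalized volume of the sphere, for
   which s is uniform on [0, 1] and both angles are uniform. *)
Definition avg N f : R := (N%:R ^+ 3)^-1 *
  \sum_(0 <= i < N) \sum_(0 <= k < N) \sum_(0 <= l < N) f (grid N i k l).

Lemma grid01 N i : (i < N)%N -> 0 <= (i%:R / N%:R : R) <= 1.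
Proof.
move=> iN; rewrite divr_ge0//= ler_pdivrMr ?ltr0n ?(leq_ltn_trans _ iN)//.
by rewrite mul1r ler_nat ltnW.
Qed.

Lemma grid_S3 N i k l : (i < N)%N -> S3 (grid N i k l).
Proof. by move=> iN; exact/hopf_S3/grid01. Qed.

Lemma eq_avg N f g : (forall x, S3 x -> f x = g x) -> avg N f = avg N g.
Proof.
move=> fg; rewrite /avg; congr (_ * _); apply: eq_big_nat => i iN.
by apply: eq_bigr => k _; apply: eq_bigr => l _; rewrite fg//; exact: grid_S3.
Qed.

Lemma avg_lin N (c d : R) f g : avg N (fun x => c * f x + d * g x) = c * avg N f + d * avg N g.
Proof.
rewrite /avg mulrCA [d * _]mulrCA -mulrDr; congr (_ * _).
rewrite !big_distrr -big_split; apply: eq_bigr => i _ /=.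
rewrite !big_distrr -big_split; apply: eq_bigr => k _ /=.
by rewrite !big_distrr -big_split.
Qed.

Lemma avg_le N f (e : R) : 0 <= e -> (forall x, S3 x -> `|f x| <= e) -> `|avg N f| <= e.
Proof.
move=> e0 fe; rewrite /avg; case: N => [|N]; first by rewrite big_geq// mulr0 normr0.
rewrite normrM normfV (ger0_norm (exprn_ge0 _ (ler0n R N.+1))) ler_pdivrMl ?exprn_gt0//.
have -> : N.+1%:R ^+ 3 * e = \sum_(0 <= i < N.+1) \sum_(0 <= k < N.+1) \sum_(0 <= l < N.+1) e.
  by rewrite !sumr_const_nat !subn0; ring.
rewrite (le_trans (ler_norm_sum _ _ _))//; apply: ler_sum_nat => i iN.
rewrite (le_trans (ler_norm_sum _ _ _))//; apply: ler_sum => k _.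
rewrite (le_trans (ler_norm_sum _ _ _))//; apply: ler_sum => l _.
by apply: fe; exact: grid_S3.
Qed.

Lemma sqrt_expr_sq s (k : nat) : 0 <= s -> Num.sqrt s ^+ k * Num.sqrt s ^+ k = s ^+ k.
Proof. by move=> s0; rewrite -exprMn -expr2 sqr_sqrtr. Qed.

(** From [cas u * cas v = cos (u - v) + sin (u + v)]: the sums over the two angles are exact, the
    sine sums vanish, and the cosine sums survive only when the weights agree modulo [N]. Only the
    sum over [i] remains a genuine Riemann sum. *)
Lemma avg_eigfM N m n m' n' p p' : (0 < N)%N ->
  avg N (fun x => eigf m n p x * eigf m' n' p' x) =
  (if (N %| m - m')%Z && (N %| n - n')%Z then
    N%:R^-1 * \sum_(0 <= i < N) (Num.sqrt (i%:R / N%:R) ^+ (`|m| + `|m'|) *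
      Num.sqrt (1 - i%:R / N%:R) ^+ (`|n| + `|n'|) * (p * p').[i%:R / N%:R]) else 0).
Proof.
move=> N0; have NR : N%:R != 0 :> R by rewrite pnatr_eq0 -lt0n.
rewrite /avg.
pose W i : R := Num.sqrt (i%:R / N%:R) ^+ (`|m| + `|m'|) *
  Num.sqrt (1 - i%:R / N%:R) ^+ (`|n| + `|n'|) * (p * p').[i%:R / N%:R].
have E i : (0 <= i < N)%N -> \sum_(0 <= k < N) \sum_(0 <= l < N)
      (eigf m n p (grid N i k l) * eigf m' n' p' (grid N i k l)) =
      W i * (torus_cos N (m - m') (n - n') + torus_sin N (m + m') (n + n')).
  move=> iN; rewrite /torus_cos /torus_sin -big_split big_distrr/=; apply: eq_bigr => k _.
  rewrite -big_split big_distrr/=; apply: eq_bigr => l _.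
  rewrite /grid !eigf_hopf ?grid01// /W hornerM !exprD.
  set u := m%:~R * _ + _; set v := m'%:~R * _ + _.
  have -> : k%:R * angle N (m - m') + l%:R * angle N (n - n') = u - v.
    by rewrite /angle /u /v !intrD !intrN /=; ring.
  have -> : k%:R * angle N (m + m') + l%:R * angle N (n + n') = u + v.
    by rewrite /angle /u /v !intrD /=; ring.
  clearbody u v; rewrite cosB sinD /cas.
  move: (_ ^+ `|m|%N) (_ ^+ `|m'|%N) (_ ^+ `|n|%N) (_ ^+ `|n'|%N) (p.[_]) (p'.[_]) (cos u) (sin u) (cos v) (sin v).
  by move=> x1 x2 x3 x4 x5 x6 x7 x8 x9 x10; ring.
rewrite (eq_big_nat _ _ E).
have [E1 _] := @torus_cos_sin R N (m - m') (n - n') N0.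
have [_ E2] := @torus_cos_sin R N (m + m') (n + n') N0.
rewrite -big_distrl/= E1 E2 addr0 /W; case: ifP => _; last by rewrite !mulr0.
by field.
Qed.

End SphereAverage.

(** * The normalized integral over the sphere and its strict positivity *)

Section SphereIntegral.
Context {R : realType}.
Local Notation E4 := 'cV[R]_4.
Implicit Types (f g : E4 -> R) (m n : int) (p q : {poly R}) (s a b : R) (N : nat).

Lemma poly_primitive q : exists P : {poly R}, P^`() = q.
Proof.
exists (\poly_(i < (size q).+1) (q`_i.-1 / i%:R)); apply/polyP => i.
rewrite coef_deriv coef_poly ltnS /= -[LHS]mulr_natr.
case: ltnP => h; last by rewrite mul0r nth_default.
by rewrite mulfVK// pnatr_eq0.
Qed.

Lemma poly_bounded q : exists B : R, forall x, 0 <= x <= 1 -> `|q.[x]| <= B.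
Proof.
exists (\sum_(i < size q) `|q`_i|) => x /andP[x0 x1].
rewrite horner_coef (le_trans (ler_norm_sum _ _ _))//; apply: ler_sum => i _.
by rewrite normrM ler_piMr// normrX ger0_norm// exprn_ile1.
Qed.

Lemma cvg_inv_bound (u : nat -> R) (l B : R) :
  (forall N, `|u N - l| <= B / N.+1%:R) -> u @ \oo --> l.
Proof.
move=> uB; apply/cvgrPdist_le => e e0; exists (Num.truncn (B / e)).+1 => // N /= BN.
rewrite distrC (le_trans (uB N))// ler_pdivrMr// -ler_pdivrMl// mulrC.
apply: ltW; apply: lt_trans (truncnS_gt _) _.
by rewrite ltr_nat ltnS.
Qed.

(** Through a primitive [P] the integral becomes a telescoping sum over the cells, and two mean
    values bound the error on each cell by [B / n%:R ^+ 2]. *)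
Lemma riemann_sum_poly q :
  (fun N => N.+1%:R^-1 * \sum_(0 <= i < N.+1) q.[i%:R / N.+1%:R]) @ \oo --> int01 q.
Proof.
have [P <-] := poly_primitive q; rewrite int01_deriv.
have [B hB] := poly_bounded P^`()^`(); apply: (@cvg_inv_bound _ _ B) => N.
set n := N.+1; have n0 : 0 < n%:R :> R by rewrite ltr0n.
have nn : n%:R != 0 :> R by rewrite gt_eqF.
have B0 : 0 <= B by apply: le_trans (hB 0 _); rewrite ?normr_ge0// lexx ler01.
have -> : P.[1] - P.[0] = \sum_(0 <= i < n) (P.[i.+1%:R / n%:R] - P.[i%:R / n%:R]).
  by rewrite telescope_sumr// divff// mul0r.
rewrite big_distrr/= -sumrB.
have -> : B / n%:R = \sum_(0 <= i < n) B / n%:R ^+ 2.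
  by rewrite sumr_const_nat subn0 -mulr_natr; field.
rewrite (le_trans (ler_norm_sum _ _ _))//; apply: ler_sum_nat => i /andP[_ iN].
have ii : i%:R / n%:R <= i.+1%:R / n%:R :> R by rewrite ler_pM2r ?invr_gt0// ler_nat.
have [c /andP[c1 c2] E] := mean_value ii (is_derive_poly P).
have [d /andP[d1 d2] E'] := mean_value c1 (is_derive_poly P^`()).
have dn : i.+1%:R / n%:R - i%:R / n%:R = n%:R^-1 :> R by rewrite -[i.+1%:R]natr1; field.
have -> : n%:R^-1 * P^`().[i%:R / n%:R] - (P.[i.+1%:R / n%:R] - P.[i%:R / n%:R]) =
   - (n%:R^-1 * (P^`().[c] - P^`().[i%:R / n%:R])).
  by rewrite E dn; ring.
rewrite E' normrN !normrM.
have h1 : `|P^`()^`().[d]| <= B.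
  apply: hB; apply/andP; split; first by rewrite (le_trans _ d1)// divr_ge0.
  by rewrite (le_trans d2)// (le_trans c2)// ler_pdivrMr// mul1r ler_nat.
have h2 : `|c - i%:R / n%:R| <= n%:R^-1.
  by rewrite ger0_norm ?subr_ge0//; lra.
have -> : B / n%:R ^+ 2 = n%:R^-1 * (B * n%:R^-1) by field.
have i0' : 0 <= n%:R^-1 :> R by rewrite invr_ge0.
by rewrite (ger0_norm i0') ler_wpM2l//; exact: ler_pM.
Qed.

(** As soon as [N] exceeds [|m - m'| + |n - n'|], congruence is equality, so distinct weights have
    average exactly 0. For equal weights the square roots pair up into the polynomial
    [jacobi_weight]. *)
Lemma avg_eigfM_cvg m n m' n' p p' :
  (fun N => avg N.+1 (fun x => eigf m n p x * eigf m' n' p' x)) @ \oo -->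
  if (m == m') && (n == n') then int01 (jacobi_weight `|m| `|n| * (p * p')) else 0.
Proof.
case: ifP => [/andP[/eqP <- /eqP <-]|ne].
  pose q := jacobi_weight `|m| `|n| * (p * p'); rewrite -/q.
  suff -> : (fun N => avg N.+1 (fun x => eigf m n p x * eigf m n p' x)) =
    (fun N => N.+1%:R^-1 * \sum_(0 <= i < N.+1) q.[i%:R / N.+1%:R]) by exact: riemann_sum_poly.
  apply/funext => N; rewrite avg_eigfM// !subrr !dvdz0 /=; congr (_ * _).
  apply: eq_big_nat => i /andP[_ iN].
  have /andP[s0] := @grid01 R _ _ iN; rewrite -subr_ge0 => s1.
  rewrite /q /jacobi_weight !hornerM hornerXn horner_exp !hornerE /=.
  by rewrite !exprD !sqrt_expr_sq// mulrA.
suff H : \forall N \near \oo, avg N.+1 (fun x => eigf m n p x * eigf m' n' p' x) = 0.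
  exact: cvg_near_cst H.
exists (`|m - m'|%N + `|n - n'|%N)%N => // N /= hN.
rewrite avg_eigfM//; case: ifP => // /andP[/dvdzP[c e] /dvdzP[c' e']].
case/negP: (negbT ne); apply/andP; split.
- rewrite -subr_eq0 e; apply/eqP; have := congr1 absz e; rewrite abszM absz_nat => e2.
  have : (`|c| = 0)%N by nia.
  by move/eqP; rewrite absz_eq0 => /eqP ->; rewrite mul0r.
- rewrite -subr_eq0 e'; apply/eqP; have := congr1 absz e'; rewrite abszM absz_nat => e2.
  have : (`|c'| = 0)%N by nia.
  by move/eqP; rewrite absz_eq0 => /eqP ->; rewrite mul0r.
Qed.

(** [limn] has a meaning only together with [integrable_S3], which uniform approximation will give
    for all continuous functions. *)
Definition sint f : R := limn (fun N => avg N.+1 f).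
Definition integrable_S3 f := cvgn (fun N => avg N.+1 f).

Lemma sint_lin (c d : R) f g : integrable_S3 f -> integrable_S3 g ->
  integrable_S3 (fun x => c * f x + d * g x) /\
  sint (fun x => c * f x + d * g x) = c * sint f + d * sint g.
Proof.
move=> cf cg.
have h : (fun N => avg N.+1 (fun x => c * f x + d * g x)) @ \oo --> c * sint f + d * sint g.
  have -> : (fun N => avg N.+1 (fun x => c * f x + d * g x)) =
     (fun N => c * avg N.+1 f + d * avg N.+1 g) by apply/funext => N; exact: avg_lin.
  by apply: cvgD; apply: cvgMr.
split; first by apply/cvg_ex; exists (c * sint f + d * sint g).
exact: (cvg_lim (@Rhausdorff R) h).
Qed.

Lemma eq_sint f g : (forall x, S3 x -> f x = g x) -> sint f = sint g.
Proof. by move=> fg; rewrite /sint; congr (limn _); apply/funext => N; exact: eq_avg. Qed.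

Lemma eq_integrable f g : (forall x, S3 x -> f x = g x) -> integrable_S3 f -> integrable_S3 g.
Proof.
move=> fg; rewrite /integrable_S3.
by have -> : (fun N => avg N.+1 f) = (fun N => avg N.+1 g) by apply/funext => N; exact: eq_avg.
Qed.

Lemma sint_le f (e : R) : 0 <= e -> integrable_S3 f -> (forall x, S3 x -> `|f x| <= e) ->
  `|sint f| <= e.
Proof. by move=> e0 cf fe; apply: (limit_norm_le cf) => N; exact: avg_le. Qed.

Lemma integrable_uniform_limit f :
  (forall e : R, 0 < e -> exists g, integrable_S3 g /\ forall x, S3 x -> `|f x - g x| <= e) ->
  integrable_S3 f.
Proof.
move=> h; apply/cauchy_cvgP/cauchy_exP => e e0.
have e4 : 0 < e / 4 by rewrite divr_gt0.
have [g [cg fg]] := h _ e4; exists (sint g); rewrite /ball_ /=.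
have : \forall N \near \oo, `|sint g - avg N.+1 g| <= e / 4.
  by move/cvgrPdist_le : cg; apply.
apply: filterS => N hN.
have := @avg_lin _ N.+1 1 (-1) f g; rewrite mul1r mulN1r => E.
have h1 : `|avg N.+1 f - avg N.+1 g| <= e / 4.
  rewrite -E; apply: avg_le => [|x Sx]; first exact: ltW.
  by have := fg x Sx; rewrite mul1r mulN1r.
rewrite /ball /=.
have -> : sint g - avg N.+1 f = (sint g - avg N.+1 g) - (avg N.+1 f - avg N.+1 g) by ring.
by rewrite (le_lt_trans (ler_normB _ _))//; lra.
Qed.

Lemma polar_coordinates (x y r : R) : 0 <= r -> x ^+ 2 + y ^+ 2 = r ^+ 2 ->
  exists2 a, 0 <= a <= 1 & x = r * cos (2 * pi * a) /\ y = r * sin (2 * pi * a).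
Proof.
rewrite le_eqVlt => /predU1P[<-|r0] e.
  exists 0; first by rewrite lexx ler01.
  move/eqP: e; rewrite expr0n paddr_eq0 ?sqr_ge0// !sqrf_eq0 => /andP[/eqP -> /eqP ->].
  by rewrite !mul0r.
pose c := x / r; pose t := acos c.
have rn : r != 0 by rewrite gt_eqF.
have c2 : c ^+ 2 + (y / r) ^+ 2 = 1 by rewrite /c !exprMn -mulrDl e -exprMn divff// expr1n.
have c1 : -1 <= c <= 1.
  by rewrite -ler_norml -(@ler_pXn2r _ 2) ?nnegrE// expr1n real_normK ?num_real// -c2 lerDl sqr_ge0.
have ct : cos t = c by rewrite /t acosK// in_itv.
have st : sin t = `|y / r|.
  by rewrite /t sin_acos// -c2 addrAC subrr add0r sqrtr_sqr.
have pi0 := pi_gt0 R.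
have t0 := acos_ge0 c1; have tp := acos_lepi c1; rewrite -/t in t0 tp.
have pp : 0 < 2 * pi :> R by rewrite mulr_gt0.
have p2 : 2 * pi != 0 :> R by rewrite mulf_neq0 // gt_eqF.
have [y0|y0] := leP 0 y.
  exists (t / (2 * pi)).
    by rewrite divr_ge0 ?(ltW pp)//= ler_pdivrMr//; lra.
  have -> : 2 * pi * (t / (2 * pi)) = t by rewrite mulrC divfK.
  rewrite ct st /c ger0_norm ?divr_ge0 ?(ltW r0)//.
  by split; field.
exists (1 - t / (2 * pi)).
  apply/andP; split; last by rewrite gerBl divr_ge0 ?(ltW pp).
  by rewrite subr_ge0 ler_pdivrMr ?mulr_gt0//; lra.
have -> : 2 * pi * (1 - t / (2 * pi)) = - t + 1%:~R * (2 * pi).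
  have -> : 2 * pi * (1 - t / (2 * pi)) = 2 * pi - t / (2 * pi) * (2 * pi) by ring.
  by rewrite divfK// mulr1z mul1r addrC.
rewrite cos_int_period sin_int_period cosN sinN ct st /c ltr0_norm; last by rewrite pmulr_llt0 ?invr_gt0.
by split; field.
Qed.

Lemma hopf_surj (x : E4) : S3 x -> exists s a b, [/\ 0 <= s <= 1, 0 <= a <= 1, 0 <= b <= 1 &
  x = hopf s a b].
Proof.
move=> Sx; pose s := x i0 ord0 ^+ 2 + x i1 ord0 ^+ 2.
have e : x i2 ord0 ^+ 2 + x i3 ord0 ^+ 2 = 1 - s.
  have := euclid_normsq x; rewrite (Sx : euclid_norm x = 1) expr1n big_ord4 /s; lra.
have s0 : 0 <= s by rewrite addr_ge0 ?sqr_ge0.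
have s1 : 0 <= 1 - s by rewrite -e addr_ge0 ?sqr_ge0.
have [a ha [xa ya]] := @polar_coordinates (x i0 ord0) (x i1 ord0) (Num.sqrt s) (sqrtr_ge0 _)
  (esym (sqr_sqrtr s0)).
have [|b hb [xb yb]] := @polar_coordinates (x i2 ord0) (x i3 ord0) (Num.sqrt (1 - s)) (sqrtr_ge0 _).
  by rewrite e sqr_sqrtr.
exists s, a, b; split => //; first by rewrite s0 -subr_ge0 s1.
have [h0 h1 h2 h3] := hopfE s a b.
by apply/matrixP => i j; rewrite ord1; have [->|->|->|->] := ord4P i; rewrite ?h0 ?h1 ?h2 ?h3.
Qed.

Lemma sum_subinterval (g : nat -> R) (K j M : nat) (c : R) : (j < K)%N ->
  (forall i, (i < K * M)%N -> 0 <= g i) ->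
  (forall i, (j * M <= i < j.+1 * M)%N -> c <= g i) ->
  M%:R * c <= \sum_(0 <= i < K * M) g i.
Proof.
move=> jK g0 gc.
have h1 : (j * M <= j.+1 * M)%N by rewrite leq_mul2r leqnSn orbT.
have h2 : (j.+1 * M <= K * M)%N by rewrite leq_mul2r jK orbT.
rewrite (@big_cat_nat _ _ _ (j * M) 0 (K * M)) ?(leq_trans h1)//= (@big_cat_nat _ _ _ (j.+1 * M) (j * M) (K * M))//=.
have -> : M%:R * c = \sum_(j * M <= i < j.+1 * M) c.
  by rewrite sumr_const_nat mulSn addnK mulr_natl.
rewrite -[leLHS]add0r -[leLHS]addr0 -addrA; apply: lerD; last apply: lerD.
- rewrite big_nat_cond; apply: sumr_ge0 => i /andP[/andP[_ ij] _]; apply: g0.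
  by rewrite (leq_trans ij)// (leq_trans h1).
- by apply: ler_sum_nat => i hi; exact: gc.
- by rewrite big_nat_cond; apply: sumr_ge0 => i /andP[/andP[_ ij] _]; exact: g0.
Qed.

(** [j] is the cell of length [1 / K < d] that contains [s]. Refining the grid by [M] leaves the
    proportion [1 / K] of its points in this cell, uniformly in [M]. *)
Lemma subinterval_index (s d : R) : 0 <= s <= 1 -> 0 < d -> exists2 K0 : nat, (0 < K0)%N &
  forall K : nat, (K0 <= K)%N -> exists2 j : nat, (j < K)%N &
    forall M i : nat, (0 < M)%N -> (j * M <= i < j.+1 * M)%N -> `|i%:R / (K * M)%:R - s| < d.
Proof.
move=> /andP[s0 s1] d0; exists (Num.truncn d^-1).+2 => // K hK.
have K0 : (0 < K)%N by rewrite (leq_trans _ hK).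
have KR : 0 < K%:R :> R by rewrite ltr0n.
have dK : K%:R^-1 < d.
  rewrite -[ltRHS]invrK ltf_pV2 ?posrE ?invr_gt0//.
  by apply: lt_le_trans (truncnS_gt _) _; rewrite ler_nat ltnW.
have [j [jK js sj]] : exists j : nat, [/\ (j < K)%N, j%:R <= s * K%:R & s * K%:R <= j.+1%:R].
  have sK0 : 0 <= s * K%:R by rewrite mulr_ge0// ltW.
  have tle : (Num.truncn (s * K%:R))%:R <= s * K%:R by rewrite truncn_le.
  have [lt|ge] := ltnP (Num.truncn (s * K%:R)) K.
    by exists (Num.truncn (s * K%:R)); split => //; exact/ltW/truncnS_gt.
  (* Only [s = 1] reaches this case; it is the right end of the last cell. *)
  exists K.-1; rewrite prednK//; split => //.
    by rewrite (le_trans _ tle)// ler_nat (leq_trans _ ge)// leq_pred.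
  by rewrite ler_piMl// ltW.
exists j => // M i M0 /andP[ij ji].
have MR : 0 < M%:R :> R by rewrite ltr0n.
have h1 : j%:R / K%:R <= i%:R / (K * M)%:R :> R.
  by rewrite natrM ler_pdivrMr// mulrAC ler_pdivlMr ?mulr_gt0// mulrCA mulrC ler_pM2r// -natrM ler_nat.
have h2 : i%:R / (K * M)%:R < j.+1%:R / K%:R :> R.
  by rewrite natrM ltr_pdivrMr ?mulr_gt0// mulrAC ltr_pdivlMr// mulrCA mulrC ltr_pM2l// -natrM ltr_nat.
have h3 : j%:R / K%:R <= s by rewrite ler_pdivrMr.
have h4 : s <= j.+1%:R / K%:R by rewrite ler_pdivlMr.
have h5 : j.+1%:R / K%:R = j%:R / K%:R + K%:R^-1 :> R by rewrite -natr1 mulrDl mul1r.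
by rewrite ltr_norml; apply/andP; split; lra.
Qed.

Lemma continuous_hopf : continuous (fun t : R * R * R => hopf t.1.1 t.1.2 t.2).
Proof.
have c1 (g : R -> R) (h : R * R * R -> R) : continuous g -> continuous h ->
    continuous (fun t => g (h t)).
  by move=> cg ch t; apply: continuous_comp; [exact: ch|exact: cg].
have cm (g h : R * R * R -> R) : continuous g -> continuous h -> continuous (fun t => g t * h t).
  by move=> cg ch t; apply: cvgM; [exact: cg|exact: ch].
have p1 : continuous (fun t : R * R * R => t.1.1).
  by move=> t; apply: continuous_comp; exact: cvg_fst.
have p2 : continuous (fun t : R * R * R => t.1.2).
  by move=> t; apply: continuous_comp; [exact: cvg_fst|exact: cvg_snd].
have p3 : continuous (fun t : R * R * R => t.2) by move=> t; exact: cvg_snd.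
have p1' : continuous (fun t : R * R * R => 1 - t.1.1).
  by move=> t; apply: cvgB; [exact: cvg_cst|exact: p1].
have ca (h : R * R * R -> R) : continuous h -> continuous (fun t => 2 * pi * h t).
  by move=> ch; apply: cm => // t; exact: cvg_cst.
have e i : continuous (fun t : R * R * R => hopf t.1.1 t.1.2 t.2 i ord0).
  have E : (fun t : R * R * R => hopf t.1.1 t.1.2 t.2 i ord0) = fun t =>
    if i == i0 then Num.sqrt t.1.1 * cos (2 * pi * t.1.2)
    else if i == i1 then Num.sqrt t.1.1 * sin (2 * pi * t.1.2)
    else if i == i2 then Num.sqrt (1 - t.1.1) * cos (2 * pi * t.2)
    else Num.sqrt (1 - t.1.1) * sin (2 * pi * t.2).
    by apply/funext => t; rewrite mxE.
  rewrite E; case: (i == i0); [|case: (i == i1); [|case: (i == i2)]]; apply: cm;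
    (apply: c1; [first [exact: sqrt_continuous|exact: continuous_cos|exact: continuous_sin]|
      first [exact: p1|exact: p1'|apply: ca; first [exact: p2|exact: p3]]]).
have near_entry (t : R * R * R) (r : R) : 0 < r -> \forall u \near t,
    forall i : 'I_4, ball (hopf t.1.1 t.1.2 t.2 i ord0) r (hopf u.1.1 u.1.2 u.2 i ord0).
  move=> r0.
  have h i : nbhs t (fun u : R * R * R =>
      ball (hopf t.1.1 t.1.2 t.2 i ord0) r (hopf u.1.1 u.1.2 u.2 i ord0)).
    by apply: (e i t); exact: nbhsx_ballx.
  have ft := nbhs_filter t.
  apply: (@filterS _ _ ft _ _ _ (@filterI _ _ ft _ _ (@filterI _ _ ft _ _ (h i0) (h i1)) (@filterI _ _ ft _ _ (h i2) (h i3)))).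
  by move=> u [[u0 u1] [u2 u3]] i; have [->|->|->|->] := ord4P i.
move=> t W /nbhs_ballP[r /= r0 H].
apply: filterS (near_entry t r r0) => u hu; apply: H; split => // i j; rewrite ord1; exact: hu.
Qed.

(** [f] stays above [c] on a box around the Hopf coordinates of [x0]. On grids of size [K * M] cells
    of proportion 1 / K^3 lie in the box, so these averages, and with them the limit, are at least
    [c / K%:R ^+ 3]. *)
Lemma avg_pos f (x0 : E4) : continuous_on_S3 f -> (forall x, S3 x -> 0 <= f x) ->
  S3 x0 -> 0 < f x0 -> integrable_S3 f -> 0 < sint f.
Proof.
move=> cf f0 Sx0 fx0 intf; have [s [a [b [hs ha hb E]]]] := hopf_surj Sx0.
pose c := f x0 / 2; have c0 : 0 < c by rewrite divr_gt0.
have : \forall t \near ((s, a), b), c < radial f (hopf t.1.1 t.1.2 t.2).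
  have nb : nbhs (hopf s a b) (fun y => c < radial f y).
    rewrite -E; have cx := cf x0 Sx0; rewrite /prop_for /continuous_at radialE// in cx.
    by apply: (cvgr_gt _ cx); rewrite /c ltr_pdivrMr// ltr_pMr// ltr1n.
  exact: (@continuous_hopf ((s, a), b) _ nb).
move=> /nbhs_ballP[d /= d0 Hd].
have box u v w : `|u - s| < d -> `|v - a| < d -> `|w - b| < d -> c < radial f (hopf u v w).
  move=> h1 h2 h3; apply: (Hd ((u, v), w)); split => /=; last by rewrite /ball /= distrC.
  by split; rewrite /= /ball /= distrC.
have [K1 _ H1] := subinterval_index hs d0; have [K2 _ H2] := subinterval_index ha d0.
have [K3 _ H3] := subinterval_index hb d0.
pose K := (K1 + K2 + K3).+1.
have [j1 jK1 P1] := H1 K ltac:(rewrite /K; lia).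
have [j2 jK2 P2] := H2 K ltac:(rewrite /K; lia).
have [j3 jK3 P3] := H3 K ltac:(rewrite /K; lia).
have low M : (0 < M)%N -> c / K%:R ^+ 3 <= avg (K * M) f.
  move=> M0; have MR : 0 < M%:R :> R by rewrite ltr0n.
  have KR : 0 < K%:R :> R by rewrite ltr0n.
  rewrite /avg ler_pdivlMl ?exprn_gt0 ?ltr0n ?muln_gt0//.
  have -> : (K * M)%:R ^+ 3 * (c / K%:R ^+ 3) = M%:R * (M%:R * (M%:R * c)).
    by rewrite natrM; field; rewrite gt_eqF.
  have pos i k l : (i < K * M)%N -> 0 <= f (grid (K * M) i k l).
    by move=> hi; apply/f0/grid_S3.
  apply: (sum_subinterval jK1) => [i hi|i hi].
    by apply: sumr_ge0 => k _; apply: sumr_ge0 => l _; exact: pos.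
  have hi' : (i < K * M)%N.
    by case/andP: hi => _ /leq_trans; apply; rewrite leq_mul2r jK1 orbT.
  apply: (sum_subinterval jK2) => [k hk|k hk].
    by apply: sumr_ge0 => l _; exact: pos.
  apply: (sum_subinterval jK3) => [l hl|l hl]; first exact: pos.
  rewrite -(radialE f (grid_S3 k l hi')); apply/ltW/box; [exact: P1|exact: P2|exact: P3].
have KR : 0 < c / K%:R ^+ 3 by rewrite divr_gt0// exprn_gt0.
apply: lt_le_trans KR _; rewrite leNgt; apply/negP => lt.
have [N0 _ /= HN] : \forall N \near \oo, avg N.+1 f < c / K%:R ^+ 3.
  by move/cvgr_lt : intf; apply.
have := HN (K * N0.+1).-1; rewrite prednK ?muln_gt0// => /(_ _).
rewrite ltNge low// => /(_ _)/notF; apply.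
by rewrite /=; nia.
Qed.

End SphereIntegral.

(** * Uniform density of the torus harmonics, by a Bernstein operator *)

Section SpanOfEigenfunctions.
Context {R : realType}.
Local Notation E4 := 'cV[R]_4.
Implicit Types (f g : E4 -> R) (m n : int) (p : {poly R}) (x : E4).

(** The polynomial factors are arbitrary, so the terms need not be eigenfunctions; in exchange the
    space is stable under multiplication by coordinates. *)
Definition eig_span f := exists s : seq (int * int * {poly R}),
  forall x, S3 x -> f x = \sum_(t <- s) eigf t.1.1 t.1.2 t.2 x.

Lemma eigfZ (c : R) m n p x : S3 x -> eigf m n (c *: p) x = c * eigf m n p x.
Proof. by move=> Sx; rewrite !eigfE// hornerZ; ring. Qed.

Lemma eig_span_eq f g : (forall x, S3 x -> f x = g x) -> eig_span f -> eig_span g.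
Proof. by move=> fg [s hs]; exists s => x Sx; rewrite -fg// hs. Qed.

Lemma eig_span_eigf m n p : eig_span (eigf m n p).
Proof. by exists [:: (m, n, p)] => x _; rewrite big_seq1. Qed.

Lemma eig_span_cst (c : R) : eig_span (fun=> c).
Proof.
exists [:: (0, 0, c%:P)] => x Sx; rewrite big_seq1 eigfE//= hornerC.
by rewrite /sgn /=; ring.
Qed.

Lemma eig_span_lin (a b : R) f g : eig_span f -> eig_span g ->
  eig_span (fun x => a * f x + b * g x).
Proof.
move=> [s hs] [t ht].
exists ([seq (u.1.1, u.1.2, a *: u.2) | u <- s] ++ [seq (u.1.1, u.1.2, b *: u.2) | u <- t]) => x Sx.
rewrite big_cat !big_map /= hs// ht// !big_distrr/=; congr (_ + _);
  by apply: eq_bigr => u _; rewrite eigfZ.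
Qed.

(** Multiplying by z raises the weight by 1. If the weight is negative, z meets a conjugate and
    leaves the factor |z|^2, for which [q] stands. *)
Definition low_factor (q : {poly R}) m : {poly R} := if m < 0 then q else 1.

Lemma low_factorP (q : {poly R}) m (r s : R) : q.[s] = r ^+ 2 ->
  r ^+ `|m| * r = r ^+ `|m + 1| * (low_factor q m).[s] /\
  r ^+ `|m| * r = r ^+ `|m - 1| * (low_factor q (- m)).[s].
Proof.
move=> qs; rewrite /low_factor oppr_lt0; case: m => [[|k]|k].
- by rewrite /= !hornerC !mulr1 expr0 mul1r.
- rewrite /= hornerC mulr1 qs; split; first by rewrite -exprSr addn1.
  rewrite subn1 /=.
  by rewrite exprS expr2; ring.
- rewrite NegzE; have -> : `|- k.+1%:Z|%N = k.+1 by rewrite abszN.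
  have -> : absz (- k.+1%:Z + 1) = k by lia.
  have -> : absz (- k.+1%:Z - 1) = k.+2 by lia.
  rewrite oppr_lt0 /= hornerC mulr1 qs; split; last by rewrite -exprSr.
  by rewrite exprS expr2; ring.
Qed.

(** Product-to-sum formulas for [cas]: a cosine shifts the weight both ways, and a sine moreover
    reverses the sign of the argument, whence the opposite weights in the second and fourth
    identities. *)
Lemma eigf_mul_coord m n p x : S3 x ->
  [/\ eigf m n p x * x i0 ord0 = eigf (m + 1) n (p * low_factor 'X m) x / 2
        + eigf (m - 1) n (p * low_factor 'X (- m)) x / 2,
      eigf m n p x * x i1 ord0 = eigf (- (m - 1)) (- n) (p * low_factor 'X (- m)) x / 2
        - eigf (- (m + 1)) (- n) (p * low_factor 'X m) x / 2,
      eigf m n p x * x i2 ord0 = eigf m (n + 1) (p * low_factor (1 - 'X) n) x / 2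
        + eigf m (n - 1) (p * low_factor (1 - 'X) (- n)) x / 2 &
      eigf m n p x * x i3 ord0 = eigf (- m) (- (n - 1)) (p * low_factor (1 - 'X) (- n)) x / 2
        - eigf (- m) (- (n + 1)) (p * low_factor (1 - 'X) n) x / 2].
Proof.
move=> Sx; have [s [a [b [hs _ _ ->]]]] := hopf_surj Sx.
have /andP[s0 s1] := hs; have s1' : 0 <= 1 - s by rewrite subr_ge0.
have [h0 h1 h2 h3] := hopfE s a b.
have [A1 A2] := @low_factorP 'X m (Num.sqrt s) s ltac:(by rewrite hornerX sqr_sqrtr).
have [B1 B2] := @low_factorP (1 - 'X) n (Num.sqrt (1 - s)) s ltac:(by rewrite !hornerE sqr_sqrtr).
rewrite h0 h1 h2 h3 !eigf_hopf// !hornerM !abszN.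
have e0 (c t : R) : cas c * cos t = (cas (c + t) + cas (c - t)) / 2.
  by rewrite /cas cosB sinB cosD sinD; field.
have e1 (c t : R) : cas c * sin t = (cas (- (c - t)) - cas (- (c + t))) / 2.
  by rewrite /cas !cosN !sinN cosB sinB cosD sinD; field.
set A := 2 * pi * a; set B := 2 * pi * b.
set r1 := Num.sqrt s in A1 A2 *; set r2 := Num.sqrt (1 - s) in B1 B2 *.
have E1 : (m + 1)%:~R * A + n%:~R * B = (m%:~R * A + n%:~R * B) + A by rewrite intrD; ring.
have E2 : (m - 1)%:~R * A + n%:~R * B = (m%:~R * A + n%:~R * B) - A by rewrite intrB; ring.
have E3 : (- (m - 1))%:~R * A + (- n)%:~R * B = - ((m%:~R * A + n%:~R * B) - A).
  by rewrite !intrN intrB; ring.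
have E4 : (- (m + 1))%:~R * A + (- n)%:~R * B = - ((m%:~R * A + n%:~R * B) + A).
  by rewrite !intrN intrD; ring.
have E5 : m%:~R * A + (n + 1)%:~R * B = (m%:~R * A + n%:~R * B) + B by rewrite intrD; ring.
have E6 : m%:~R * A + (n - 1)%:~R * B = (m%:~R * A + n%:~R * B) - B by rewrite intrB; ring.
have E7 : (- m)%:~R * A + (- (n - 1))%:~R * B = - ((m%:~R * A + n%:~R * B) - B).
  by rewrite !intrN intrB; ring.
have E8 : (- m)%:~R * A + (- (n + 1))%:~R * B = - ((m%:~R * A + n%:~R * B) + B).
  by rewrite !intrN intrD; ring.
rewrite E1 E2 E3 E4 E5 E6 E7 E8; set T := m%:~R * A + _.
move: (r1 ^+ `|m|) (r1 ^+ `|m + 1|) (r1 ^+ `|m - 1|) (r2 ^+ `|n|) (r2 ^+ `|n + 1|) (r2 ^+ `|n - 1|)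
  (low_factor _ m).[s] (low_factor _ (- m)).[s] (low_factor _ n).[s] (low_factor _ (- n)).[s] A1 A2 B1 B2.
move=> u u1 u2 v v1 v2 f1 f2 g1 g2 A1 A2 B1 B2.
split.
- transitivity (u * r1 * v * p.[s] * (cas T * cos A)); first by ring.
  rewrite e0//; transitivity ((u * r1) * v * p.[s] * cas (T + A) / 2 + (u * r1) * v * p.[s] * cas (T - A) / 2); first by ring.
  by rewrite {1}A1 A2; ring.
- transitivity (u * r1 * v * p.[s] * (cas T * sin A)); first by ring.
  rewrite e1; transitivity ((u * r1) * v * p.[s] * cas (- (T - A)) / 2 - (u * r1) * v * p.[s] * cas (- (T + A)) / 2); first by ring.
  by rewrite {1}A2 A1; ring.
- transitivity (v * r2 * u * p.[s] * (cas T * cos B)); first by ring.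
  rewrite e0//; transitivity ((v * r2) * u * p.[s] * cas (T + B) / 2 + (v * r2) * u * p.[s] * cas (T - B) / 2); first by ring.
  by rewrite {1}B1 B2; ring.
- transitivity (v * r2 * u * p.[s] * (cas T * sin B)); first by ring.
  rewrite e1; transitivity ((v * r2) * u * p.[s] * cas (- (T - B)) / 2 - (v * r2) * u * p.[s] * cas (- (T + B)) / 2); first by ring.
  by rewrite {1}B2 B1; ring.
Qed.

Lemma eig_span_sum (I : Type) (s : seq I) (F : I -> E4 -> R) :
  (forall i, eig_span (F i)) -> eig_span (fun x => \sum_(i <- s) F i x).
Proof.
move=> hF; elim: s => [|i s IH].
  by apply: eig_span_eq (eig_span_cst 0) => x _; rewrite big_nil.
by apply: eig_span_eq (eig_span_lin 1 1 (hF i) IH) => x _; rewrite big_cons !mul1r.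
Qed.

Lemma eig_span_mul_coord f i : eig_span f -> eig_span (fun x => f x * x i ord0).
Proof.
move=> [s hs].
suff H t : eig_span (fun x => eigf t.1.1 t.1.2 t.2 x * x i ord0).
  by apply: eig_span_eq (eig_span_sum s H) => x Sx; rewrite hs// big_distrl.
case: t => [[m n] p] /=.
have sp a b c a' b' c' (e : R) : eig_span (fun x => 2^-1 * eigf a b c x + e * eigf a' b' c' x).
  by apply: eig_span_lin; exact: eig_span_eigf.
have [->|->|->|->] := ord4P i.
- apply: eig_span_eq (sp (m + 1) n (p * low_factor 'X m) (m - 1) n (p * low_factor 'X (- m)) 2^-1) => x Sx.
  by have [-> _ _ _] := eigf_mul_coord m n p Sx; ring.
- apply: eig_span_eq (sp (- (m - 1)) (- n) (p * low_factor 'X (- m)) (- (m + 1)) (- n) (p * low_factor 'X m) (- 2^-1)) => x Sx.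
  by have [_ -> _ _] := eigf_mul_coord m n p Sx; ring.
- apply: eig_span_eq (sp m (n + 1) (p * low_factor (1 - 'X) n) m (n - 1) (p * low_factor (1 - 'X) (- n)) 2^-1) => x Sx.
  by have [_ _ -> _] := eigf_mul_coord m n p Sx; ring.
- apply: eig_span_eq (sp (- m) (- (n - 1)) (p * low_factor (1 - 'X) (- n)) (- m) (- (n + 1)) (p * low_factor (1 - 'X) n) (- 2^-1)) => x Sx.
  by have [_ _ _ ->] := eigf_mul_coord m n p Sx; ring.
Qed.

Implicit Types (y c : E4) (h : R) (l : seq 'I_4).

(* Expectation of g after a random walk from y whose step in direction i is +-h
   with mean h x_i: a Bernstein operator written one coin at a time. *)
Fixpoint walk x h l g y : R :=
  if l is i :: l' then
    (1 + x i ord0) / 2 * walk x h l' g (y + h *: basis4 i) +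
    (1 - x i ord0) / 2 * walk x h l' g (y - h *: basis4 i)
  else g y.

(** For a fixed start the walk is a polynomial in the coordinates of [x], which enter only as biases
    of the coins. *)
Lemma eig_span_walk h l g y : eig_span (fun x => walk x h l g y).
Proof.
elim: l y => [|i l IH] y; first exact: eig_span_cst.
have s1 := IH (y + h *: basis4 i); have s2 := IH (y - h *: basis4 i).
have s3 := eig_span_lin 2^-1 2^-1 s1 s2.
have s4 := eig_span_lin 2^-1 (- 2^-1) (eig_span_mul_coord i s1) (eig_span_mul_coord i s2).
by apply: eig_span_eq (eig_span_lin 1 1 s3 s4) => x _ /=; field.
Qed.

Lemma walk_le x h l g g' y : S3 x -> (forall z, g z <= g' z) ->
  walk x h l g y <= walk x h l g' y.
Proof.
move=> Sx gg; elim: l y => [|i l IH] y //=.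
have := coord_le_euclid_norm x i; rewrite (Sx : euclid_norm x = 1) ler_norml => /andP[xl xu].
by apply: lerD; rewrite ler_wpM2l// divr_ge0//; lra.
Qed.

Lemma walk_lin x h l g g' (a b : R) y :
  walk x h l (fun z => a * g z + b * g' z) y = a * walk x h l g y + b * walk x h l g' y.
Proof. by elim: l y => [|i l IH] y //=; rewrite !IH; ring. Qed.

Lemma walk_cst x h l (a : R) y : walk x h l (fun=> a) y = a.
Proof. by elim: l y => [|i l IH] y //=; rewrite !IH; field. Qed.

Definition sqdist c y : R := \sum_(i < 4) (y i ord0 - c i ord0) ^+ 2.

(** Bias and variance: a step in direction [i] has mean [h * x i ord0] and variance
    [h ^+ 2 * (1 - x i ord0 ^+ 2)]. *)
Lemma walk_sqdist x h l c y : walk x h l (sqdist c) y =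
  sqdist (c - h *: \sum_(i <- l) x i ord0 *: basis4 i) y + h ^+ 2 * \sum_(i <- l) (1 - x i ord0 ^+ 2).
Proof.
elim: l y => [|i l IH] y; first by rewrite /= !big_nil scaler0 subr0 mulr0 addr0.
rewrite /= !IH !big_cons; set S := \sum_(_ <- _) _ *: _; set V := \sum_(_ <- _) _.
rewrite /sqdist !big_ord4 !mxE.
by have [->|->|->|->] := ord4P i; rewrite !eqxx !ord4_eq /=; field.
Qed.

Lemma continuous_S3_bounded f : continuous_on_S3 f -> exists2 M : R, 0 <= M & forall y, `|radial f y| <= M.
Proof.
move=> cf; have cn : continuous_on_S3 (fun x => `|f x|).
  move=> x Sx; have cx := cf x Sx; rewrite /prop_for /continuous_at in cx *.
  exact: cvg_norm cx.
(* The walk may end at the origin, where [radial f] takes the arbitrary value [f 0]. *)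
have [x Sx hx] := S3_max cn; exists (`|f x| + `|f 0|); first by rewrite addr_ge0.
move=> y; have [->|y0] := eqVneq y 0; first by rewrite /radial scaler0 lerDr.
by rewrite (le_trans (hx _ (S3_normalize y0)))// lerDl.
Qed.

(** [y] ranges over R^4 since the walk leaves the sphere; hence compactness in its covering form,
    applied to radii near 0. *)
Lemma S3_uniform_continuity f (e : R) : continuous_on_S3 f -> 0 < e ->
  exists2 d : R, 0 < d & forall x, S3 x -> forall y, ball x d y -> `|f x - radial f y| <= e.
Proof.
move=> cf e0.
have /compact_near_coveringP cov := @compact_S3 R.
have H : \forall d \near (0 : R)^'+, (@S3 R) `<=` (fun x => forall y, ball x d y -> `|radial f x - radial f y| <= e).
  apply: (cov R (0^'+) (fun d x => forall y, ball x d y -> `|radial f x - radial f y| <= e)) => x Sx.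
  have e2 : 0 < e / 2 by rewrite divr_gt0.
  have cx := cf x Sx; rewrite /prop_for /continuous_at in cx.
  have /nbhs_ballP[r /= r0 Hr] : \forall y \near x, `|radial f x - radial f y| <= e / 2.
    by move/cvgrPdist_le : cx; apply.
  have r2 : 0 < r / 2 by rewrite divr_gt0.
  exists (ball x (r / 2), [set d | d < r / 2]).
    split; first exact: nbhsx_ballx.
    by apply: nbhs_right_lt.
  move=> [x' d] [/= xx' dr] y x'y.
  have h1 := Hr x' (le_ball (_ : r / 2 <= r) xx').
  have h2 : `|radial f x - radial f y| <= e / 2.
    apply: Hr; rewrite [r](splitr r); apply: ball_triangle xx' _.
    by apply: le_ball x'y; exact: ltW.
  have -> : radial f x' - radial f y = (radial f x - radial f y) - (radial f x - radial f x') by ring.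
  rewrite (le_trans (ler_normB _ _))//.
  have := h1 ltac:(by rewrite ler_pdivrMr// ler_pMr// ler1n); lra.
have [d [d0 Hd]] : exists d, 0 < d /\ (@S3 R) `<=` (fun x => forall y, ball x d y -> `|radial f x - radial f y| <= e).
  have H2 := @filterI _ ((0 : R)^'+) _ _ _ (nbhs_right_gt (0 : R)) H.
  have [d [/= d0 Hd]] := filter_ex (H2 _).
  by exists d.
exists d => // x Sx y xy; rewrite -(radialE f Sx); exact: Hd.
Qed.

(** Chebyshev's inequality as in Bernstein's proof of the Weierstrass theorem: the walk from 0 ends
    at [x] on average, with mean squared error at most [4 / n%:R], and outside the ball of radius
    [d] the oscillation [2 * M] is at most [K * sqdist x y]. *)
Lemma eig_span_dense f (e : R) : continuous_on_S3 f -> 0 < e ->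
  exists2 g, eig_span g & forall x, S3 x -> `|f x - g x| <= e.
Proof.
move=> cf e0; have [M M0 hM] := continuous_S3_bounded cf.
have e2 : 0 < e / 2 by rewrite divr_gt0.
have [d d0 hd] := S3_uniform_continuity cf e2.
pose K := 2 * M / d ^+ 2.
have K0 : 0 <= K by apply: divr_ge0; [exact: mulr_ge0|apply/exprn_ge0/ltW].
(* Chosen so that [K * (4 / n%:R) <= e / 2]. *)
pose n := (Num.truncn (8 * K / e)).+1.
have n0 : 0 < n%:R :> R by rewrite ltr0n.
pose l := flatten (nseq n [:: i0; i1; i2; i3]).
pose h : R := n%:R^-1.
exists (fun x => walk x h l (radial f) 0); first exact: eig_span_walk.
move=> x Sx.
have sl (V : zmodType) (F : 'I_4 -> V) : \sum_(i <- l) F i = (\sum_(i < 4) F i) *+ n.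
  rewrite /l; elim: n {n0 l h} => [|k IH] /=; first by rewrite big_nil.
  by rewrite !big_cons IH big_ord4 mulrS !addrA.
have wq : walk x h l (sqdist x) 0 <= 4 / n%:R.
  rewrite walk_sqdist !sl.
  have -> : \sum_(i < 4) x i ord0 *: basis4 i = x.
    apply/matrixP => i j; rewrite ord1 summxE (bigD1 i)//= big1 ?addr0; last first.
      by move=> k /negPf ki; rewrite !mxE eq_sym ki mulr0.
    by rewrite ord1 !mxE !eqxx mulr1.
  have -> : h *: (x *+ n) = x.
    by rewrite -scaler_nat scalerA /h mulVf ?scale1r// gt_eqF.
  rewrite subrr; have -> : sqdist (0 : E4) 0 = 0.
    by rewrite /sqdist big1// => i _; rewrite !mxE subrr expr0n.
  rewrite add0r; set V := \sum_(_ < _) _; rewrite -[V *+ n]mulr_natr /h mulrCA mulrA.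
  have V4 : V <= 4.
    rewrite /V big_ord4; have := sqr_ge0 (x i0 ord0); have := sqr_ge0 (x i1 ord0).
    by have := sqr_ge0 (x i2 ord0); have := sqr_ge0 (x i3 ord0); lra.
  have -> : V * n%:R^-1 ^+ 2 * n%:R = V / n%:R by field; rewrite gt_eqF.
  by rewrite ler_pM2r ?invr_gt0.
have key y : `|f x - radial f y| <= 1 * (e / 2) + K * sqdist x y.
  have q0 : 0 <= sqdist x y by apply: sumr_ge0 => i _; exact: sqr_ge0.
  have [xy|nxy] := pselect (ball x d y).
    by rewrite mul1r (le_trans (hd x Sx y xy))// lerDl mulr_ge0.
  have dq : d ^+ 2 <= sqdist x y.
    rewrite leNgt; apply/negP => lt; apply: nxy; split => // i j; rewrite ord1 /ball /= distrC.
    rewrite -(@ltr_pXn2r _ 2) ?nnegrE ?(ltW d0)// real_normK ?num_real//.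
    apply: le_lt_trans lt; rewrite /sqdist (bigD1 i)//= lerDl sumr_ge0// => k _; exact: sqr_ge0.
  rewrite (le_trans (ler_normB _ _))// -(radialE f Sx).
  apply: (@le_trans _ _ (2 * M)); first by have := hM x; have := hM y; lra.
  rewrite mul1r -[leLHS]add0r lerD ?(ltW e2)//.
  have -> : 2 * M = K * d ^+ 2 by rewrite /K divfK// gt_eqF// exprn_gt0.
  by rewrite ler_wpM2l.
have up : walk x h l (fun y => 1 * (e / 2) + K * sqdist x y) 0 <= e.
  rewrite (walk_lin x h l (fun=> e / 2) (sqdist x) 1 K) walk_cst mul1r.
  have := ler_wpM2l K0 wq; have : K * (4 / n%:R) <= e / 2.
    rewrite mulrA ler_pdivrMr//.
    have := truncnS_gt (8 * K / e); rewrite -/n ltr_pdivrMr//; lra.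
  lra.
have E : f x - walk x h l (radial f) 0 = walk x h l (fun y => f x - radial f y) 0.
  have := walk_lin x h l (fun=> f x) (radial f) 1 (-1) 0; rewrite walk_cst mul1r mulN1r => <-.
  by congr (walk _ _ _ _ _); apply/funext => y; rewrite mulN1r.
rewrite E ler_norml; apply/andP; split; last first.
  by apply: le_trans up; apply: walk_le => // y; apply: le_trans (key y); exact: ler_norm.
rewrite lerNl -[X in X <= _]mulN1r -[X in X <= _]addr0 -[X in _ + X](mul0r (walk x h l (radial f) 0)).
rewrite -walk_lin; apply: le_trans up; apply: walk_le => // y.
by apply: le_trans (key y); rewrite mulN1r mul0r addr0 -normrN ler_norm.
Qed.

End SpanOfEigenfunctions.

(** * Orthogonality, completeness and the eigenspaces of the sphere *)

Section SpectralTheorem.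
Context {R : realType}.
Local Notation E4 := 'cV[R]_4.
Implicit Types (f g : E4 -> R) (m n : int) (t : int * int * nat) (x : E4).

Lemma continuous_on_S3_lin (a b : R) f g : continuous_on_S3 f -> continuous_on_S3 g ->
  continuous_on_S3 (fun x => a * f x + b * g x).
Proof.
move=> cf cg x Sx; have := cf x Sx; have := cg x Sx; rewrite /prop_for /continuous_at => hg hf.
by apply: (cvgD (cvgMr hf) (cvgMr hg)).
Qed.

Lemma continuous_on_S3M f g : continuous_on_S3 f -> continuous_on_S3 g ->
  continuous_on_S3 (fun x => f x * g x).
Proof.
move=> cf cg x Sx; have := cf x Sx; have := cg x Sx; rewrite /prop_for /continuous_at => hg hf.
exact: (cvgM hf hg).
Qed.

Lemma continuous_eigf m n (p : {poly R}) : continuous_on_S3 (eigf m n p).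
Proof. exact/smooth_continuous_on_S3/smooth_eigf. Qed.

Lemma integrable_eigf m n (p : {poly R}) : integrable_S3 (eigf m n p).
Proof.
apply: (@eq_integrable R (fun x => eigf m n p x * eigf 0 0 1 x)).
  by move=> x Sx; rewrite [X in _ * X]eigfE//= hornerC /sgn /=; ring.
exact: cvgP (@avg_eigfM_cvg R m n 0 0 p 1).
Qed.

Lemma integrable_eig_span f : eig_span f -> integrable_S3 f.
Proof.
move=> [s hs]; suff H : integrable_S3 (fun x => \sum_(t <- s) eigf t.1.1 t.1.2 t.2 x).
  by apply: eq_integrable H => x Sx; rewrite hs.
elim: s {hs} => [|t s IH].
  have [+ _] := sint_lin 0 0 (@integrable_eigf 0 0 1) (@integrable_eigf 0 0 1).
  by apply: eq_integrable => x _; rewrite big_nil !mul0r addr0.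
have [+ _] := sint_lin 1 1 (@integrable_eigf t.1.1 t.1.2 t.2) IH.
by apply: eq_integrable => x _; rewrite big_cons !mul1r.
Qed.

Lemma continuous_integrable f : continuous_on_S3 f -> integrable_S3 f.
Proof.
move=> cf; apply: integrable_uniform_limit => e e0.
by have [g sg fg] := eig_span_dense cf e0; exists g; split => //; exact: integrable_eig_span.
Qed.

Definition index_degree t : nat := (`|t.1.1| + `|t.1.2| + 2 * t.2)%N.

Definition basis_fun t : E4 -> R :=
  eigf t.1.1 t.1.2 (jacobi `|t.1.1| (`|t.1.1| + `|t.1.2|) t.2).

Definition sphere_eigenvalue (k : nat) : R := (k * (k + 2))%:R.

Lemma continuous_basis_fun t : continuous_on_S3 (basis_fun t).
Proof. exact: continuous_eigf. Qed.

Lemma basis_fun_eigen t x : S3 x ->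
  sphere_laplacian (basis_fun t) x = sphere_eigenvalue (index_degree t) * basis_fun t x.
Proof. by move=> Sx; apply: eigf_eigen => //; exact: jacobi_ode. Qed.

(** Different weights are separated by the angular averages, equal weights by the Jacobi
    polynomials. *)
Lemma basis_fun_orthogonal t (u : int * int * nat) : t != u -> sint (fun x => basis_fun t x * basis_fun u x) = 0.
Proof.
move=> tu; apply: (cvg_lim (@Rhausdorff R)).
have := @avg_eigfM_cvg R t.1.1 t.1.2 u.1.1 u.1.2 (jacobi `|t.1.1| (`|t.1.1| + `|t.1.2|) t.2)
  (jacobi `|u.1.1| (`|u.1.1| + `|u.1.2|) u.2).
case: ifP => // /andP[/eqP e1 /eqP e2]; rewrite -e1 -e2 jacobi_orthogonal// => [h|].
  by rewrite /basis_fun -e1 -e2.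
apply: contra tu => /eqP e3.
by rewrite [t]surjective_pairing [u]surjective_pairing [t.1]surjective_pairing [u.1]surjective_pairing e1 e2 e3.
Qed.

Lemma basis_fun_neq0 t : exists2 x, S3 x & basis_fun t x != 0.
Proof.
set p : {poly R} := jacobi `|t.1.1| (`|t.1.1| + `|t.1.2|) t.2.
have p0 : p != 0 by rewrite -size_poly_gt0 size_jacobi.
(* The numbers 1 / (i + 2) are infinitely many points of ]0, 1[, so one of them is not a root; both
   angles are then set to 0, where [cas] is 1. *)
have [i hi] : exists i : nat, ~~ root p (i.+2%:R^-1).
  apply: contrapT => h; pose rs := [seq i.+2%:R^-1 : R | i <- iota 0 (size p)].
  have := @max_poly_roots _ p rs p0; rewrite size_map size_iota ltnn => /(_ _ _)/notF; apply.
    by apply/allP => _ /mapP[i _ ->]; apply: contrapT => hi; apply: h; exists i; apply/negP.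
  rewrite map_inj_uniq ?iota_uniq// => i j /invr_inj /eqP.
  by rewrite eqr_nat => /eqP[].
pose s : R := i.+2%:R^-1.
have s0 : 0 < s by rewrite invr_gt0.
have s1 : 0 < 1 - s by rewrite subr_gt0 invf_lt1// ltr1n.
exists (hopf s 0 0); first by apply: hopf_S3; rewrite ltW//= -subr_ge0 ltW.
rewrite /basis_fun eigf_hopf; last by rewrite ltW//= -subr_ge0 ltW.
rewrite -/p !mulr0 addr0 /cas cos0 sin0 addr0 mulr1.
by rewrite !mulf_neq0 ?expf_neq0// gt_eqF// sqrtr_gt0.
Qed.

Lemma sint_sq_gt0 f x : continuous_on_S3 f -> S3 x -> f x != 0 -> 0 < sint (fun x => f x * f x).
Proof.
move=> cf Sx fx; have c2 := continuous_on_S3M cf cf.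
apply: (avg_pos c2 _ Sx) => [y _||]; first by rewrite -expr2 sqr_ge0.
  by rewrite -expr2 exprn_even_gt0.
exact: continuous_integrable.
Qed.

Lemma basis_fun_sq_gt0 t : 0 < sint (fun x => basis_fun t x * basis_fun t x).
Proof. by have [x Sx] := basis_fun_neq0 t; apply: sint_sq_gt0 => //; exact: continuous_basis_fun. Qed.

Definition comb (s : seq (R * (int * int * nat))) : E4 -> R :=
  fun x => \sum_(u <- s) u.1 * basis_fun u.2 x.

Lemma comb_cons a s : comb (a :: s) = fun x => a.1 * basis_fun a.2 x + 1 * comb s x.
Proof. by apply/funext => x; rewrite /comb big_cons mul1r. Qed.

Lemma comb0 : comb [::] = fun y => 0 * basis_fun (0, 0, 0%N) y + 0 * basis_fun (0, 0, 0%N) y.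
Proof. by apply/funext => y; rewrite /comb big_nil !mul0r addr0. Qed.

Lemma smooth_lin_S3 (a b : R) f g : smooth_on_S3 f -> smooth_on_S3 g ->
  smooth_on_S3 (fun y => a * f y + b * g y).
Proof. by move=> sf sg; exact: (@smooth_on_lin R _ (radial f) (radial g) a b (@open_punctured R) sf sg). Qed.

Lemma smooth_basis_fun t : smooth_on_S3 (basis_fun t).
Proof. exact: smooth_eigf. Qed.

Lemma smooth_comb s : smooth_on_S3 (comb s).
Proof.
elim: s => [|a s IH]; last first.
  by rewrite comb_cons; apply: smooth_lin_S3 => //; exact: smooth_basis_fun.
rewrite comb0.
by apply: smooth_lin_S3; exact: smooth_basis_fun.
Qed.

Lemma laplacian_comb s x : S3 x -> sphere_laplacian (comb s) x =
  comb [seq (sphere_eigenvalue (index_degree u.2) * u.1, u.2) | u <- s] x.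
Proof.
move=> Sx; elim: s => [|a s IH].
  rewrite comb0.
  by rewrite sphere_laplacian_lin// ?mul0r ?addr0//; exact: smooth_basis_fun.
rewrite /= !comb_cons sphere_laplacian_lin//; [|exact: smooth_basis_fun|exact: smooth_comb].
by rewrite IH basis_fun_eigen//=; ring.
Qed.

Lemma sint_comb f s : continuous_on_S3 f -> sint (fun x => f x * comb s x) =
  \sum_(u <- s) u.1 * sint (fun x => f x * basis_fun u.2 x).
Proof.
move=> cf; elim: s => [|a s IH].
  rewrite big_nil (@eq_sint R _ (fun x => 0 * f x + 0 * f x)); last first.
    by move=> x _; rewrite /comb big_nil !mul0r mulr0 addr0.
  have ci := continuous_integrable cf.
  by have [_ ->] := sint_lin 0 0 ci ci; rewrite !mul0r addr0.
rewrite big_cons -IH comb_cons.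
have c1 := continuous_integrable (continuous_on_S3M cf (@continuous_basis_fun a.2)).
have c2 := continuous_integrable (continuous_on_S3M cf (smooth_continuous_on_S3 (smooth_comb s))).
have [_ E] := sint_lin a.1 1 c1 c2; rewrite mul1r in E; rewrite -E.
by apply: eq_sint => x _; ring.
Qed.

Lemma eig_span_comb f : eig_span f -> exists s, forall x, S3 x -> f x = comb s x.
Proof.
move=> [s hs].
have h (t : int * int * {poly R}) : exists s', forall x, S3 x -> eigf t.1.1 t.1.2 t.2 x = comb s' x.
  have [c hc] := poly_jacobi_span `|t.1.1| (`|t.1.1| + `|t.1.2|) t.2.
  exists [seq (c i, (t.1, i)) | i <- iota 0 (size t.2)] => x Sx.
  rewrite eigfE// [in LHS]hc horner_sum big_distrr /comb big_map.
  have -> : iota 0 (size t.2) = index_iota 0 (size t.2) by rewrite /index_iota subn0.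
  rewrite big_mkord.
  by apply: eq_bigr => i _; rewrite hornerZ /basis_fun eigfE//; rewrite mulrCA.
have [F hF] := choice h.
exists (flatten [seq F v | v <- s]) => x Sx; rewrite hs// /comb big_flatten big_map.
by apply: eq_bigr => t _; exact: hF.
Qed.

Lemma comb_dense f (e : R) : continuous_on_S3 f -> 0 < e ->
  exists s, forall x, S3 x -> `|f x - comb s x| <= e.
Proof.
move=> cf e0; have [g /eig_span_comb[s gs] fg] := eig_span_dense cf e0.
by exists s => x Sx; rewrite -gs//; exact: fg.
Qed.

Lemma sintM_le f g (M e : R) : continuous_on_S3 f -> continuous_on_S3 g -> 0 <= M -> 0 <= e ->
  (forall x, S3 x -> `|f x| <= M) -> (forall x, S3 x -> `|g x| <= e) ->
  `|sint (fun x => f x * g x)| <= M * e.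
Proof.
move=> cf cg M0 e0 fM ge; apply: sint_le; first exact: mulr_ge0.
  exact/continuous_integrable/continuous_on_S3M.
by move=> x Sx; rewrite normrM ler_pM// ?fM ?ge.
Qed.

Lemma bounded_on_S3 f : continuous_on_S3 f -> exists2 M : R, 0 < M & forall x, S3 x -> `|f x| <= M.
Proof.
move=> /continuous_S3_bounded[M M0 hM]; exists (M + 1); first by rewrite ltr_wpDl.
by move=> x Sx; rewrite -(radialE f Sx) (le_trans (hM x))// lerDl.
Qed.

Lemma sintMB h f g (a b : R) : continuous_on_S3 h -> continuous_on_S3 f -> continuous_on_S3 g ->
  sint (fun x => h x * (a * f x + b * g x)) =
  a * sint (fun x => h x * f x) + b * sint (fun x => h x * g x).
Proof.
move=> ch cf cg.
have c1 := continuous_integrable (continuous_on_S3M ch cf).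
have c2 := continuous_integrable (continuous_on_S3M ch cg).
have [_ <-] := sint_lin a b c1 c2.
by apply: eq_sint => x _; ring.
Qed.

(** Let [c] be the integral of the square of [f] and [M] a bound for [f]. A combination within
    [c / (2 * M)] of [f] is orthogonal to [f], which forces [c <= c / 2]. *)
Lemma basis_fun_complete f : continuous_on_S3 f ->
  (forall t, sint (fun x => f x * basis_fun t x) = 0) -> forall x, S3 x -> f x = 0.
Proof.
move=> cf h x Sx; apply/eqP/negP => /negP fx.
have c0 := sint_sq_gt0 cf Sx fx; set c := sint _ in c0.
have [M M0 hM] := bounded_on_S3 cf.
have e0 : 0 < c / (2 * M) by rewrite divr_gt0 ?mulr_gt0.
have [s hs] := comb_dense cf e0.
have cs := smooth_continuous_on_S3 (smooth_comb s).
have E := sintMB 1 (-1) cf cf cs.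
rewrite sint_comb// big1 in E; last by move=> u _; rewrite h mulr0.
have := @sintM_le f (fun x => 1 * f x + -1 * comb s x) M _ cf (@continuous_on_S3_lin 1 (-1) _ _ cf cs) (ltW M0) (ltW e0) hM.
rewrite E mulr0 addr0 mul1r -/c => H.
have := H _; rewrite ger0_norm ?(ltW c0)// => {}H.
have : c <= M * (c / (2 * M)) by apply: H => y Sy; rewrite mul1r mulN1r; exact: hs.
have -> : M * (c / (2 * M)) = c / 2 by field; rewrite gt_eqF.
lra.
Qed.

(* If P is a combination of basis functions uniformly close to f, apply the
   maximum principle to f / (mu + l) - Q, where (Laplacian + l) Q = P: so Q is
   close to f / (mu + l) as well, and the coefficients of P and Q on the basis
   function t differ by the factor ev + l. *)
Lemma eigenfunction_coef f (mu : R) t : smooth_on_S3 f ->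
  (forall x, S3 x -> sphere_laplacian f x = mu * f x) ->
  sphere_eigenvalue (index_degree t) != mu -> sint (fun x => f x * basis_fun t x) = 0.
Proof.
move=> sf hf ne; have cf := smooth_continuous_on_S3 sf; have cb := @continuous_basis_fun t.
have [M M0 hM] := bounded_on_S3 cb.
(* Makes [mu + l] positive, and being at least 1 keeps the bounds below free of [l]. *)
pose l := 1 + `|mu|.
have l1 : 1 <= l by rewrite lerDl.
have ml : 0 < mu + l by rewrite /l; have := ler_norm (- mu); rewrite normrN; lra.
have ev0 k : 0 <= sphere_eigenvalue k by rewrite ler0n.
have el k : 0 < sphere_eigenvalue k + l by rewrite ltr_wpDl// (lt_le_trans ltr01).
set ev := sphere_eigenvalue (index_degree t) in ne *.
set I := sint _.
have key e : 0 < e -> `|I / (mu + l) - I / (ev + l)| <= 2 * M * e.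
  move=> e0; have [s hs] := comb_dense cf e0.
  have cs := smooth_continuous_on_S3 (smooth_comb s).
  pose s' := [seq (u.1 / (sphere_eigenvalue (index_degree u.2) + l), u.2) | u <- s].
  have cs' := smooth_continuous_on_S3 (smooth_comb s').
  have sg := smooth_lin_S3 (mu + l)^-1 (-1) sf (smooth_comb s').
  have hg x : S3 x -> `|sphere_laplacian (fun y => (mu + l)^-1 * f y + -1 * comb s' y) x
     + l * ((mu + l)^-1 * f x + -1 * comb s' x)| <= e.
    move=> Sx; rewrite sphere_laplacian_lin ?laplacian_comb ?hf//; last exact: smooth_comb.
    suff -> : (mu + l)^-1 * (mu * f x) + -1 * comb [seq (sphere_eigenvalue (index_degree u.2) * u.1, u.2) | u <- s'] x
        + l * ((mu + l)^-1 * f x + -1 * comb s' x) = f x - comb s x by exact: hs.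
    have -> : comb s x = comb [seq (sphere_eigenvalue (index_degree u.2) * u.1, u.2) | u <- s'] x + l * comb s' x.
      rewrite /comb !big_map big_distrr -big_split /=; apply: eq_bigr => u _.
      by have := el (index_degree u.2); move: (sphere_eigenvalue _) => v v0; field; rewrite gt_eqF.
    by field; rewrite gt_eqF.
  have gl := maximum_principle sg (lt_le_trans ltr01 l1) hg.
  have gle x : S3 x -> `|(mu + l)^-1 * f x + -1 * comb s' x| <= e.
    by move=> Sx; apply: le_trans (gl x Sx); rewrite ler_peMl.
  have fle x : S3 x -> `|1 * f x + -1 * comb s x| <= e.
    by move=> Sx; rewrite mul1r mulN1r; exact: hs.
  have h1 := sintM_le cb (@continuous_on_S3_lin (mu + l)^-1 (-1) _ _ cf cs') (ltW M0) (ltW e0) hM gle.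
  have h2 := sintM_le cb (@continuous_on_S3_lin 1 (-1) _ _ cf cs) (ltW M0) (ltW e0) hM fle.
  rewrite sintMB// in h1; rewrite sintMB// in h2.
  have EI : sint (fun x => basis_fun t x * f x) = I by apply: eq_sint => x _; rewrite mulrC.
  rewrite EI in h1 h2.
  have EQ : sint (fun x => basis_fun t x * comb s' x) = sint (fun x => basis_fun t x * comb s x) / (ev + l).
    rewrite !sint_comb// big_map big_distrl /=; apply: eq_bigr => u _.
    by have [<-|tu] := eqVneq t u.2; [rewrite -/ev; ring|rewrite basis_fun_orthogonal// !mulr0 mul0r].
  rewrite EQ in h1; move: h1 h2; set A := sint _ => h1 h2.
  (* The coefficient of [f / (mu + l) - Q], minus that of [f - P] divided by [ev + l]; each is at
     most [M * e]. *)
  have -> : I / (mu + l) - I / (ev + l) =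
     ((mu + l)^-1 * I + -1 * (A / (ev + l))) - (ev + l)^-1 * (1 * I + -1 * A) by ring.
  rewrite (le_trans (ler_normB _ _))// normrM.
  have i1 : `|(ev + l)^-1| <= 1.
    rewrite ger0_norm ?invr_ge0 ?(ltW (el _))// invf_le1 ?el//.
    by rewrite (le_trans l1)// lerDr.
  have := ler_pM (normr_ge0 _) (normr_ge0 _) i1 h2; rewrite mul1r; lra.
have z : I / (mu + l) - I / (ev + l) = 0.
  apply/eqP; rewrite -normr_le0; apply/ler_addgt0Pl => e e0; rewrite addr0.
  have := key (e / (2 * M)); rewrite divr_gt0 ?mulr_gt0// => /(_ isT).
  by have -> : 2 * M * (e / (2 * M)) = e by field; rewrite gt_eqF.
have n1 : mu + l != 0 by rewrite gt_eqF.
have n2 : ev + l != 0 by rewrite gt_eqF ?el.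
have E : I * (ev - mu) = (I / (mu + l) - I / (ev + l)) * (mu + l) * (ev + l).
  by clearbody ev l I; move: n1 n2 => *; field; apply/andP.
move: E; rewrite z !mul0r => /eqP; rewrite mulf_eq0 subr_eq0 (negPf ne) orbF => /eqP; exact.
Qed.

Lemma eigenvalue_trivial f (mu : R) : smooth_on_S3 f ->
  (forall x, S3 x -> sphere_laplacian f x = mu * f x) ->
  (forall k, sphere_eigenvalue k != mu) -> forall x, S3 x -> f x = 0.
Proof.
move=> sf hf ne; apply: basis_fun_complete; first exact: smooth_continuous_on_S3.
by move=> t; apply: eigenfunction_coef hf _.
Qed.

(* The indices of degree k are the weights (m, n) of the maximal torus on
   V_k (x) V_k, where V_k is the irreducible representation of SU(2) of dimension
   k + 1; the third component is forced by the degree. *)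
Definition pair_index (k i j : nat) : int * int * nat :=
  let m : int := i%:Z + j%:Z - k%:Z in let n : int := i%:Z - j%:Z in
  (m, n, (k - `|m| - `|n|)./2)%N.

(** |m| + |n| is at most [k] and has the parity of [k], so the halving in [pair_index] is exact. *)
Lemma index_degree_pair k i j : (i <= k)%N -> (j <= k)%N -> index_degree (pair_index k i j) = k.
Proof.
move=> ik jk; rewrite /index_degree /pair_index /=.
set m := _ - k%:Z; set n := _ - j%:Z.
have := odd_double_half (k - `|m| - `|n|); rewrite -mul2n.
have -> : odd (k - `|m| - `|n|) = false by apply/negbTE; lia.
lia.
Qed.

Definition index_of k (p : 'I_k.+1 * 'I_k.+1) : int * int * nat := pair_index k p.1 p.2.

Lemma index_degree_of k (p : 'I_k.+1 * 'I_k.+1) : index_degree (index_of p) = k.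
Proof. by rewrite index_degree_pair// -ltnS; exact: ltn_ord. Qed.

Lemma index_of_inj k : injective (@index_of k).
Proof.
move=> [i j] [i' j']; rewrite /index_of /pair_index => -[] *.
by congr pair; apply/val_inj => /=; lia.
Qed.

(** Solves i + j = m + k and i - j = n; the cases on the signs give the solution without division by
    2. *)
Lemma pair_index_surj t : exists i j, [/\ (i <= index_degree t)%N, (j <= index_degree t)%N &
  t = pair_index (index_degree t) i j].
Proof.
case: t => -[m n] l; set k := index_degree _.
have kE : k = (`|m| + `|n| + 2 * l)%N by [].
have h : exists i j : nat, [/\ (i <= k)%N, (j <= k)%N, m = i%:Z + j%:Z - k%:Z & n = i%:Z - j%:Z].
  clearbody k; case: m n kE => [m|m] [n|n] /= kE.
  - by exists (m + n + l)%N, (m + l)%N; split; lia.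
  - by exists (m + l)%N, (m + n + 1 + l)%N; split; lia.
  - by exists (n + l)%N, l; split; lia.
  - by exists l, (n + 1 + l)%N; split; lia.
have [i [j [ik jk em en]]] := h; exists i, j; split => //.
rewrite /pair_index -em -en kE -addnA addKn addKn mul2n doubleK //.
Qed.

(** [f] minus its projection onto degree [k] is orthogonal to every basis function, in the other
    degrees by [eigenfunction_coef]; completeness concludes. *)
Lemma eigenspace_decomposition f k : smooth_on_S3 f ->
  (forall x, S3 x -> sphere_laplacian f x = sphere_eigenvalue k * f x) ->
  exists a : 'I_k.+1 * 'I_k.+1 -> R,
    forall x, S3 x -> f x = \sum_p a p * basis_fun (index_of p) x.
Proof.
move=> sf hf; pose b := @index_of k.
pose N p := sint (fun x => basis_fun (b p) x * basis_fun (b p) x).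
pose a p := sint (fun x => f x * basis_fun (b p) x) / N p.
exists a => x Sx; pose s := [seq (a p, b p) | p <- index_enum ('I_k.+1 * 'I_k.+1)%type].
have sE y : \sum_p a p * basis_fun (b p) y = comb s y by rewrite /comb big_map.
rewrite sE; apply/eqP; rewrite -subr_eq0; apply/eqP.
have cf := smooth_continuous_on_S3 sf.
have cs := smooth_continuous_on_S3 (smooth_comb s).
suff : 1 * f x + -1 * comb s x = 0 by rewrite mul1r mulN1r.
apply: (basis_fun_complete (f := fun x => 1 * f x + -1 * comb s x)) Sx; first exact: continuous_on_S3_lin.
move=> t; have cb := @continuous_basis_fun t.
rewrite (@eq_sint R _ (fun x => basis_fun t x * (1 * f x + -1 * comb s x))); last by move=> y _; rewrite mulrC.
rewrite sintMB// sint_comb// big_map /=.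
have E : sint (fun x => basis_fun t x * f x) = sint (fun x => f x * basis_fun t x).
  by apply: eq_sint => y _; rewrite mulrC.
rewrite E; have [i [j [ik jk tE]]] := pair_index_surj t.
have [tk|tk] := eqVneq (index_degree t) k.
  rewrite tk in ik jk tE; rewrite -ltnS in ik; rewrite -ltnS in jk; pose p : 'I_k.+1 * 'I_k.+1 := (Ordinal ik, Ordinal jk).
  have tb : t = b p by [].
  rewrite (bigD1 p)//= big1 => [|p' p'p]; last first.
    rewrite basis_fun_orthogonal ?mulr0//; apply: contra p'p => /eqP e; apply/eqP/index_of_inj.
    by move: e; rewrite tb.
  rewrite addr0 tb -/(N p) /a divfK ?mul1r ?mulN1r ?subrr//.
  by rewrite gt_eqF// basis_fun_sq_gt0.
rewrite (eigenfunction_coef sf hf); last first.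
  by rewrite /sphere_eigenvalue eqr_nat; apply: contra tk => /eqP e; apply/eqP; nia.
rewrite big1 ?mulr0 ?addr0// => p _; rewrite basis_fun_orthogonal ?mulr0//.
by apply: contra tk => /eqP ->; rewrite index_degree_of.
Qed.

Lemma basis_fun_independent (I : finType) (b : I -> int * int * nat) (a : I -> R) : injective b ->
  (forall x, S3 x -> \sum_i a i * basis_fun (b i) x = 0) -> forall i, a i = 0.
Proof.
move=> binj h i; pose s := [seq (a i, b i) | i <- index_enum I].
have cb := @continuous_basis_fun (b i).
have := sint_comb s cb; rewrite big_map /= (bigD1 i)//= big1 => [|j ji]; last first.
  by rewrite basis_fun_orthogonal ?mulr0//; apply: contra ji => /eqP/binj ->.
rewrite addr0 (@eq_sint R _ (fun x => 0 * basis_fun (b i) x + 0 * basis_fun (b i) x)); last first.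
  by move=> x Sx; rewrite /comb big_map /= h// !mul0r mulr0 addr0.
have ci := continuous_integrable cb; have [_ ->] := sint_lin 0 0 ci ci.
rewrite !mul0r addr0 => /esym/eqP; rewrite mulf_eq0 => /orP[/eqP //|].
by rewrite gt_eqF// basis_fun_sq_gt0.
Qed.

End SpectralTheorem.

(** * Action of the group and dimension of the invariant eigenspaces *)

Section GroupInvariance.
Context {R : realType}.
Local Notation E4 := 'cV[R]_4.
Implicit Types (f : E4 -> R) (q m n : int) (x : E4).

Lemma rot2M (a b : R) : rot2 a *m rot2 b = rot2 (a + b).
Proof.
apply/matrixP => i j; rewrite !mxE !big_ord_recl big_ord0 !mxE.
rewrite [2 * pi * (a + b)]mulrDr sinD cosD; move: (cos _) (sin _) (cos _) (sin _) => ca sa cb sb.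
by case: i => -[|[|]]// hi; case: j => -[|[|]]// hj; rewrite -?val_eqE /=; ring.
Qed.

Lemma rot2_0 : rot2 (0 : R) = 1%:M.
Proof.
apply/matrixP => i j; rewrite !mxE mulr0 cos0 sin0 oppr0.
by case: (i == j) => //; case: (i < j)%N.
Qed.

Lemma lens_gen_mulV q p1 p2 : lens_gen R q p1 p2 *m lens_gen R q (- p1) (- p2) = 1%:M.
Proof.
have e (p : int) : p%:~R / q%:~R + (- p)%:~R / q%:~R = 0 :> R.
  by rewrite mulrNz mulNr subrr.
have := mulmx_block (rot2 (p1%:~R / q%:~R : R)) 0 0 (rot2 (p2%:~R / q%:~R))
  (rot2 ((- p1)%:~R / q%:~R)) 0 0 (rot2 ((- p2)%:~R / q%:~R)).
rewrite !mulmx0 !mul0mx !addr0 !add0r !rot2M !e rot2_0 => E; apply: (etrans E).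
by rewrite -scalar_mx_block.
Qed.

Lemma block_diag_mulE (A D : 'M[R]_2) x (i : 'I_2) :
  ((block_mx A 0 0 D : 'M[R]_(2 + 2)) *m (x : 'cV[R]_(2 + 2))) (lshift 2 i) ord0 =
    \sum_(j < 2) A i j * x (lshift 2 j) ord0 /\
  ((block_mx A 0 0 D : 'M[R]_(2 + 2)) *m (x : 'cV[R]_(2 + 2))) (rshift 2 i) ord0 =
    \sum_(j < 2) D i j * x (rshift 2 j) ord0.
Proof.
split; rewrite mxE big_split_ord /=.
  rewrite [X in _ + X]big1 ?addr0.
    by apply: eq_bigr => j _; rewrite block_mxEul.
  by move=> j _; rewrite block_mxEur mxE mul0r.
rewrite [X in X + _]big1 ?add0r.
  by apply: eq_bigr => j _; rewrite block_mxEdr.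
by move=> j _; rewrite block_mxEdl mxE mul0r.
Qed.

(** [rot2 t] is the rotation by - 2 pi t, hence the minus signs. *)
Lemma lens_gen_hopf q p1 p2 (s a b : R) :
  lens_gen R q p1 p2 *m hopf s a b = hopf s (a - p1%:~R / q%:~R) (b - p2%:~R / q%:~R).
Proof.
have [h0 h1 h2 h3] := hopfE s a b.
have [k0 k1 k2 k3] := hopfE s (a - p1%:~R / q%:~R) (b - p2%:~R / q%:~R).
have e0 : i0 = @lshift 2 2 ord0 by exact/val_inj.
have e1 : i1 = @lshift 2 2 (lift ord0 ord0) by apply/val_inj; rewrite /= inordK.
have e2 : i2 = @rshift 2 2 ord0 by apply/val_inj; rewrite /= inordK.
have e3 : i3 = @rshift 2 2 (lift ord0 ord0) by apply/val_inj; rewrite /= inordK.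
set x := hopf s a b; set y := hopf _ _ _.
have [g0 g2] := block_diag_mulE (rot2 (p1%:~R / q%:~R)) (rot2 (p2%:~R / q%:~R)) x ord0.
have [g1 g3] := block_diag_mulE (rot2 (p1%:~R / q%:~R)) (rot2 (p2%:~R / q%:~R)) x (lift ord0 ord0).
rewrite -e0 in g0; rewrite -e1 in g1; rewrite -e2 in g2; rewrite -e3 in g3.
have rE (t : R) i j : rot2 t i j = if i == j then cos (2 * pi * t)
    else if (i < j)%N then sin (2 * pi * t) else - sin (2 * pi * t) by rewrite mxE.
rewrite !big_ord_recl !big_ord0 -?e0 -?e1 -?e2 -?e3 !rE -!val_eqE /= ?h0 ?h1 ?h2 ?h3 in g0 g1 g2 g3.
rewrite mulrBr cosB sinB in k0 k1; rewrite mulrBr cosB sinB in k2 k3.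
apply/matrixP => i j; rewrite ord1.
have [->|->|->|->] := ord4P i; rewrite ?k0 ?k1 ?k2 ?k3.
- by apply: (etrans g0); ring.
- by apply: (etrans g1); ring.
- by apply: (etrans g2); ring.
- by apply: (etrans g3); ring.
Qed.

Lemma lens_gen_S3 q p1 p2 x : S3 x -> S3 (lens_gen R q p1 p2 *m x).
Proof. by move=> /hopf_surj[s [a [b [hs _ _ ->]]]]; rewrite lens_gen_hopf; exact: hopf_S3. Qed.

(** This is [cas (T - psi) = cos psi * cas T - sin psi * cas (- T)]. *)
Lemma eigf_lens_gen q p1 p2 m n (p : {poly R}) x : S3 x ->
  eigf m n p (lens_gen R q p1 p2 *m x) =
  cos (angle q (m * p1 + n * p2)) * eigf m n p x - sin (angle q (m * p1 + n * p2)) * eigf (- m) (- n) p x.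
Proof.
move=> /hopf_surj[s [a [b [hs _ _ ->]]]]; rewrite lens_gen_hopf !eigf_hopf// !abszN.
set T := m%:~R * (2 * pi * a) + n%:~R * (2 * pi * b); set psi := angle _ _.
have -> : m%:~R * (2 * pi * (a - p1%:~R / q%:~R)) + n%:~R * (2 * pi * (b - p2%:~R / q%:~R)) = T - psi.
  by rewrite /T /psi /angle intrD !intrM; ring.
have -> : (- m)%:~R * (2 * pi * a) + (- n)%:~R * (2 * pi * b) = - T by rewrite /T !mulrNz; ring.
by rewrite /cas cosB sinB cosN sinN; ring.
Qed.

Lemma invariant_lens_group q p1 p2 f :
  invariant_on_S3 (lens_group R q p1 p2) f <->
  forall x, S3 x -> f (lens_gen R q p1 p2 *m x) = f x.
Proof.
set g := lens_gen R q p1 p2; pose g' := lens_gen R q (- p1) (- p2).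
have gg' : g *m g' = 1%:M by exact: lens_gen_mulV.
split=> [h x Sx|h].
  by apply: h => //; exists 1.
have h' x : S3 x -> f (g' *m x) = f x.
  by move=> Sx; rewrite -h ?mulmxA ?gg' ?mul1mx//; exact: lens_gen_S3.
have pw (u : 'M[R]_4) k : (forall x, S3 x -> S3 (u *m x)) -> (forall x, S3 x -> f (u *m x) = f x) ->
    forall x, S3 x -> f ((u ^+ k) *m x) = f x.
  move=> uS uf; elim: k => [|k IH] x Sx; first by rewrite expr0 mul1mx.
  by rewrite exprSr -mulmxE -mulmxA IH ?uf//; exact: uS.
have ug : g \is a GRing.unit by have [] := mulmx1_unit gg'.
have gi : g^-1 = g' by rewrite -[LHS]mulr1 -[1]/(1%:M) -gg' mulmxE mulKr.
move=> _ x [k _ <-] Sx; case: k => k; first by apply: pw => // y; exact: lens_gen_S3.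
rewrite NegzE -exprz_inv gi; apply: pw => // y; exact: lens_gen_S3.
Qed.

Variables (q p1 p2 : int).
Hypothesis q0 : 0 < q.

Definition weight (t : int * int * nat) : int := t.1.1 * p1 + t.1.2 * p2.

Lemma basis_fun_lens_gen t x : S3 x -> basis_fun t (lens_gen R q p1 p2 *m x) =
  cos (angle q (weight t)) * basis_fun t x - sin (angle q (weight t)) * basis_fun (- t.1.1, - t.1.2, t.2) x.
Proof. by move=> Sx; rewrite /basis_fun /= !abszN eigf_lens_gen. Qed.

Lemma index_of_rev k (p : 'I_k.+1 * 'I_k.+1) (t := index_of p) :
  index_of (rev_ord p.1, rev_ord p.2) = (- t.1.1, - t.1.2, t.2).
Proof.
case: p @t => i j; rewrite /index_of /pair_index /=.
have := ltn_ord i; have := ltn_ord j; move: (val i) (val j) => {}i {}j ik jk.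
have e1 : (k.+1 - i.+1)%N%:Z + (k.+1 - j.+1)%N%:Z - k%:Z = - (i%:Z + j%:Z - k%:Z) by lia.
have e2 : (k.+1 - i.+1)%N%:Z - (k.+1 - j.+1)%N%:Z = - (i%:Z - j%:Z) by lia.
by rewrite e1 e2 !abszN.
Qed.

Definition lens_pred k (p : 'I_k.+1 * 'I_k.+1) : bool := (q %| weight (index_of p))%Z.

(** Invariance couples only the coefficients at [p] and at the opposite weight [rv p], and says that
    a rotation by [psi p] fixes this pair; unless the angle is trivial, the pair is 0. *)
Lemma invariant_coef k (a : 'I_k.+1 * 'I_k.+1 -> R) :
  (forall x, S3 x -> \sum_p a p * basis_fun (index_of p) (lens_gen R q p1 p2 *m x) =
     \sum_p a p * basis_fun (index_of p) x) ->
  forall p, ~~ lens_pred p -> a p = 0.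
Proof.
move=> h; pose rv (p : 'I_k.+1 * 'I_k.+1) := (rev_ord p.1, rev_ord p.2).
have rvK : involutive rv by case=> i j; rewrite /rv /= !rev_ordK.
pose b := @index_of k; have binj : injective b := @index_of_inj k.
pose psi p := angle q (weight (b p)) : R.
have psiN p : psi (rv p) = - psi p.
  have wN : weight (b (rv p)) = - weight (b p) by rewrite /b index_of_rev /weight /=; ring.
  by rewrite /psi wN /angle mulrNz; ring.
have E x : S3 x -> \sum_p (a p * (cos (psi p) - 1) + a (rv p) * sin (psi p)) * basis_fun (b p) x = 0.
  move=> Sx; have := h x Sx; rewrite -/b => /eqP; rewrite -subr_eq0 => /eqP; apply: etrans.
  have -> : \sum_p a p * basis_fun (index_of p) (lens_gen R q p1 p2 *m x) =
     \sum_p (a p * cos (psi p)) * basis_fun (b p) x + \sum_p (a (rv p) * sin (psi p)) * basis_fun (b p) x.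
    rewrite [X in _ + X](reindex_inj (inv_inj rvK)) -big_split /=; apply: eq_bigr => p _.
    rewrite basis_fun_lens_gen// -/(b p) rvK psiN sinN -/(psi p) /b index_of_rev -/(b p) /=; ring.
  by rewrite -big_split -sumrB /=; apply: eq_bigr => p _; ring.
have C p := basis_fun_independent binj E p.
move=> p np; have := C p; have := C (rv p); rewrite /= rvK psiN cosN sinN => e2 e1.
have c1 := @cos_angle_lt1 R q (weight (b p)) q0 np; rewrite -/(psi p) in c1.
have sc := sin2cos2 (psi p).
have : a p * (2 - 2 * cos (psi p)) = 0.
  transitivity ((a p * (cos (psi p) - 1) + a (rv p) * sin (psi p)) * (cos (psi p) - 1)
     - (a (rv p) * (cos (psi p) - 1) + a p * - sin (psi p)) * sin (psi p) ); last by rewrite e1 e2 !mul0r subrr.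
  have -> : a p * (2 - 2 * cos (psi p)) = a p * ((cos (psi p) - 1) ^+ 2 + sin (psi p) ^+ 2).
    by rewrite sc; ring.
  by ring.
move/eqP; rewrite mulf_eq0 => /orP[/eqP //|/eqP]; lra.
Qed.

Lemma lens_eigenspace_dim k : has_dim_on_S3
  (eigenspace_S3 (lens_group R q p1 p2) (sphere_eigenvalue k)) #|@lens_pred k|.
Proof.
pose b := @index_of k; have binj : injective b := @index_of_inj k.
exists (fun i => basis_fun (b (enum_val i))); split.
- move=> i; split; first exact: smooth_basis_fun.
    apply/invariant_lens_group => x Sx; rewrite basis_fun_lens_gen//.
    have [-> ->] := @cos_angle_dvd R q (weight (b (enum_val i))) q0 (enum_valP i).
    by rewrite mul1r mul0r subr0.
  move=> x Sx; rewrite basis_fun_eigen// index_degree_of//.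
- by move=> a /basis_fun_independent; apply => i j /binj/enum_val_inj.
- move=> f [sf /invariant_lens_group invf hf].
  have [a ha] := eigenspace_decomposition sf hf.
  have a0 : forall p, ~~ lens_pred p -> a p = 0.
    apply: invariant_coef => x Sx; rewrite -!ha ?invf//; exact: lens_gen_S3.
  exists (fun i => a (enum_val i)) => x Sx; rewrite ha//.
  rewrite (bigID (@lens_pred k)) /= [X in _ + X]big1 ?addr0 => [|p /a0 ->]; last by rewrite mul0r.
  by rewrite big_enum_val.
Qed.

Lemma lens_eigenspace_trivial (mu : R) : (forall k, sphere_eigenvalue k != mu) ->
  has_dim_on_S3 (eigenspace_S3 (lens_group R q p1 p2) mu) 0.
Proof.
move=> ne; exists (fun=> fun=> 0); split => [[]//|a _ []//|f [sf _ hf]].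
by exists (fun=> 0) => x Sx; rewrite big_ord0 (eigenvalue_trivial sf hf).
Qed.

End GroupInvariance.

(** * Listing levels with multiplicities in increasing order *)

Section Enumeration.
Context {R : realType}.

Definition partial_count (d : nat -> nat) (k : nat) := (\sum_(0 <= i < k) d i)%N.

Lemma partial_countS d k : partial_count d k.+1 = (partial_count d k + d k)%N.
Proof. by rewrite /partial_count big_nat_recr. Qed.

Lemma partial_count_le d j k : (j <= k)%N -> (partial_count d j <= partial_count d k)%N.
Proof.
move/subnK <-; elim: (k - j)%N => [//|i IH]; rewrite addSn partial_countS.
by rewrite (leq_trans IH) ?leq_addr.
Qed.

(** [kappa j] is the level at position [j] when level [k] is repeated [d k] times; empty levels are
    skipped, and unboundedness ensures that every position is filled. *)
Lemma enumeration_with_multiplicity d : (forall n, exists k, (n < partial_count d k)%N) ->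
  exists kappa : nat -> nat, forall j, (partial_count d (kappa j) <= j < partial_count d (kappa j).+1)%N.
Proof.
move=> unb; have h j : exists k, (partial_count d k <= j < partial_count d k.+1)%N.
  pose P k := (j < partial_count d k)%N.
  case: (ex_minnP (P := P) (unb j)) => -[|k]; rewrite /P; first by rewrite /partial_count big_geq.
  move=> jk mk; exists k; rewrite jk andbT leqNgt; apply/negP => /mk.
  by rewrite ltnn.
by have [kappa hk] := choice h; exists kappa.
Qed.

Variables (d kappa : nat -> nat).
Hypothesis kappaP : forall j, (partial_count d (kappa j) <= j < partial_count d (kappa j).+1)%N.

Lemma kappa_eq j k : (partial_count d k <= j < partial_count d k.+1)%N -> kappa j = k.
Proof.
move=> /andP[h1 h2]; have /andP[h3 h4] := kappaP j.
case: (ltngtP (kappa j) k) => // lt.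
- by have := partial_count_le d lt; lia.
- by have := partial_count_le d lt; lia.
Qed.

Lemma kappa_homo : {homo kappa : i j / (i <= j)%N}.
Proof.
move=> i j ij; rewrite leqNgt; apply/negP => lt.
have := partial_count_le d lt; have /andP[h1 h2] := kappaP i; have /andP[h3 h4] := kappaP j; lia.
Qed.

Lemma card_kappa k : ([set j | kappa j = k] #= `I_(d k))%card.
Proof.
have -> : [set j | kappa j = k] = (fun i => partial_count d k + i)%N @` `I_(d k).
  apply/seteqP; split => [j <- /=|_ [i /= id <-]]; last first.
    by apply: kappa_eq; rewrite leq_addr partial_countS ltn_add2l.
  have /andP[h1 h2] := kappaP j; exists (j - partial_count d (kappa j))%N; last by rewrite subnKC.
  by rewrite ltn_subLR// -partial_countS.
by apply: inj_card_eq => i j _ _ /addnI.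
Qed.

Lemma sum_kappa (u : nat -> R) k :
  \sum_(0 <= j < partial_count d k) u (kappa j) = \sum_(0 <= i < k) (d i)%:R * u i.
Proof.
elim: k => [|k IH]; first by rewrite /partial_count !big_geq.
rewrite (@big_cat_nat _ _ _ (partial_count d k))//= ?IH; last by rewrite partial_count_le.
rewrite big_nat_recr//=; congr (_ + _).
rewrite (eq_big_nat _ _ (F2 := fun=> u k)) => [|j hj]; last by rewrite (kappa_eq hj).
by rewrite sumr_const_nat partial_countS addKn mulr_natl.
Qed.

(** Terms being nonnegative, each partial sum is squeezed between sums over complete levels, which
    are partial sums of the grouped series. *)
Lemma cvg_series_kappa (u : nat -> R) (l : R) : (forall n, 0 <= u n) ->
  (forall n, exists k, (n < partial_count d k)%N) ->
  series (fun k => (d k)%:R * u k) @ \oo --> l ->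
  series (fun j => u (kappa j)) @ \oo --> l.
Proof.
move=> u0 unb hl.
have mono (m n : nat) : (m <= n)%N -> \sum_(0 <= j < m) u (kappa j) <= \sum_(0 <= j < n) u (kappa j).
  by move=> mn; rewrite (@big_cat_nat _ _ _ m 0 n)//= lerDl sumr_ge0.
have ndl : nondecreasing_seq (series (fun k => (d k)%:R * u k)).
  by apply/nondecreasing_seqP => k; rewrite seriesEnat /= big_nat_recr//= lerDl mulr_ge0.
have lel k : series (fun k => (d k)%:R * u k) k <= l.
  rewrite -(cvg_lim (@Rhausdorff R) hl); apply: nondecreasing_cvgn_le => //.
  exact: cvgP hl.
apply/cvgrPdist_le => e e0.
have [K _ hK] : \forall k \near \oo, `|l - series (fun k => (d k)%:R * u k) k| <= e.
  by move/cvgrPdist_le : hl; apply.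
exists (partial_count d K) => // n /= Kn.
have low : series (fun k => (d k)%:R * u k) K <= series (fun j => u (kappa j)) n.
  by rewrite !seriesEnat /= -sum_kappa; exact: mono.
have up : series (fun j => u (kappa j)) n <= l.
  have [k nk] := unb n; apply: le_trans (lel k).
  by rewrite !seriesEnat /= -sum_kappa; apply: mono; exact: ltnW.
have := hK K (leqnn _); rewrite !ger0_norm ?subr_ge0//; lra.
Qed.

End Enumeration.

(** * The heat trace of the quotient as a weighted Gaussian sum *)

Section LensHeatTrace.
Context {R : realType}.
Variables (q p1 p2 : int).
Hypothesis q0 : 0 < q.

(** The value 0 at [n = 0] makes the halved term of [hsum] vanish, so that [hsum] is the plain sum
    over [n >= 1]. *)
Definition lens_mult (n : nat) : nat := if n is k.+1 then #|@lens_pred q p1 p2 k| else 0%N.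

Lemma lens_mult_le n : (lens_mult n <= n ^ 2)%N.
Proof.
case: n => [//|k]; rewrite /lens_mult (leq_trans (max_card _))//.
by rewrite card_prod !card_ord mulnn.
Qed.

Lemma lens_mult_bounded : quad_bounded (1 : R) (fun n => (lens_mult n)%:R).
Proof.
move=> n; rewrite ger0_norm// mul1r -natrX ler_nat (leq_trans (lens_mult_le n))//.
by rewrite leq_exp2r.
Qed.

(** In each even degree the middle index has weight (0, 0) and gives an invariant function. *)
Lemma lens_mult_unbounded n : exists k, (n < partial_count (fun k => lens_mult k.+1) k)%N.
Proof.
elim: n => [|n [k nk]]; [exists 1%N|exists (2 * k).+1].
  rewrite /partial_count big_nat1; apply/card_gt0P; exists (ord0, ord0).
  by rewrite unfold_in /lens_pred /weight /pair_index /= !mul0r dvdz0.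
rewrite partial_countS; have := partial_count_le (fun k => lens_mult k.+1) (_ : k <= 2 * k)%N.
rewrite leq_pmull// => /(_ isT) h.
suff : (0 < lens_mult (2 * k).+1)%N by lia.
have kk : (k < (2 * k).+1)%N by rewrite ltnS leq_pmull.
apply/card_gt0P; exists (Ordinal kk, Ordinal kk).
rewrite unfold_in /lens_pred /weight /pair_index /=.
have -> : k%:Z + k%:Z - (2 * k)%N%:Z = 0 by lia.
by rewrite subrr !mul0r dvdz0.
Qed.

Lemma sphere_eigenvalue_le (j k : nat) :
  (sphere_eigenvalue j <= sphere_eigenvalue k :> R) = (j <= k)%N.
Proof. by rewrite ler_nat; apply/idP/idP => h; nia. Qed.

(** The heat trace is needed at all times, while the Gaussian bounds are for [tau <= 1]; a larger
    [tau] is dominated by 1. *)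
Lemma summable_lens_mult (tau : R) : 0 < tau ->
  summable (fun n => (lens_mult n)%:R * gauss tau n).
Proof.
move=> t0; pose s := Num.min tau 1.
have s01 : 0 < s <= 1 by rewrite /s lt_min t0 ltr01 ge_min lexx orbT.
have [B hB] := bounded_is_summable s01 lens_mult_bounded (gauss_exp_bounded s01).
exists B => n; apply: le_trans (hB n); rewrite !normrM ler_wpM2l// /gauss !ger0_norm ?expR_ge0//.
rewrite ler_expR lerN2 ler_pXn2r ?nnegrE ?mulr_ge0 ?(ltW t0)//; last by case/andP: s01 => /ltW.
by rewrite ler_wpM2r// /s ge_min lexx.
Qed.

Lemma lens_heat_trace : is_heat_trace (lens_group R q p1 p2)
  (fun t => expR t * hsum (fun n => (lens_mult n)%:R * gauss (Num.sqrt t) n)).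
Proof.
have [kappa hk] := enumeration_with_multiplicity lens_mult_unbounded.
exists (fun j => sphere_eigenvalue (kappa j)); split.
  split=> [i j ij|mu]; first by rewrite sphere_eigenvalue_le; exact: kappa_homo hk _ _ ij.
  have [[k kmu]|ne] := pselect (exists k, sphere_eigenvalue k = mu).
    exists (lens_mult k.+1); split; first by rewrite -kmu; exact: lens_eigenspace_dim.
    have -> : [set j | sphere_eigenvalue (kappa j) = mu] = [set j | kappa j = k].
      apply/seteqP; split => j /= h; last by rewrite h.
      by apply/eqP; rewrite eqn_leq -!sphere_eigenvalue_le h kmu lexx.
    exact: (card_kappa hk).
  exists 0%N; split; first by apply: lens_eigenspace_trivial => // k; apply/eqP => e; apply: ne; exists k.
  have -> : [set j | sphere_eigenvalue (kappa j) = mu] = set0.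
    by apply/seteqP; split => j //= e; apply: ne; exists (kappa j).
  by rewrite II0.
move=> t t0; have s0 : 0 < Num.sqrt t by rewrite sqrtr_gt0.
have cv := summable_cvg (summable_lens_mult s0).
pose u k := expR (- sphere_eigenvalue k * t) : R.
apply: (cvg_series_kappa hk (u := u)) => [n||]; [exact: expR_ge0|exact: lens_mult_unbounded|].
have -> : series (fun k => (lens_mult k.+1)%:R * u k) = (fun N =>
    expR t * series (half0 (fun n => (lens_mult n)%:R * gauss (Num.sqrt t) n)) N.+1).
  apply/funext => N; rewrite !seriesEnat /= big_nat_recl// [half0 _ 0%N]/= !mul0r add0r big_distrr /=.
  apply: eq_bigr => k _; rewrite mulrCA; congr (_ * _).
  rewrite /u /gauss -expRD exprMn sqr_sqrtr ?(ltW t0)//; congr (expR _).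
  by rewrite /sphere_eigenvalue natrM natrD -[k.+1%:R]natr1; ring.
apply: cvgMr; rewrite (cvg_shiftS (series _)); exact: cv.
Qed.

End LensHeatTrace.

(** * Characters of SO(4) as sequences satisfying a difference equation *)

Section CharacterSums.
Context {R : realType}.
Implicit Types (a b u v : R) (n N : nat).

(* character of the representation of SO(4) on harmonic polynomials of degree n-1 *)
Definition char_sum a b n : R := \sum_(i < n) \sum_(j < n)
  cos ((i%:R + j%:R + 1 - n%:R) * a + (i%:R - j%:R) * b).

(** Where [sin u] is nonzero this is sin(n u) / sin(u), the SU(2) character of dimension [n]; the
    sum is defined at every angle. *)
Definition cos_sum u n : R := \sum_(i < n) cos ((2 * i%:R + 1 - n%:R) * u).

Lemma sin_sum_eq0 u n : \sum_(i < n) sin ((2 * i%:R + 1 - n%:R) * u) = 0.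
Proof.
set S := \sum_(_ < _) _; suff : S = - S by move=> h; lra.
rewrite {1}/S (reindex_inj rev_ord_inj) -sumrN; apply: eq_bigr => i _.
rewrite -sinN; congr (sin _); rewrite /= natrB//; rewrite -[i.+1%:R]natr1; ring.
Qed.

(** Half sum and half difference are the angles in the double cover SU(2) x SU(2) of SO(4). The
    addition formula separates [i] from [j], and the sine sums vanish by oddness. *)
Lemma char_sumE a b n : char_sum a b n = cos_sum ((a + b) / 2) n * cos_sum ((a - b) / 2) n.
Proof.
rewrite /cos_sum; set u := (a + b) / 2; set v := (a - b) / 2.
transitivity (\sum_(i < n) \sum_(j < n)
   (cos ((2 * i%:R + 1 - n%:R) * u) * cos ((2 * j%:R + 1 - n%:R) * v)
    - sin ((2 * i%:R + 1 - n%:R) * u) * sin ((2 * j%:R + 1 - n%:R) * v))).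
  apply: eq_bigr => i _; apply: eq_bigr => j _; rewrite -cosD; congr (cos _).
  by rewrite /u /v; field.
rewrite big_distrl /=; apply: eq_bigr => i _; rewrite sumrB big_distrr /=.
by rewrite -[X in _ - X]big_distrr /= sin_sum_eq0 mulr0 subr0.
Qed.

Lemma cos_sum0 u : cos_sum u 0 = 0. Proof. by rewrite /cos_sum big_ord0. Qed.

Lemma cos_sum1 u : cos_sum u 1 = 1.
Proof. by rewrite /cos_sum big_ord1 mulr0 add0r subrr mul0r cos0. Qed.

Lemma cos_sum_rec u n : cos_sum u n.+2 = 2 * cos u * cos_sum u n.+1 - cos_sum u n.
Proof.
rewrite /cos_sum; apply/eqP; rewrite eq_sym subr_eq; apply/eqP.
have -> : 2 * cos u * \sum_(i < n.+1) cos ((2 * i%:R + 1 - n.+1%:R) * u) =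
   \sum_(i < n.+1) cos ((2 * i%:R + 1 - n.+2%:R) * u) + \sum_(i < n.+1) cos ((2 * i%:R + 1 - n%:R) * u).
  rewrite big_distrr -big_split /=; apply: eq_bigr => i _.
  set x := (2 * i%:R + 1 - n.+1%:R) * u.
  have -> : (2 * i%:R + 1 - n.+2%:R) * u = x - u by rewrite /x -[n.+2%:R]natr1; ring.
  have -> : (2 * i%:R + 1 - n%:R) * u = x + u by rewrite /x -[n.+1%:R]natr1; ring.
  by rewrite cosB cosD; ring.
rewrite [in RHS]big_ord_recr /= -addrA; congr (_ + _).
rewrite big_ord_recr /= addrC; congr (cos _ + _).
by rewrite -[n.+2%:R]natr1 -[n.+1%:R]natr1; ring.
Qed.

(** A product of solutions with roots exp(+-iu) and exp(+-iv) has roots exp(+-ia) and exp(+-ib), on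
    which - [dd] acts as [A] and [B]. Both factors are odd in [n], so the product is even, as the
    reflection in [dd] requires. *)
Lemma char_sum_dd a b n (X := char_sum a b) (A := 2 - 2 * cos a) (B := 2 - 2 * cos b) :
  dd (dd X) n + (A + B) * dd X n + A * B * X n = 0.
Proof.
pose U := cos_sum ((a + b) / 2); pose V := cos_sum ((a - b) / 2).
have XE m : X m = U m * V m by exact: char_sumE.
set c := cos ((a + b) / 2); set d := cos ((a - b) / 2).
have U2 m : U m.+2 = 2 * c * U m.+1 - U m by exact: cos_sum_rec.
have V2 m : V m.+2 = 2 * d * V m.+1 - V m by exact: cos_sum_rec.
have U0 : U 0%N = 0 by exact: cos_sum0.
have V0 : V 0%N = 0 by exact: cos_sum0.
have U1 : U 1%N = 1 by exact: cos_sum1.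
have V1 : V 1%N = 1 by exact: cos_sum1.
have [AB1 AB2] : A + B = 4 - 4 * c * d /\ A * B = 4 * (c - d) ^+ 2.
  have ea : a = (a + b) / 2 + (a - b) / 2 by field.
  have eb : b = (a + b) / 2 - (a - b) / 2 by field.
  rewrite /A /B [in cos a]ea [in cos b]eb cosB cosD -/c -/d.
  have s1 := sin2cos2 ((a + b) / 2); have s2 := sin2cos2 ((a - b) / 2).
  rewrite -/c in s1; rewrite -/d in s2; move: (sin _) (sin _) s1 s2 => s t s1 s2.
  split; first by ring.
  transitivity (4 * ((1 - c * d) ^+ 2 - s ^+ 2 * t ^+ 2)); first by ring.
  by rewrite s1 s2; ring.
rewrite AB1 AB2 {AB1 AB2}; clearbody U V c d; rewrite /dd.
case: n => [|[|n]] /=; rewrite !XE !U2 !V2 ?U1 ?V1 ?U0 ?V0; ring.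
Qed.

Lemma char_sum_bounded a b : quad_bounded 1 (char_sum a b).
Proof.
move=> n; rewrite mul1r /char_sum.
apply: (@le_trans _ _ (\sum_(i < n) \sum_(j < n) (1 : R))).
  rewrite (le_trans (ler_norm_sum _ _ _))// ler_sum// => i _.
  by rewrite (le_trans (ler_norm_sum _ _ _))// ler_sum// => j _; exact: cos_max.
by rewrite !sumr_const !card_ord -mulrnA -natrX ler_nat mulnn leq_exp2r.
Qed.

Lemma dd_lin a b (X Y : nat -> R) : dd (fun n => a * X n + b * Y n) = fun n => a * dd X n + b * dd Y n.
Proof. by apply/funext => n; rewrite /dd; ring. Qed.

Lemma dd_eq0 (X : nat -> R) : (forall n, dd X n = 0) -> forall n, X n = X 0%N.
Proof.
move=> h; have X1 : X 1%N = X 0%N by have := h 0%N; rewrite /dd /=; lra.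
suff H n : X n = X 0%N /\ X n.+1 = X 0%N by move=> n; case: (H n).
elim: n => [//|n [e1 e2]]; split => //; have := h n.+1; rewrite /dd /= e1 e2; lra.
Qed.

(** The equation reduces to [dd (dd X) = 0]. A sequence killed by the reflected [dd] is constant, so
    [dd X] is 2, and then [X] minus the squares is constant too. *)
Lemma char_sum_trivial a b : cos a = 1 -> cos b = 1 -> forall n, char_sum a b n = n%:R ^+ 2.
Proof.
move=> ca cb; pose X := char_sum a b.
have X0 : X 0%N = 0 by rewrite /X char_sumE !cos_sum0 mul0r.
have X1 : X 1%N = 1 by rewrite /X char_sumE !cos_sum1 mul1r.
have h n : dd (dd X) n = 0.
  by have := char_sum_dd a b n; rewrite /= ca cb mulr1 subrr addr0 !mul0r !addr0.
have Y2 n : dd X n = 2 by rewrite (dd_eq0 h) /dd /= X0 X1; ring.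
pose Z n := 1 * X n + (-1) * n%:R ^+ 2.
have Z0 n : dd Z n = 0.
  rewrite /Z dd_lin Y2 /dd; case: n => [|n] /=; first by ring.
  by rewrite -[n.+2%:R]natr1 -[n.+1%:R]natr1; ring.
move=> n; have := dd_eq0 Z0 n; rewrite /Z X0 -/X; rewrite expr0n /=; lra.
Qed.

(** With one factor of the equation degenerate, [dd] acts on [dd X] as [- C], so [X + C^-1 * dd X]
    is constant, equal to [2 / C] at 0. The second clause doubles the factor [dd + C] to fit the
    form of [oscillating_sum_decay]. *)
Lemma char_sum_half a b (C := 2 - 2 * cos a + (2 - 2 * cos b)) : cos a = 1 \/ cos b = 1 -> 0 < C ->
  (forall n, char_sum a b n = 2 / C + - C^-1 * dd (char_sum a b) n) /\
  (forall n, dd (dd (dd (char_sum a b))) n + (C + C) * dd (dd (char_sum a b)) n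
     + C * C * dd (char_sum a b) n = 0).
Proof.
move=> h C0; set X := char_sum a b; have Cn : C != 0 by rewrite gt_eqF.
have rec : dd (dd X) = fun n => - C * dd X n + 0 * dd X n.
  apply/funext => n; have := char_sum_dd a b n; rewrite /= -/X -/C.
  have -> : (2 - 2 * cos a) * (2 - 2 * cos b) = 0 by case: h => ->; rewrite mulr1 subrr ?mul0r ?mulr0.
  by rewrite !mul0r !addr0 => /eqP; rewrite addr_eq0 => /eqP ->; ring.
split=> n; last by rewrite rec dd_lin rec; ring.
pose Z n := 1 * X n + C^-1 * dd X n.
have Z0 m : dd Z m = 0 by rewrite /Z dd_lin rec; field.
have X00 : X 0%N = 0 by rewrite /X char_sumE !cos_sum0 mul0r.
have dX0 : dd X 0%N = 2 by rewrite /dd /= X00 /X char_sumE !cos_sum1; ring.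
have := dd_eq0 Z0 n; rewrite /Z X00 dX0 !mul1r add0r => h'.
by rewrite mulNr [2 / C]mulrC -h' addrK.
Qed.

End CharacterSums.

(** * Asymptotics of the weighted sum of the multiplicities *)

Section CountingAsymptotics.
Context {R : realType}.
Implicit Types (tau a b : R) (n N : nat) (q p m : int).

Lemma rapid_decay_eq (f g : R -> R) : (forall tau, 0 < tau <= 1 -> f tau = g tau) ->
  rapid_decay f -> rapid_decay g.
Proof. by move=> fg h M; have [D hD] := h M; exists D => tau t; rewrite -fg// hD. Qed.

Lemma rapid_decay_lin (c d : R) (f g : R -> R) : rapid_decay f -> rapid_decay g ->
  rapid_decay (fun tau => c * f tau + d * g tau).
Proof.
move=> hf hg M; have [D hD] := hf M; have [E hE] := hg M.
exists (`|c| * D + `|d| * E) => tau t; rewrite (le_trans (ler_normD _ _))// !normrM mulrDl -!mulrA.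
by rewrite lerD// ler_wpM2l// ?hD ?hE.
Qed.

Lemma rapid_decay0 : rapid_decay (fun=> 0 : R).
Proof. by move=> M; exists 0 => tau _; rewrite mul0r normr0. Qed.

Lemma rapid_decay_sum (I : Type) (s : seq I) (F : I -> R -> R) :
  (forall i, rapid_decay (F i)) -> rapid_decay (fun tau => \sum_(i <- s) F i tau).
Proof.
move=> hF; elim: s => [|i s IH].
  by apply: rapid_decay_eq rapid_decay0 => tau _; rewrite big_nil.
by apply: rapid_decay_eq (rapid_decay_lin 1 1 (hF i) IH) => tau _; rewrite big_cons !mul1r.
Qed.

(* With 1 / 0 = 0: this is 1 / (1 - cos b) if only cos a is 1, 1 / (1 - cos a)
   if only cos b is 1, and 0 in the other cases. *)
Definition half_trivial_weight a b : R :=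
  (if cos a == 1 then (1 - cos b)^-1 else 0) + (if cos b == 1 then (1 - cos a)^-1 else 0).

Lemma summable_gauss X (K tau : R) : quad_bounded K X -> 0 < tau <= 1 ->
  summable (fun n => X n * gauss tau n).
Proof. by move=> XK t; exact: bounded_is_summable t XK (gauss_exp_bounded t). Qed.

Lemma cos_le1 a : cos a <= 1.
Proof. by have := cos_max a; rewrite ler_norml => /andP[]. Qed.

Lemma char_sum_half_decay a b (C := 2 - 2 * cos a + (2 - 2 * cos b)) :
  cos a = 1 \/ cos b = 1 -> 0 < C -> rapid_decay (fun tau =>
  hsum (fun n => char_sum a b n * gauss tau n) - 2 / C * hsum (gauss tau)).
Proof.
move=> ab C0; have [E rec] := char_sum_half ab C0; rewrite -/C in E rec.
have Xb := quad_bounded_dd (char_sum_bounded a b).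
move=> M; have [D hD] := oscillating_sum_decay Xb C0 C0 rec M.
exists (C^-1 * D) => tau t.
have s1 : summable (gauss tau) by have := summable_gauss (@quad_bounded1 R) t; under eq_fun do rewrite mul1r.
have -> : hsum (fun n => char_sum a b n * gauss tau n) =
   2 / C * hsum (gauss tau) + - C^-1 * hsum (fun n => dd (char_sum a b) n * gauss tau n).
  rewrite -(hsum_lin _ _ s1 (summable_gauss Xb t)).
  by apply: eq_hsum => n; rewrite [in LHS]E; ring.
have Ci : 0 <= C^-1 by rewrite invr_ge0 ltW.
by rewrite addrC addKr normrM normrN (ger0_norm Ci) -[leRHS]mulrA ler_wpM2l// hD.
Qed.

Lemma char_sum_asymptotics a b : rapid_decay (fun tau =>
  hsum (fun n => char_sum a b n * gauss tau n)
  - ((cos a == 1) && (cos b == 1))%:R * hsum (fun n => n%:R ^+ 2 * gauss tau n)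
  - half_trivial_weight a b * hsum (gauss tau)).
Proof.
rewrite /half_trivial_weight.
have [ca|ca] := eqVneq (cos a) 1; have [cb|cb] := eqVneq (cos b) 1.
- rewrite ca cb subrr invr0 addr0; apply: rapid_decay_eq rapid_decay0 => tau t.
  rewrite mul0r subr0 mul1r; apply/esym/eqP; rewrite subr_eq0; apply/eqP/eq_hsum => n.
  by rewrite char_sum_trivial.
- have b0 : 0 < 1 - cos b by rewrite subr_gt0 lt_neqAle cb cos_le1.
  have C0 : 0 < 2 - 2 * cos a + (2 - 2 * cos b) by rewrite ca; lra.
  apply: rapid_decay_eq (char_sum_half_decay (or_introl ca) C0) => tau _; rewrite mul0r subr0 addr0.
  by congr (_ - _ * _); rewrite ca; field; rewrite (gt_eqF b0) gt_eqF//; lra.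
- have a0 : 0 < 1 - cos a by rewrite subr_gt0 lt_neqAle ca cos_le1.
  have C0 : 0 < 2 - 2 * cos a + (2 - 2 * cos b) by rewrite cb; lra.
  apply: rapid_decay_eq (char_sum_half_decay (or_intror cb) C0) => tau _; rewrite mul0r subr0 add0r.
  by congr (_ - _ * _); rewrite cb; field; rewrite (gt_eqF a0) gt_eqF//; lra.
have a0 : 0 < 2 - 2 * cos a by have := cos_le1 a; rewrite le_eqVlt (negPf ca) /=; lra.
have b0 : 0 < 2 - 2 * cos b by have := cos_le1 b; rewrite le_eqVlt (negPf cb) /=; lra.
move=> M; have [D hD] := oscillating_sum_decay (char_sum_bounded a b) a0 b0 (char_sum_dd a b) M.
by exists D => tau t; rewrite addr0 !mul0r !subr0 hD.
Qed.

Lemma cos_angle_eq1 q m : 0 < q -> (cos (angle q m) == 1 :> R) = (q %| m)%Z.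
Proof.
move=> q0; apply/idP/idP => [|/(cos_angle_dvd (R := R) q0)[-> _]//].
by apply: contraTT => /(cos_angle_lt1 (R := R) q0)/lt_eqF ->.
Qed.

Lemma lens_mult_char N p1 p2 n : (0 < N)%N -> N%:R * (lens_mult N p1 p2 n)%:R =
  \sum_(0 <= r < N) char_sum (r%:R * angle N p1) (r%:R * angle N p2) n :> R.
Proof.
move=> N0; case: n => [|k].
  by rewrite mulr0 big1// => r _; rewrite /char_sum big_ord0.
rewrite /lens_mult -sum1_card natr_sum big_distrr /= big_mkcond.
rewrite /char_sum exchange_big /=.
under [RHS]eq_bigr do rewrite exchange_big /=.
rewrite pair_big /=; apply: eq_bigr => -[i j] _ /=.
transitivity (\sum_(0 <= r < N) cos (r%:R * angle N (weight p1 p2 (pair_index k i j))) : R).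
  by rewrite (sum_angle _ N0).1 unfold_in /lens_pred mulr1.
apply: eq_bigr => r _; congr (cos _); rewrite /weight /pair_index /= angleD /angle !intrM !intrD !mulrNz.
have -> : k.+1%:R = k%:~R + 1 :> R by rewrite -natr1.
rewrite !pmulrn; ring.
Qed.

Lemma sum_multiples (V : nmodType) (F : nat -> V) (c e : nat) : (0 < c)%N ->
  \sum_(0 <= r < e * c | (c %| r)%N) F r = \sum_(0 <= m < e) F (m * c)%N.
Proof.
move=> c0; elim: e => [|e IH]; first by rewrite !big_geq.
rewrite (@big_cat_nat _ _ _ (e * c))//=; last by rewrite leq_mul2r leqnSn orbT.
rewrite IH big_nat_recr//=; congr (_ + _).
rewrite mulSn -{1}[(e * c)%N]add0n big_addn addnK -(prednK c0).
rewrite big_mkcond big_nat_recl//= add0n prednK// dvdn_mull//.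
rewrite big_nat_cond big1 ?addr0// => i /andP[/andP[_ ic] _].
rewrite addnC dvdn_addr ?dvdn_mull//; case: ifP => // /dvdn_leq h; exfalso; lia.
Qed.

(** Multiplication by [u] permutes the residues modulo [e], and [G] depends only on the residue. *)
Lemma sum_coprime_permutation (G : int -> R) (e : nat) (u : int) : (0 < e)%N ->
  (forall m z : int, G (m + z * e%:Z) = G m) -> coprimez u e ->
  \sum_(0 <= m < e) G (m%:Z * u) = \sum_(0 <= m < e) G m%:Z.
Proof.
move=> e0 per cu; have ez : (e%:Z != 0) by rewrite eqz_nat -lt0n.
have hb (m : 'I_e) : (absz ((m%:Z * u) %% e)%Z < e)%N.
  by rewrite -ltz_nat gez0_abs ?modz_ge0// ltz_pmod.
pose h (m : 'I_e) := Ordinal (hb m).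
have hinj : injective h.
  move=> m m' /(congr1 (fun i : 'I_e => (i : nat)%:Z)) /=.
  rewrite !gez0_abs ?modz_ge0// => /eqP; rewrite eqz_mod_dvd -mulrBl Gauss_dvdzl 1?coprimez_sym//.
  move=> d; apply/val_inj => /=; have := ltn_ord m; have := ltn_ord m'.
  case/dvdzP: d => z hz l1 l2; have : z = 0 by nia.
  by move=> z0; move: hz; rewrite z0 mul0r; lia.
rewrite !big_mkord [RHS](reindex_inj hinj); apply: eq_bigr => m _ /=.
by rewrite gez0_abs ?modz_ge0// [in LHS](divz_eq (m%:Z * u) e) addrC per.
Qed.

(* the term of index 0 is 1 / 0 = 0 *)
Definition cyclic_weight (e : nat) : R := \sum_(0 <= m < e) (1 - cos (angle e m%:Z))^-1.

(** With [e] the gcd of [p] and [N], and [c = N / e], the first cosine is 1 exactly for [r = m * c],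
    and the second angle is then 2 pi m p' / e. The gcd hypothesis makes [p'] prime to [e], so a
    permutation of the residues removes it: here all dependence on [p'] disappears. *)
Lemma half_trivial_sum N p p' : (0 < N)%N -> gcdz (gcdz p p') N = 1 ->
  \sum_(0 <= r < N) (if cos (r%:R * angle N p) == 1 :> R then (1 - cos (r%:R * angle N p'))^-1 else 0)
  = cyclic_weight (gcdn `|p| N).
Proof.
move=> N0 g1; have q0 : 0 < N%:Z by [].
set e := gcdn _ _; pose c := (N %/ e)%N.
have e0 : (0 < e)%N by rewrite gcdn_gt0 N0 orbT.
have eN : (e * c)%N = N by rewrite /c mulnC divnK// dvdn_gcdr.
have c0 : (0 < c)%N by rewrite -(ltn_pmul2l e0) muln0 eN.
have dE (r : nat) : (N %| r%:Z * p)%Z = (c %| r)%N.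
  have [u pE] : exists u : nat, `|p|%N = (u * e)%N by apply/dvdnP; exact: dvdn_gcdl.
  have cop : coprime c u.
    rewrite /coprime -(eqn_pmul2l e0) muln_gcdr eN [(e * u)%N]mulnC -pE muln1 gcdnC; exact/eqP.
  by rewrite -[N in LHS]eN dvdzE abszM pE mulnA [(e * c)%N]mulnC dvdn_pmul2r// Gauss_dvdl.
rewrite -{1}eN; under eq_bigr do rewrite angleMl cos_angle_eq1// dE.
rewrite -big_mkcond /= sum_multiples//.
have cop' : coprimez p' e.
  have h : (gcdz p' e %| e%:Z)%Z by exact: dvdz_gcdr.
  suff : (gcdz p' e %| gcdz (gcdz p p') N)%Z by rewrite g1 dvdz1.
  by rewrite !dvdz_gcd dvdz_gcdl !(dvdz_trans h)// dvdzE; [exact: dvdn_gcdr|exact: dvdn_gcdl].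
have per (m z : int) : (1 - cos (angle e (m + z * e%:Z)))^-1 = (1 - cos (angle e m))^-1 :> R.
  by rewrite angle_period// cos_int_period.
apply: etrans (sum_coprime_permutation e0 per cop').
apply: eq_bigr => m _; congr ((1 - cos _)^-1).
rewrite angleMl /angle -eN !intrM PoszM !intrM; clearbody c e; field.
by rewrite !pnatr_eq0 -!lt0n e0.
Qed.

(** If both angles are trivial, [N] divides r p, r p' and r N, hence [r]; only [r = 0]
    contributes. *)
Lemma sum_both_trivial N p p' : (0 < N)%N -> gcdz (gcdz p p') N = 1 ->
  \sum_(0 <= r < N) ((cos (r%:R * angle N p) == 1 :> R) && (cos (r%:R * angle N p') == 1 :> R))%:R = 1 :> R.
Proof.
case: N => [//|N] _ g1; have q0 : 0 < N.+1%:Z by [].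
rewrite big_nat_recl// !mul0r !cos0 !eqxx big_nat_cond big1 ?addr0// => r /andP[/andP[_ rN] _].
rewrite !angleMl !cos_angle_eq1//; case: andP => // -[h1 h2].
have : (N.+1%:Z %| r.+1%:Z)%Z.
  rewrite -[r.+1%:Z]mulr1 -g1.
  have -> : (r.+1%:Z * gcdz (gcdz p p') N.+1) = gcdz (gcdz (r.+1%:Z * p) (r.+1%:Z * p')) (r.+1%:Z * N.+1).
    by rewrite -!mulz_gcdr.
  by rewrite !dvdz_gcd h1 h2 dvdz_mull.
by rewrite dvdzE => /dvdn_leq => /(_ isT) /=; lia.
Qed.

Lemma hsum_sum (I : Type) (s : seq I) (X : I -> nat -> R) tau : 0 < tau <= 1 ->
  (forall i, quad_bounded 1 (X i)) ->
  \sum_(i <- s) hsum (fun n => X i n * gauss tau n) =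
  hsum (fun n => (\sum_(i <- s) X i n) * gauss tau n).
Proof.
move=> t X1; elim: s => [|i s IH].
  have s1 := summable_gauss (@quad_bounded1 R) t.
  have [_ E] := hsumZ 0 s1; rewrite mul0r in E; rewrite big_nil -[LHS]E.
  by apply: eq_hsum => n; rewrite big_nil !mul0r.
have bs : quad_bounded (size s)%:R (fun n => \sum_(i <- s) X i n).
  move=> n; rewrite (le_trans (ler_norm_sum _ _ _))//.
  apply: (@le_trans _ _ (\sum_(i <- s) 1 * n.+1%:R ^+ 2)); first by apply: ler_sum => k _; exact: X1.
  by rewrite big_const_seq count_predT iter_addr_0 mul1r mulr_natl.
rewrite big_cons IH -[X in X + _]mul1r -[X in _ + X]mul1r.
rewrite -hsum_lin; [|exact: summable_gauss (X1 i) t|exact: summable_gauss bs t].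
by apply: eq_hsum => n; rewrite big_cons; ring.
Qed.

Lemma lens_mult_asymptotics N p1 p2 : (0 < N)%N -> gcdz (gcdz p1 p2) N = 1 ->
  rapid_decay (fun tau => N%:R * hsum (fun n => (lens_mult N p1 p2 n)%:R * gauss tau n)
    - hsum (fun n => n%:R ^+ 2 * gauss tau n)
    - (cyclic_weight (gcdn `|p1| N) + cyclic_weight (gcdn `|p2| N)) * hsum (gauss tau)).
Proof.
move=> N0 g1.
have := rapid_decay_sum (index_iota 0 N)
  (fun r : nat => char_sum_asymptotics (r%:R * angle N p1) (r%:R * angle N p2)).
apply: rapid_decay_eq => tau t; rewrite !sumrB -!big_distrl /= sum_both_trivial// mul1r.
rewrite /half_trivial_weight big_split /= half_trivial_sum// half_trivial_sum//; last by rewrite [gcdz p2 _]gcdzC.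
congr (_ - _ - _).
rewrite (@hsum_sum nat (index_iota 0 N) (fun r => char_sum (r%:R * angle N p1) (r%:R * angle N p2)))//; last first.
  by move=> r; exact: char_sum_bounded.
rewrite -(hsumZ _ (summable_gauss (@lens_mult_bounded R N p1 p2) t)).2.
by apply: eq_hsum => n; rewrite mulrA lens_mult_char.
Qed.

End CountingAsymptotics.

(** * From the theta asymptotics to the heat expansion in powers of the square root of t *)

Section HeatExpansion.
Context {R : realType}.
Implicit Types (tau x : R) (n k N : nat).

(** Each term of index [i >= k] is at most x^k / i!, and the inverse factorials sum to at most
    [expR 1]. *)
Lemma expR_taylor k x : 0 <= x <= 1 ->
  `|expR x - \sum_(0 <= i < k) x ^+ i / i`!%:R| <= expR 1 * x ^+ k.
Proof.
move=> /andP[x0 x1]; set S := \sum_(_ <= _ < _) _.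
have nd y n : 0 <= y -> series (exp_coeff y) n <= expR y :> R.
  move=> y0; apply: nondecreasing_cvgn_le; last exact: is_cvg_series_exp_coeff.
  apply/nondecreasing_seqP => m; rewrite seriesEnat /= big_nat_recr//= lerDl.
  by rewrite /exp_coeff /= divr_ge0// exprn_ge0.
rewrite ger0_norm ?subr_ge0; last by have := nd x k x0; rewrite seriesEnat.
rewrite lerBlDl; apply: limr_le; first exact: is_cvg_series_exp_coeff.
exists k => // n /= kn; rewrite seriesEnat /= (@big_cat_nat _ _ _ k)//= lerD2l.
apply: (@le_trans _ _ (x ^+ k * \sum_(k <= i < n) exp_coeff 1 i)).
  rewrite big_distrr /=; apply: ler_sum_nat => i /andP[ki _]; rewrite /exp_coeff /= expr1n mulrA mulr1.
  rewrite ler_pM2r ?invr_gt0 ?ltr0n ?fact_gt0//; exact: ler_wiXn2l.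
rewrite mulrC ler_wpM2r ?exprn_ge0//; apply: le_trans (nd 1 n ler01).
rewrite seriesEnat /= [leRHS](@big_cat_nat _ _ _ k)//= lerDr sumr_ge0// => i _.
by rewrite /exp_coeff /= expr1n divr_ge0.
Qed.

(** Power series coefficients of [expR (tau ^+ 2)] in [tau]. *)
Definition exp_sq_coef n : R := if odd n then 0 else (n./2`!%:R)^-1.

Lemma sum_exp_sq_coef n tau : \sum_(j < n) exp_sq_coef j * tau ^+ j =
  \sum_(0 <= i < uphalf n) (tau ^+ 2) ^+ i / i`!%:R.
Proof.
elim: n => [|n IH]; first by rewrite big_ord0 big_geq.
rewrite big_ord_recr /= IH {IH} /exp_sq_coef uphalf_half.
have := odd_double_half n; case: (odd n) => /= e.
  by rewrite mul0r addr0.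
rewrite big_nat_recr//= mulrC; congr (_ + _ * _); rewrite -exprM.
by rewrite -[in LHS]e add0n -mul2n.
Qed.

Lemma exp_sq_taylor n tau : 0 < tau <= 1 ->
  `|expR (tau ^+ 2) - \sum_(j < n) exp_sq_coef j * tau ^+ j| <= expR 1 * tau ^+ n.
Proof.
move=> /andP[t0 t1]; rewrite sum_exp_sq_coef.
have x01 : 0 <= tau ^+ 2 <= 1 by rewrite sqr_ge0 exprn_ile1// ltW.
apply: le_trans (expR_taylor _ x01) _; rewrite ler_wpM2l ?expR_ge0// -exprM.
apply: ler_wiXn2l; rewrite ?(ltW t0)//.
by rewrite mul2n uphalf_half doubleD -{1}[n]odd_double_half leq_add2r; case: (odd n).
Qed.

(** Power series coefficients of [expR (tau ^+ 2) * (b0 + b2 * tau ^+ 2)] in [tau]. *)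
Definition heat_coef (b0 b2 : R) n : R :=
  b0 * exp_sq_coef n + (if n is m.+2 then b2 * exp_sq_coef m else 0).

Lemma heat_sum (H : R -> R) (b0 b2 : R) N :
  rapid_decay (fun tau => tau ^+ 3 * H tau - b0 - b2 * tau ^+ 2) ->
  exists D : R, forall tau, 0 < tau <= 1 ->
  `|expR (tau ^+ 2) * (tau ^+ 3 * H tau) - \sum_(j < N.+1) heat_coef b0 b2 j * tau ^+ j|
    <= D * tau ^+ N.+1.
Proof.
move=> hH; have [D hD] := hH N.+1.
exists (expR 1 * D + `|b0| * expR 1 + `|b2| * expR 1) => tau t.
have [t0 t1] := andP t; have tn m : 0 <= tau ^+ m by rewrite exprn_ge0// ltW.
(* The part multiplied by [tau ^+ 2] is truncated two orders earlier, whence [N.-1]. *)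
have split_sum : \sum_(j < N.+1) heat_coef b0 b2 j * tau ^+ j =
    b0 * \sum_(j < N.+1) exp_sq_coef j * tau ^+ j
    + b2 * tau ^+ 2 * \sum_(j < N.-1) exp_sq_coef j * tau ^+ j.
  case: N {hD} => [|N]; first by rewrite !big_ord1 big_ord0 /heat_coef /=; ring.
  rewrite !big_distrr /= [X in _ = _ + X](_ : _ = \sum_(j < N.+2)
     (if (j : nat) is m.+2 then b2 * exp_sq_coef m else 0) * tau ^+ j); last first.
    rewrite 2!big_ord_recl /= !mul0r !add0r; apply: eq_bigr => j _.
    by rewrite /= add0n -[bump 0 (bump 0 j)]/(2 + j)%N exprD; ring.
  by rewrite -big_split; apply: eq_bigr => j _; rewrite /heat_coef mulrDl mulrA.
rewrite split_sum; set S0 := \sum_(j < N.+1) _; set S2 := \sum_(j < N.-1) _.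
have E0 : `|expR (tau ^+ 2) - S0| <= expR 1 * tau ^+ N.+1 by exact: exp_sq_taylor.
have E2 : `|tau ^+ 2 * (expR (tau ^+ 2) - S2)| <= expR 1 * tau ^+ N.+1.
  rewrite normrM ger0_norm//; apply: le_trans (ler_wpM2l (tn 2) (@exp_sq_taylor N.-1 tau t)) _.
  rewrite mulrCA ler_wpM2l ?expR_ge0// -exprD; apply: ler_wiXn2l; rewrite ?(ltW t0)//; lia.
have EH := hD tau t.
have -> : expR (tau ^+ 2) * (tau ^+ 3 * H tau) - (b0 * S0 + b2 * tau ^+ 2 * S2) =
   expR (tau ^+ 2) * (tau ^+ 3 * H tau - b0 - b2 * tau ^+ 2) + b0 * (expR (tau ^+ 2) - S0)
   + b2 * (tau ^+ 2 * (expR (tau ^+ 2) - S2)) by ring.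
rewrite (le_trans (ler_normD _ _))// !mulrDl lerD//; last first.
  by rewrite normrM -[leRHS]mulrA ler_wpM2l.
rewrite (le_trans (ler_normD _ _))// lerD//; last by rewrite normrM -[leRHS]mulrA ler_wpM2l.
rewrite normrM -[leRHS]mulrA ler_pM// ger0_norm ?expR_ge0// ler_expR exprn_ile1// ltW//.
Qed.

(** The constant (4 pi)^(3/2) cancels the normalization of the expansion, and the remainder
    [D * tau ^+ N.+1] has one power of [tau] to spare, which makes it a little o. *)
Lemma heat_asymptotics_of_sum (H : R -> R) (b0 b2 : R) :
  rapid_decay (fun tau => tau ^+ 3 * H tau - b0 - b2 * tau ^+ 2) ->
  heat_asymptotics 3 (fun t => expR t * H (Num.sqrt t))
    (fun j => (4 * pi) `^ (3 / 2) * heat_coef b0 b2 j).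
Proof.
move=> hH N; have [D hD] := heat_sum N hH.
have D0 : 0 <= D by have := hD 1; rewrite ltr01 lexx => /(_ isT) /(le_trans (normr_ge0 _)); rewrite expr1n mulr1.
apply/eqoP => e e0.
have D1 : 0 < D + 1 by rewrite ltr_wpDl.
near=> t.
have t0 : 0 < t by near: t; exact: nbhs_right_gt.
have te : t <= (e / (D + 1)) ^+ 2.
  by near: t; apply: nbhs_right_le; rewrite exprn_gt0// divr_gt0.
have t1 : t <= 1 by near: t; exact: nbhs_right_le.
pose tau := Num.sqrt t.
have tau0 : 0 < tau by rewrite sqrtr_gt0.
have tE : t = tau ^+ 2 by rewrite sqr_sqrtr// ltW.
have tau1 : tau <= 1 by rewrite -(@ler_pXn2r _ 2) ?nnegrE ?(ltW tau0)// -tE expr1n.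
have tn : tau != 0 by rewrite gt_eqF.
have taue : tau <= e / (D + 1).
  by rewrite -(@ler_pXn2r _ 2) ?nnegrE ?(ltW tau0) ?divr_ge0 ?(ltW e0) ?(ltW D1)// -tE.
have pw (x : R) : t `^ (x / 2) = tau `^ x.
  by rewrite tE -powR_mulrn ?(ltW tau0)// -powRrM mulrCA divff// mulr1.
have P0 : 0 < (4 * pi) `^ (3 / 2) :> R by rewrite powR_gt0// mulr_gt0// pi_gt0.
have -> : (4 * pi * t) `^ (- (3%:R / 2)) = ((4 * pi) `^ (3 / 2))^-1 * (tau ^+ 3)^-1.
  rewrite powRM ?mulr_ge0 ?pi_ge0 ?(ltW t0)// powRN; congr (_ * _).
  by rewrite powRN pw powR_mulrn ?(ltW tau0).
have -> : \sum_(j < N.+1) (4 * pi) `^ (3 / 2) * heat_coef b0 b2 j * t `^ (j%:R / 2) =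
   (4 * pi) `^ (3 / 2) * \sum_(j < N.+1) heat_coef b0 b2 j * tau ^+ j.
  by rewrite big_distrr /=; apply: eq_bigr => j _; rewrite pw powR_mulrn ?(ltW tau0)// mulrA.
have -> : t `^ ((N%:R - 3%:R) / 2) = tau ^+ N / tau ^+ 3.
  by rewrite pw powRB ?tn ?implybT// !powR_mulrn// ltW.
have := hD tau; rewrite tau0 tau1 => /(_ isT); rewrite -tE -/tau.
set S := \sum_(_ < _) _ => hS.
have -> : expR t * H tau - ((4 * pi) `^ (3 / 2))^-1 * (tau ^+ 3)^-1 * ((4 * pi) `^ (3 / 2) * S)
   = (expR t * (tau ^+ 3 * H tau) - S) / tau ^+ 3.
  by field; rewrite tn gt_eqF.
have i3 : 0 < (tau ^+ 3)^-1 by rewrite invr_gt0 exprn_gt0.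
rewrite normrM [X in _ * X]gtr0_norm// [X in e * X]gtr0_norm ?mulr_gt0 ?exprn_gt0//.
rewrite [leRHS]mulrA ler_pM2r//; apply: le_trans hS _.
rewrite exprSr mulrCA mulrC ler_wpM2r ?exprn_ge0 ?(ltW tau0)//.
apply: le_trans (ler_wpM2l D0 taue) _.
rewrite mulrA ler_pdivrMr// mulrC ler_wpM2l ?(ltW e0)//; lra.
Unshelve. all: by end_near.
Qed.

(** After multiplication by [tau ^+ 3] the sum with n^2 contributes [C2] and the plain one
    [C0 * tau ^+ 2]. The constants and [w] are parameters so that two groups can be given literally
    the same coefficient sequence. *)
Lemma lens_heat_expansion (w C0 C2 : R) (N : nat) (p1 p2 : int) : (0 < N)%N ->
  gcdz (gcdz p1 p2) N = 1 ->
  w = cyclic_weight (gcdn `|p1| N) + cyclic_weight (gcdn `|p2| N) ->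
  rapid_decay (fun tau => tau * hsum (gauss tau) - C0) ->
  rapid_decay (fun tau => tau ^+ 3 * hsum (fun n => n%:R ^+ 2 * gauss tau n) - C2) ->
  has_heat_expansion (lens_group R N p1 p2)
    (fun j => (4 * pi) `^ (3 / 2) * heat_coef (C2 / N%:R) (w * C0 / N%:R) j).
Proof.
move=> N0 g1 wE h0 h2; have Nn : N%:R != 0 :> R by rewrite pnatr_eq0 -lt0n.
eexists; split; first by apply: lens_heat_trace.
apply: (@heat_asymptotics_of_sum (fun tau => hsum (fun n => (lens_mult N p1 p2 n)%:R * gauss tau n))) => M.
have := @lens_mult_asymptotics R N p1 p2 N0 g1; rewrite -wE => h.
have [D hD] := h M; have [D0 hD0] := h0 M; have [D2 hD2] := h2 M.
exists ((D + D2 + `|w| * D0) / N%:R) => tau t; have [t0 t1] := andP t.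
have i0 : 0 < N%:R^-1 :> R by rewrite invr_gt0 ltr0n.
have := hD tau t; have := hD0 tau t; have := hD2 tau t.
set L := hsum (fun n => (lens_mult N p1 p2 n)%:R * _); set T2 := hsum (fun n => _ ^+ 2 * _).
set T0 := hsum _ => e2 e0 e.
have -> : tau ^+ 3 * L - C2 / N%:R - w * C0 / N%:R * tau ^+ 2 =
   (tau ^+ 3 * (N%:R * L - T2 - w * T0) + (tau ^+ 3 * T2 - C2) + w * (tau ^+ 2 * (tau * T0 - C0))) / N%:R.
  by field.
rewrite normrM (gtr0_norm i0) [leRHS]mulrAC ler_pM2r// !mulrDl.
have small (y z : R) m : `|y| <= z -> `|tau ^+ m * y| <= z.
  move=> yz; apply: le_trans yz; rewrite normrM ler_piMl// ger0_norm ?exprn_ge0 ?exprn_ile1// ltW//.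
rewrite (le_trans (ler_normD _ _))// lerD//.
  by rewrite (le_trans (ler_normD _ _))// lerD//; exact: small.
by rewrite normrM -[leRHS]mulrA ler_wpM2l//; exact: small.
Qed.

End HeatExpansion.

(** * Arithmetic of the parameters and comparison of the two quotients *)

(** Cancelling [g] in [a1 * q1 = a2 * q2] leaves [b1 * q1 = b2 * q2]. Both pairs are coprime, [q1]
    and [q2] because a common divisor divides [p1], [p2] and [q], so this equates two reduced
    fractions. *)
Lemma cofactors_of_gcd (q p1 p2 a1 a2 g b1 b2 q1 q2 : int) : 0 < q ->
  gcdz (gcdz p1 p2) q = 1 -> q1 = gcdz p1 q -> q2 = gcdz p2 q ->
  q = a1 * q1 -> q = a2 * q2 -> g = gcdz a1 a2 -> a1 = b1 * g -> a2 = b2 * g ->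
  q1 = b2 /\ q2 = b1.
Proof.
move=> q0 g1 q1E q2E e1 e2 gE eb1 eb2.
have pos (u v : int) : 0 < u -> 0 <= v -> forall w : int, u = w * v -> 0 < w /\ 0 < v.
  move=> u0 v0 w uE; have v1 : 0 < v.
    by rewrite lt_def v0 andbT; apply/eqP => e; move: u0; rewrite uE e mulr0 ltxx.
  by move: u0; rewrite uE pmulr_lgt0.
have qq1 : 0 <= q1 by rewrite q1E.
have qq2 : 0 <= q2 by rewrite q2E.
have gg : 0 <= g by rewrite gE.
have [a10 q10] := pos _ _ q0 qq1 a1 e1.
have [a20 q20] := pos _ _ q0 qq2 a2 e2.
have [b10 g0] := pos _ _ a10 gg b1 eb1.
have [b20 _] := pos _ _ a20 gg b2 eb2.
have bq : b1 * q1 = b2 * q2.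
  apply: (mulIf (lt0r_neq0 g0)).
  by rewrite mulrAC -eb1 -e1 e2 {1}eb2 mulrAC.
have cq : coprimez q1 q2.
  suff : (gcdz q1 q2 %| gcdz (gcdz p1 p2) q)%Z by rewrite g1 dvdz1.
  have d1 := dvdz_gcdl q1 q2; have d2 := dvdz_gcdr q1 q2.
  have h1 : (q1 %| p1)%Z by rewrite q1E dvdz_gcdl.
  have h2 : (q2 %| p2)%Z by rewrite q2E dvdz_gcdl.
  have h3 : (q1 %| q)%Z by rewrite q1E dvdz_gcdr.
  by rewrite !dvdz_gcd (dvdz_trans d1 h1) (dvdz_trans d2 h2) (dvdz_trans d1 h3).
have cb : coprimez b1 b2.
  have := mulz_gcdl b1 b2 g; rewrite -eb1 -eb2 -gE gez0_abs// -[RHS]mul1r.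
  by move=> /(mulIf (lt0r_neq0 g0))/eqP.
have antisym (u v : int) : 0 < u -> 0 < v -> (u %| v)%Z -> (v %| u)%Z -> u = v.
  move=> u0 v0; rewrite !dvdzE => uv vu; have : `|u|%N = `|v|%N by apply/eqP; rewrite eqn_dvd uv vu.
  by move=> h; rewrite -(gez0_abs (ltW u0)) h gez0_abs// ltW.
split; apply: antisym => //.
- by rewrite -(Gauss_dvdzl b2 cq) -bq dvdz_mull.
- by rewrite -(@Gauss_dvdzr b2 b1 q1) ?[coprimez b2 _]coprimez_sym// bq dvdz_mulr.
- by rewrite -(@Gauss_dvdzl q2 b1 q1) ?[coprimez q2 _]coprimez_sym// bq dvdz_mull.
- by rewrite -(@Gauss_dvdzr b1 b2 q2)// -bq dvdz_mulr.
Qed.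

Theorem lemma6p5 (R : realType)
  (q ph1 ph2 sh1 sh2 : int)
  (hq : 0 < q)
  (hp_gcd : gcdz (gcdz ph1 ph2) q = 1)
  (hs_gcd : gcdz (gcdz sh1 sh2) q = 1)
  (hp_neq : (ph1 <> ph2 %[mod q])%Z /\ (ph1 <> - ph2 %[mod q])%Z)
  (hs_neq : (sh1 <> sh2 %[mod q])%Z /\ (sh1 <> - sh2 %[mod q])%Z)
  (q11 q21 p1 p2 alphah1 betah1 g1 alpha1 beta1 : int)
  (hq11 : q11 = gcdz ph1 q) (hq21 : q21 = gcdz ph2 q)
  (hp1 : ph1 = p1 * q11) (hp2 : ph2 = p2 * q21)
  (halphah1 : q = alphah1 * q11) (hbetah1 : q = betah1 * q21)
  (hg1 : g1 = gcdz alphah1 betah1)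
  (halpha1 : alphah1 = alpha1 * g1) (hbeta1 : betah1 = beta1 * g1)
  (q12 q22 s1 s2 alphah2 betah2 g2 alpha2 beta2 : int)
  (hq12 : q12 = gcdz sh1 q) (hq22 : q22 = gcdz sh2 q)
  (hs1 : sh1 = s1 * q12) (hs2 : sh2 = s2 * q22)
  (halphah2 : q = alphah2 * q12) (hbetah2 : q = betah2 * q22)
  (hg2 : g2 = gcdz alphah2 betah2)
  (halpha2 : alphah2 = alpha2 * g2) (hbeta2 : betah2 = beta2 * g2)
  (halpha : alpha1 = alpha2) (hbeta : beta1 = beta2) :
  same_heat_expansion (lens_group R q ph1 ph2) (lens_group R q sh1 sh2).
Proof.
have [e1 e2] := cofactors_of_gcd hq hp_gcd hq11 hq21 halphah1 hbetah1 hg1 halpha1 hbeta1.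
have [f1 f2] := cofactors_of_gcd hq hs_gcd hq12 hq22 halphah2 hbetah2 hg2 halpha2 hbeta2.
have [C0 h0] := @theta0_asymptotics R; have [C2 h2] := @theta2_asymptotics R.
case: q hq hp_gcd hs_gcd {hp_neq hs_neq halphah1 hbetah1 halphah2 hbetah2} hq11 hq21 hq12 hq22
  => // N N0 gp gs hq11 hq21 hq12 hq22.
pose w : R := cyclic_weight (gcdn `|ph1| N) + cyclic_weight (gcdn `|ph2| N).
have w2 : w = cyclic_weight (gcdn `|sh1| N) + cyclic_weight (gcdn `|sh2| N).
  (* The cofactors are the gcds in exchanged order, so equal cofactors give equal gcds, on which
     alone [w] depends. *)
  have [E1 E2] : gcdz ph1 N = gcdz sh1 N /\ gcdz ph2 N = gcdz sh2 N.
    by rewrite -hq11 -hq21 -hq12 -hq22 e1 e2 f1 f2 halpha hbeta.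
  by case: E1 E2 => E1 [E2]; rewrite /w -[gcdn `|sh1| N]E1 -[gcdn `|sh2| N]E2.
exists (fun j => (4 * pi) `^ (3 / 2) * heat_coef (C2 / N%:R) (w * C0 / N%:R) j).
by split; apply: lens_heat_expansion.
Qed.
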